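(* Let $a<b$ be real numbers, let $R>0$, and let $F$ be analytic and bounded in the rectangular region $(a,b)\times(0,R)=\{x+iy\in\mathbb{C}: a<x<b,\ 0<y<R\}$. Set $f(x)=\lim_{y\to0^{+}}F(x+iy)$ in $\mathcal{D}'(a,b)$, so that $f\in L^{\infty}(a,b)$. Let $x_{0}\in(a,b)$ be such that the distributional lateral limit $$f(x_{0}+0)=\gamma\quad(\mathrm{L})$$ exists. Then the distributional point value $$f(x_{0})=\gamma\quad(\mathrm{L})$$ also exists. In fact, the point value is of the first order, and thus $$\lim_{x\to x_{0}}\frac{1}{x-x_{0}}\int_{x_{0}}^{x}f(t)\,\mathrm{d}t=\gamma .$$
   Context: The equality $f(x)=\lim_{y\to0^{+}}F(x+iy)$ in $\mathcal{D}'(a,b)$ means that $\langle f,\phi\rangle=\lim_{y\to0^{+}}\int_{a}^{b}F(x+iy)\phi(x)\,\mathrm{d}x$ for every $\phi\in\mathcal{D}(a,b)$ (the smooth functions with compact support in $(a,b)$). Here $\gamma\in\mathbb{C}$. Distributional (Łojasiewicz) point value: for $f\in\mathcal{D}'(a,b)$ and $x_0\in(a,b)$, $f(x_{0})=\gamma$ $(\mathrm{L})$ means that $$\lim_{\varepsilon\to0^{+}}\langle f(x_{0}+\varepsilon x),\phi(x)\rangle=\gamma\int_{-\infty}^{\infty}\phi(x)\,\mathrm{d}x\qquad( * )$$ for every $\phi\in\mathcal{D}(\mathbb{R})$ (the pairing is defined for all sufficiently small $\varepsilon>0$). Distributional lateral limit: $f(x_{0}+0)=\gamma$ $(\mathrm{L})$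 means that $( * )$ holds for every $\phi\in\mathcal{D}(\mathbb{R})$ with (compact) support contained in $(0,\infty)$. Order: let $\partial_{x_{0}}(g)=((x-x_{0})g(x))'$ (distributional derivative). Equivalently to $( * )$, $f(x_0)=\gamma$ $(\mathrm{L})$ if and only if there is $n\in\mathbb{N}$ and $f_{n}$, continuous near $x_{0}$ with $f_{n}(x_{0})=\gamma$, such that $f=\partial_{x_{0}}^{n}f_{n}$ near $x_0$; the point value is then said to be of order $n$. For $f\in L^\infty$ near $x_0$ one has $f_1(x)=\frac{1}{x-x_0}\int_{x_0}^x f(t)\,\mathrm{d}t$ for $x\neq x_0$. *)

(* Defs.v *)
From HB Require Import structures.
From mathcomp Require Import all_boot all_order all_algebra complex.
From mathcomp Require Import all_classical all_reals all_analysis.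

Set Implicit Arguments.
Unset Strict Implicit.
Unset Printing Implicit Defensive.

Import Order.TTheory GRing.Theory Num.Theory.
Import numFieldNormedType.Exports.
Local Open Scope classical_set_scope.
Local Open Scope ring_scope.
Local Open Scope complex_scope.

(* Throughout, [R[i]^o] (convertible to [R[i]]) is only used to select the
   normed-module structure, hence the usual topology, of the complex plane. *)

Definition rectangle (R : realType) (a b r : R) : set R[i] :=
  [set z | [/\ a < complex.Re z, complex.Re z < b,
               0 < complex.Im z & complex.Im z < r]].

(* Since the field of scalars is [R[i]], derivability in the direction 1 is
   complex differentiability. *)
Definition analytic_on (R : realType) (U : set R[i]) (F : R[i] -> R[i]) : Prop :=
  forall z, U z -> derivable (F : R[i]^o -> R[i]^o) z 1.

Definition bounded_on (R : realType) (U : set R[i]) (F : R[i] -> R[i]) : Prop :=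
  exists M : R, forall z, U z -> `|F z| <= M%:C.

Definition Cintegral (R : realType) (A : set R) (g : R -> R[i]) : R[i] :=
  (\int[lebesgue_measure]_(x in A) complex.Re (g x)) +i*
  (\int[lebesgue_measure]_(x in A) complex.Im (g x)).

Definition oriented_integral (R : realType) (c d : R) (g : R -> R[i]) : R[i] :=
  if c <= d then Cintegral `[c, d] g else - Cintegral `[d, c] g.

Definition Cderive (R : realType) (phi : R -> R[i]) : R -> R[i] :=
  fun x => (derive1 (fun t => complex.Re (phi t)) x) +i*
           (derive1 (fun t => complex.Im (phi t)) x).

Definition smooth (R : realType) (phi : R -> R[i]) : Prop :=
  forall n x,
    derivable (fun t => complex.Re (iter n (@Cderive R) phi t)) x 1 /\
    derivable (fun t => complex.Im (iter n (@Cderive R) phi t)) x 1.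

Definition supp (R : realType) (phi : R -> R[i]) : set R :=
  closure [set x | phi x != 0].

Definition test_function (R : realType) (U : set R) (phi : R -> R[i]) : Prop :=
  [/\ smooth phi, compact (supp phi) & supp phi `<=` U].

(* A distribution on U is a total functional, of which only the values on the
   test functions on U are meaningful; in the continuity clause [B] ranges over
   the common upper bounds of the derivatives of [phi] of order at most [N]. *)
Definition is_distribution (R : realType) (U : set R)
    (f : (R -> R[i]) -> R[i]) : Prop :=
  (forall (c : R[i]) phi psi, test_function U phi -> test_function U psi ->
     f (fun x => c * phi x + psi x) = c * f phi + f psi) /\
  (forall K : set R, compact K -> K `<=` U ->
     exists (N : nat) (M : R), forall phi, test_function U phi ->
       supp phi `<=` K ->
       forall B : R,
         (forall k x, (k <= N)%N -> `|iter k (@Cderive R) phi x| <= B%:C) ->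
         `|f phi| <= (M * B)%:C).

Definition boundary_value (R : realType) (a b : R) (F : R[i] -> R[i])
    (f : (R -> R[i]) -> R[i]) : Prop :=
  forall phi, test_function `]a, b[ phi ->
    Cintegral `]a, b[ (fun x => F (x +i* y) * phi x) @[y --> 0^'+]
      --> (f phi : R[i]^o).

Definition regular_distribution (R : realType) (U : set R) (g : R -> R[i]) :
    (R -> R[i]) -> R[i] :=
  fun phi => Cintegral U (fun x => g x * phi x).

Definition eq_distribution (R : realType) (U : set R)
    (f1 f2 : (R -> R[i]) -> R[i]) : Prop :=
  forall phi, test_function U phi -> f1 phi = f2 phi.

Definition Linfty (R : realType) (U : set R) (g : R -> R[i]) : Prop :=
  [/\ measurable_fun U (fun x => complex.Re (g x)),
      measurable_fun U (fun x => complex.Im (g x)) &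
      exists M : R,
        {ae (@lebesgue_measure R), forall x, U x -> `|g x| <= M%:C}].

(* <f(x0 + eps x), phi(x)>, by the change of variables t = x0 + eps x. *)
Definition dilated_pairing (R : realType) (f : (R -> R[i]) -> R[i])
    (x0 eps : R) (phi : R -> R[i]) : R[i] :=
  f (fun t => (eps^-1)%:C * phi ((t - x0) / eps)).

Definition dilation_limit_on (R : realType) (V : set R)
    (f : (R -> R[i]) -> R[i]) (x0 : R) (gamma : R[i]) : Prop :=
  forall phi, test_function V phi ->
    dilated_pairing f x0 eps phi @[eps --> 0^'+]
      --> (gamma * Cintegral setT phi : R[i]^o).

Definition point_value (R : realType) (f : (R -> R[i]) -> R[i])
    (x0 : R) (gamma : R[i]) : Prop :=
  dilation_limit_on setT f x0 gamma.

Definition right_lateral_limit (R : realType) (f : (R -> R[i]) -> R[i])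
    (x0 : R) (gamma : R[i]) : Prop :=
  dilation_limit_on `]0, +oo[ f x0 gamma.

Definition distr_derive (R : realType) (f : (R -> R[i]) -> R[i]) :
    (R -> R[i]) -> R[i] :=
  fun phi => - f (Cderive phi).

Definition distr_mul (R : realType) (h : R -> R[i]) (f : (R -> R[i]) -> R[i]) :
    (R -> R[i]) -> R[i] :=
  fun phi => f (fun x => h x * phi x).

Definition partial_at (R : realType) (x0 : R) (f : (R -> R[i]) -> R[i]) :
    (R -> R[i]) -> R[i] :=
  distr_derive (distr_mul (fun x => (x - x0)%:C) f).

(* The order is not required to be minimal. *)
Definition point_value_of_order (R : realType) (n : nat) (U : set R)
    (f : (R -> R[i]) -> R[i]) (x0 : R) (gamma : R[i]) : Prop :=
  exists (delta : R) (fn : R -> R[i]),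
    let V : set R := (`]x0 - delta, x0 + delta[)%classic in
    [/\ 0 < delta, V `<=` U,
        (forall x, V x -> {for x, continuous (fn : R -> R[i]^o)}),
        fn x0 = gamma &
        eq_distribution V f (iter n (partial_at x0) (regular_distribution V fn))].

(* Main.v *)
Require Import Defs.
From HB Require Import structures.
From mathcomp Require Import all_boot all_order all_algebra complex.
From mathcomp Require Import all_classical all_reals all_analysis.
From mathcomp Require Import ring lra.
Import Order.TTheory GRing.Theory Num.Theory.
Import numFieldNormedType.Exports.
Set Implicit Arguments.
Unset Strict Implicit.
Unset Printing Implicit Defensive.
Local Open Scope classical_set_scope.
Local Open Scope ring_scope.
Local Open Scope complex_scope.

(** Let [G] be a primitive of the bounded analytic function [F], which exists by
    Goursat's theorem. Its partial derivatives are bounded, so it is Lipschitz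
    and extends continuously to the boundary; write [g x] for [G x 0]. Integrating
    by parts against a test function and letting the height tend to zero shows
    that the boundary value [f] exists and is the distributional derivative of
    the Lipschitz function [g] ([boundary_value_primitive]). A Lipschitz
    function has a bounded density, because it is the difference of two
    nondecreasing functions whose Stieltjes measures are dominated by the
    Lebesgue measure ([lipschitz_density]); hence [f] is in L-infinity.

    The whole statement is thus about differentiability of [g] at [x0]. Testing
    the lateral limit on smooth approximations of the characteristic functions
    of the intervals from [eta] to 1 shows that [g] has the right derivative
    [gamma] at [x0] ([right_lateral_derivative]). If [g] is differentiable at
    [x0] with derivative [gamma], then moving the derivative to the dilated test
    function gives the point value ([derivative_point_value]); its order is one,
    with the difference quotient of [g] as [f_1] ([derivative_order_one]); and
    the averages of a density converge, because the density integrates to the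
    increments of [g] ([has_derivative_average]).

    The step from the right derivative to the left one is where analyticity
    enters once more ([left_derivative]). The function [G - g x0 - gamma (z - x0)],
    rescaled around [x0], is bounded on a fixed region of the upper half plane
    and is uniformly small on a fixed segment of the positive axis. A
    two-constants estimate makes it small near a point of the negative axis,
    and the Lipschitz bound carries this down to the axis.

    The two-constants estimate rests on the maximum principle for functions
    with a complex expansion of second order at each point ([maximum_principle]).
    A primitive of a differentiable function has such expansions by the mean
    value inequality alone, and so do Moebius maps and products. *)

Local Notation modc := ComplexField.Normc.normc.
Local Notation mu := lebesgue_measure.

(** * The modulus as a real number *)

Section Modulus.
Context {R : realType}.
Implicit Types z w : R[i].

Lemma modcE z : modc z = Num.sqrt (complex.Re z ^+ 2 + complex.Im z ^+ 2).
Proof. by case: z. Qed.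

Lemma normC_modc z : `|z| = (modc z)%:C.
Proof. by rewrite normc_def modcE. Qed.

Lemma modc_ge0 z : 0 <= modc z.
Proof. by rewrite modcE sqrtr_ge0. Qed.

Lemma modc_sqr z : modc z ^+ 2 = complex.Re z ^+ 2 + complex.Im z ^+ 2.
Proof. by rewrite modcE sqr_sqrtr// addr_ge0// sqr_ge0. Qed.

Lemma modcM z w : modc (z * w) = modc z * modc w.
Proof. exact: ComplexField.Normc.normcM. Qed.

Lemma modcX z n : modc (z ^+ n) = modc z ^+ n.
Proof.
elim: n => [|n IHn]; first by rewrite !expr0 ComplexField.Normc.normc1.
by rewrite !exprS modcM IHn.
Qed.

Lemma modcV z : modc z^-1 = (modc z)^-1.
Proof. exact: ComplexField.Normc.normcV. Qed.

Lemma modcD z w : modc (z + w) <= modc z + modc w.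
Proof. exact: (@le_normcD R). Qed.

Lemma modcN z : modc (- z) = modc z.
Proof. exact: (@normcN R). Qed.

Lemma modc0 : modc (0 : R[i]) = 0.
Proof. exact: ComplexField.Normc.normc0. Qed.

Lemma modcB z w : modc (z - w) <= modc z + modc w.
Proof. by rewrite -(modcN w); exact: modcD. Qed.

Lemma modc_distC z w : modc (z - w) = modc (w - z).
Proof. by rewrite -modcN opprB. Qed.

Lemma modc_trans w z1 z2 : modc (z1 - z2) <= modc (z1 - w) + modc (w - z2).
Proof.
have -> : z1 - z2 = (z1 - w) + (w - z2) by ring.
exact: modcD.
Qed.

Lemma modc_real (x : R) : modc x%:C = `|x|.
Proof. by rewrite modcE /= expr0n addr0 sqrtr_sqr. Qed.

Lemma modc_Re z : `|complex.Re z| <= modc z.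
Proof.
by rewrite modcE -sqrtr_sqr ler_wsqrtr// lerDl sqr_ge0.
Qed.

Lemma modc_Im z : `|complex.Im z| <= modc z.
Proof.
by rewrite modcE -sqrtr_sqr ler_wsqrtr// lerDr sqr_ge0.
Qed.

Lemma modc_le z : modc z <= `|complex.Re z| + `|complex.Im z|.
Proof.
rewrite modcE -[leRHS]ger0_norm ?addr_ge0// -sqrtr_sqr ler_wsqrtr//.
rewrite sqrrD !real_normK ?num_real// -addrA lerD2l lerDr.
by rewrite mulrn_wge0// mulr_ge0.
Qed.

Lemma modc_le2 z (e : R) :
  `|complex.Re z| <= e -> `|complex.Im z| <= e -> modc z <= 2 * e.
Proof. by move=> h1 h2; apply: (le_trans (modc_le z)); lra. Qed.

Lemma modc_eq0 z : modc z = 0 -> z = 0.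
Proof. exact: ComplexField.Normc.eq0_normc. Qed.

Lemma modc_i : modc ('i : R[i]) = 1.
Proof. by rewrite modcE /= expr0n expr1n add0r sqrtr1. Qed.

Lemma le_normC z (M : R) : (`|z| <= M%:C) = (modc z <= M).
Proof. by rewrite normC_modc lecR. Qed.

End Modulus.

(** * Functions of a real variable with complex values *)

Section ComplexDerivative.
Context {R : realType}.
Implicit Types (V W : R -> R[i]) (x : R) (c d : R[i]).

Definition Cis_derive W x d :=
  is_derive x 1 (fun t => complex.Re (W t)) (complex.Re d) /\
  is_derive x 1 (fun t => complex.Im (W t)) (complex.Im d).

Lemma CReM c d : complex.Re (c * d) =
  complex.Re c * complex.Re d - complex.Im c * complex.Im d.
Proof. by case: c => ? ?; case: d. Qed.

Lemma CImM c d : complex.Im (c * d) =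
  complex.Re c * complex.Im d + complex.Im c * complex.Re d.
Proof. by case: c => ? ?; case: d. Qed.

Lemma ReD c d : complex.Re (c + d) = complex.Re c + complex.Re d.
Proof. by case: c => ? ?; case: d. Qed.

Lemma ImD c d : complex.Im (c + d) = complex.Im c + complex.Im d.
Proof. by case: c => ? ?; case: d. Qed.

Lemma ReN c : complex.Re (- c) = - complex.Re c.
Proof. by case: c. Qed.

Lemma ImN c : complex.Im (- c) = - complex.Im c.
Proof. by case: c. Qed.

Definition ReImE := (CReM, CImM, ReD, ImD, ReN, ImN).

Lemma complex_ext c d : complex.Re c = complex.Re d -> complex.Im c = complex.Im d ->
  c = d.
Proof. by case: c => ? ?; case: d => ? ? /= -> ->. Qed.

Lemma Cis_derive_cst c x : Cis_derive (fun=> c) x 0.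
Proof. by split; exact: is_derive_cst. Qed.

Lemma Cis_deriveD V W x c d : Cis_derive V x c -> Cis_derive W x d ->
  Cis_derive (fun t => V t + W t) x (c + d).
Proof.
move=> [v1 v2] [w1 w2]; split.
- rewrite ReD (_ : (fun t => _) = (fun t => complex.Re (V t)) +
    (fun t => complex.Re (W t))); last by apply/funext => t; rewrite ReD.
  exact: is_deriveD.
- rewrite ImD (_ : (fun t => _) = (fun t => complex.Im (V t)) +
    (fun t => complex.Im (W t))); last by apply/funext => t; rewrite ImD.
  exact: is_deriveD.
Qed.

Lemma Cis_deriveN W x d : Cis_derive W x d -> Cis_derive (fun t => - W t) x (- d).
Proof.
move=> [w1 w2]; split.
- rewrite ReN (_ : (fun t => _) = - (fun t => complex.Re (W t))).
    exact: is_deriveN.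
  by apply/funext => t; rewrite ReN.
- rewrite ImN (_ : (fun t => _) = - (fun t => complex.Im (W t))).
    exact: is_deriveN.
  by apply/funext => t; rewrite ImN.
Qed.

Lemma Cis_deriveB V W x c d : Cis_derive V x c -> Cis_derive W x d ->
  Cis_derive (fun t => V t - W t) x (c - d).
Proof. by move=> dV dW; apply: Cis_deriveD => //; exact: Cis_deriveN. Qed.

Lemma Cis_deriveM V W x c d : Cis_derive V x c -> Cis_derive W x d ->
  Cis_derive (fun t => V t * W t) x (c * W x + V x * d).
Proof.
move=> [v1 v2] [w1 w2]; split.
- rewrite (_ : (fun t => _) =
    (fun t => complex.Re (V t)) * (fun t => complex.Re (W t)) -
    (fun t => complex.Im (V t)) * (fun t => complex.Im (W t))); last first.
    by apply/funext => t; rewrite CReM.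
  apply: (is_derive_eq (is_deriveB (is_deriveM v1 w1) (is_deriveM v2 w2))).
  by rewrite !ReImE /GRing.scale/=; ring.
- rewrite (_ : (fun t => _) =
    (fun t => complex.Re (V t)) * (fun t => complex.Im (W t)) +
    (fun t => complex.Im (V t)) * (fun t => complex.Re (W t))); last first.
    by apply/funext => t; rewrite CImM.
  apply: (is_derive_eq (is_deriveD (is_deriveM v1 w2) (is_deriveM v2 w1))).
  by rewrite !ReImE /GRing.scale/=; ring.
Qed.

Lemma is_derive_line (p q x : R) : is_derive x 1 (fun t : R => p + t * q) q.
Proof.
have d1 : is_derive x 1 (fun t : R => t * q) q.
  have := is_deriveM (is_derive_id x (1 : R)) (is_derive_cst q x (1 : R)).
  by rewrite scaler0 add0r /GRing.scale/= mulr1.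
have := is_deriveD (is_derive_cst p x (1 : R)) d1.
by rewrite add0r.
Qed.

Lemma Cis_derive_line (p q : R[i]) x :
  Cis_derive (fun t : R => p + t%:C * q) x q.
Proof.
split.
- rewrite (_ : (fun t => _) = (fun t : R => complex.Re p + t * complex.Re q)).
    exact: is_derive_line.
  by apply/funext => t; rewrite !ReImE/= mul0r subr0.
- rewrite (_ : (fun t => _) = (fun t : R => complex.Im p + t * complex.Im q)).
    exact: is_derive_line.
  by apply/funext => t; rewrite !ReImE/= mul0r addr0.
Qed.

Lemma Cis_derive_eq W x c d : Cis_derive W x c -> c = d -> Cis_derive W x d.
Proof. by move=> ? <-. Qed.

Lemma mean_value_le (f f' : R -> R) (a b K : R) : a <= b ->
  (forall x, a <= x <= b -> is_derive x 1 f (f' x)) ->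
  (forall x, a <= x <= b -> `|f' x| <= K) -> `|f b - f a| <= K * (b - a).
Proof.
rewrite le_eqVlt => /predU1P[-> _ _|ab df f'K]; first by rewrite !subrr normr0 mulr0.
have [c cab ->] : exists2 c, c \in `]a, b[ & f b - f a = f' c * (b - a).
  apply: MVT => // [x|]; first by rewrite in_itv/= => /andP[/ltW ax /ltW xb];
    apply: df; rewrite ax.
  apply: derivable_within_continuous => x; rewrite in_itv/= => xab.
  by have [] := df x xab.
rewrite normrM (@gtr0_norm _ (b - a)) ?subr_gt0//; apply: ler_wpM2r.
  by rewrite subr_ge0 ltW.
by apply: f'K; move: cab; rewrite in_itv/= => /andP[/ltW -> /ltW ->].
Qed.

(** The factor 2 pays for estimating the two components separately. *)
Lemma Cmean_value_le W W' (a b K : R) : a <= b ->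
  (forall x, a <= x <= b -> Cis_derive W x (W' x)) ->
  (forall x, a <= x <= b -> modc (W' x) <= K) ->
  modc (W b - W a) <= 2 * (K * (b - a)).
Proof.
move=> ab dW W'K; apply: modc_le2; rewrite !ReImE.
- apply: (@mean_value_le (fun t => complex.Re (W t))
    (fun t => complex.Re (W' t))) => // x xab; first by case: (dW x xab).
  exact: le_trans (modc_Re _) (W'K x xab).
- apply: (@mean_value_le (fun t => complex.Im (W t))
    (fun t => complex.Im (W' t))) => // x xab; first by case: (dW x xab).
  exact: le_trans (modc_Im _) (W'K x xab).
Qed.

End ComplexDerivative.

(** * Antiderivatives *)

Lemma is_derive_derive1 (R : realType) (f : R -> R) (x d : R) :
  derivable f x 1 -> derive1 f x = d -> is_derive x 1 f d.
Proof. by move=> df fd; apply: (DeriveDef df); rewrite -derive1E. Qed.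

Lemma segment_sub_oo (R : realType) (a b c d : R) : a < c -> d < b ->
  `[c, d] `<=` `]a, b[.
Proof.
move=> ac db x /=; rewrite !in_itv/= => /andP[cx xd].
by rewrite (lt_le_trans ac cx) (le_lt_trans xd db).
Qed.

Lemma continuous_oo_measurable (R : realType) (f : R -> R) (a b : R) :
  (forall x, a < x < b -> {for x, continuous f}) -> measurable_fun `]a, b[ f.
Proof.
move=> cf; apply: measurable_realfun.open_continuous_measurable_fun.
  exact: interval_open.
by move=> x; rewrite inE/= in_itv/=; exact: cf.
Qed.

Lemma bounded_itv_integrable (R : realType) (f : R -> R) (i : interval R)
    (a b K : R) : [set` i] `<=` `]a, b[ -> measurable_fun `]a, b[ f ->
  (forall x, a < x < b -> `|f x| <= K) -> mu.-integrable [set` i] (EFin \o f).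
Proof.
move=> iab mf fK; apply: measurable_bounded_integrable => //.
- apply: (@le_lt_trans _ _ (mu `]a, b[%classic)).
    by apply: le_measure => //; rewrite inE.
  by rewrite lebesgue_measure_itv/=; case: ifP; rewrite ?ltry// -EFinB ltry.
- exact: measurable_funS mf.
- exists K; split; first by rewrite num_real.
  move=> M KM x /= ix; apply: le_trans (ltW KM); apply: fK.
  by have := iab _ ix; rewrite /= in_itv.
Qed.

Lemma antiderivative (R : realType) (f : R -> R) (a b K : R) :
  (forall x, a < x < b -> {for x, continuous f}) ->
  (forall x, a < x < b -> `|f x| <= K) ->
  exists P : R -> R, forall x, a < x < b -> is_derive x 1 P (f x).
Proof.
move=> cf fK.
exists (fun y => \int[mu]_(t in `]a, y]) f t) => x /andP[ax xb].
have [|||dF F'] := @continuous_FTC1 R f (BRight a) x ((x + b) / 2) _ _ ax.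
- by lra.
- apply: (bounded_itv_integrable (a := a) (b := b)) fK => //.
    move=> t /=; rewrite !in_itv/= => /andP[-> /= tx]; lra.
  exact: continuous_oo_measurable.
- by apply: cf; rewrite ax.
exact: is_derive_derive1 dF F'.
Qed.

Section ComplexAntiderivative.
Context {R : realType}.

Definition Ccontinuous_at (W : R -> R[i]) (x : R) :=
  {for x, continuous (fun t => complex.Re (W t))} /\
  {for x, continuous (fun t => complex.Im (W t))}.

Lemma Ccontinuous_eps (W : R -> R[i]) (x : R) :
  (forall e, 0 < e -> exists2 d, 0 < d &
     forall t, `|t - x| < d -> modc (W t - W x) <= e) -> Ccontinuous_at W x.
Proof.
move=> cW; split; apply/(@cvgrPdist_le _ R^o) => e /cW[d d0 Wd].
- apply/nbhs_normP; exists d => //= t /= xt.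
  have Wt : modc (W t - W x) <= e by apply: Wd; rewrite distrC.
  apply: le_trans Wt; rewrite distrC.
  by have := modc_Re (W t - W x); rewrite !ReImE.
- apply/nbhs_normP; exists d => //= t /= xt.
  have Wt : modc (W t - W x) <= e by apply: Wd; rewrite distrC.
  apply: le_trans Wt; rewrite distrC.
  by have := modc_Im (W t - W x); rewrite !ReImE.
Qed.

Lemma Cantiderivative (W : R -> R[i]) (a b K : R) :
  (forall x, a < x < b -> Ccontinuous_at W x) ->
  (forall x, a < x < b -> modc (W x) <= K) ->
  exists P : R -> R[i], forall x, a < x < b -> Cis_derive P x (W x).
Proof.
move=> cW WK.
have [P1 dP1] : exists P1 : R -> R, forall x, a < x < b ->
    is_derive x 1 P1 (complex.Re (W x)).
  apply: (@antiderivative _ _ _ _ K) => x xab; first by case: (cW x xab).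
  exact: le_trans (modc_Re _) (WK x xab).
have [P2 dP2] : exists P2 : R -> R, forall x, a < x < b ->
    is_derive x 1 P2 (complex.Im (W x)).
  apply: (@antiderivative _ _ _ _ K) => x xab; first by case: (cW x xab).
  exact: le_trans (modc_Im _) (WK x xab).
by exists (fun x => P1 x +i* P2 x) => x xab; split; [exact: dP1|exact: dP2].
Qed.

End ComplexAntiderivative.

(** * Holomorphic functions on a rectangle have primitives *)

Section Differentiability.
Context {R : realType}.
Implicit Types (F T : R[i] -> R[i]) (z h D : R[i]).

(** Complex differentiability in terms of the real-valued modulus. *)
Definition Cdiff F z D := forall e : R, 0 < e -> exists2 d : R, 0 < d &
  forall h, modc h <= d -> modc (F (z + h) - F z - D * h) <= e * modc h.

Lemma derivable_Cdiff F z : derivable (F : R[i]^o -> R[i]^o) z 1 ->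
  exists D, Cdiff F z D.
Proof.
move=> /cvg_ex[/= D FD]; exists D => e e0.
have e0C : 0 < e%:C by rewrite ltcR.
move/(@cvgrPdist_le _ R[i]^o): FD => /(_ _ e0C).
rewrite near_withinE => /nbhs_normP[/= d d0 Hd].
have dE : d = (complex.Re d)%:C.
  by move: d0; rewrite ltcE => /andP[/eqP]; case: d Hd => ? ? _ /= ->.
have d0R : 0 < complex.Re d by rewrite -ltcR -dE.
exists (complex.Re d / 2); first by rewrite divr_gt0.
move=> h hd; have [->|h0] := eqVneq h 0.
  by rewrite addr0 subrr mulr0 subr0 modc0 mulr0.
have hd' : `|0 - h| < d.
  by rewrite sub0r normrN normC_modc dE ltcR; lra.
have /= := Hd h hd' h0.
rewrite le_normC /GRing.scale/= mulr1 [h + z]addrC => Fh.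
have -> : F (z + h) - F z - D * h = - ((D - h^-1 * (F (z + h) - F z)) * h).
  by rewrite mulrBl [h^-1 * _]mulrC mulfVK//; ring.
by rewrite modcN modcM ler_wpM2r// modc_ge0.
Qed.

Lemma Cdiff_continuous F z D : Cdiff F z D -> forall e : R, 0 < e ->
  exists2 d : R, 0 < d & forall h, modc h < d -> modc (F (z + h) - F z) <= e.
Proof.
move=> /(_ 1 ltr01)[d d0 Fd] e e0.
have D1 : 0 < 1 + modc D by rewrite ltr_pwDl// modc_ge0.
exists (Num.min d (e / (1 + modc D))); first by rewrite lt_min d0 divr_gt0.
move=> h; rewrite lt_min => /andP[hd he].
have -> : F (z + h) - F z = (F (z + h) - F z - D * h) + D * h by ring.
apply: (le_trans (modcD _ _)); rewrite modcM.
have := Fd h (ltW hd); rewrite mul1r.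
by move: he; rewrite ltr_pdivlMr// => he Fh; nra.
Qed.

Lemma Cdiff_horizontal F (x y : R) D : Cdiff F (x +i* y) D ->
  Ccontinuous_at (fun s => F (s +i* y)) x.
Proof.
move=> FD; apply: Ccontinuous_eps => e e0.
have [d d0 Fd] := Cdiff_continuous FD e0; exists d => // t td.
have -> : t +i* y = x +i* y + (t - x)%:C by apply: complex_ext; rewrite !ReImE/=; lra.
by apply: Fd; rewrite modc_real.
Qed.

End Differentiability.

Section Primitive.
Context {R : realType}.
Implicit Types (x y l m : R).

Lemma nested_segments (u v : nat -> R) : (forall n, u n <= u n.+1) ->
  (forall n, v n.+1 <= v n) -> (forall n, u n <= v n) ->
  exists c, forall n, u n <= c <= v n.
Proof.
move=> uS vS uv.
have um n k : u n <= u (n + k)%N.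
  by elim: k => [|k IHk]; rewrite ?addn0// addnS (le_trans IHk).
have vm n k : v (n + k)%N <= v n.
  by elim: k => [|k IHk]; rewrite ?addn0// addnS (le_trans _ IHk).
have ubv n : ubound (range u) (v n).
  move=> _ [k _ <-]; apply: (le_trans (um k n)); rewrite addnC.
  exact: le_trans (uv _) (vm _ _).
exists (sup (range u)) => n; apply/andP; split.
  by apply: ub_le_sup; [exists (v 0%N)|exists n].
by apply: ge_sup => //; exists (u 0%N); exists 0%N.
Qed.

Lemma exists_halving (C d : R) : 0 < d -> exists n, C / 2 ^+ n <= d.
Proof.
move=> d0; exists (Num.bound (C / d)).
have := upper_nthrootP (leqnn (Num.bound (C / d))).
rewrite ltr_pdivrMr// => /ltW.
by rewrite ler_pdivrMr ?exprn_gt0// mulrC.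
Qed.

Variables (F : R[i] -> R[i]) (a b r M : R).
Hypothesis dF : forall x y, a < x < b -> 0 < y < r ->
  exists D, Cdiff F (x +i* y) D.
Hypothesis FM : forall x y, a < x < b -> 0 < y < r -> modc (F (x +i* y)) <= M.

Lemma horizontal_antiderivative : exists P : R -> R -> R[i],
  forall x y, a < x < b -> 0 < y < r ->
    Cis_derive (fun s => P s y) x (F (x +i* y)).
Proof.
suff /choice[P HP] : forall y, exists P : R -> R[i], 0 < y < r ->
    forall x, a < x < b -> Cis_derive P x (F (x +i* y)).
  by exists (fun x y => P y x) => x y xab yr; exact: HP.
move=> y; case: (boolP (0 < y < r)) => [y0r|_]; last by exists (fun=> 0).
have [||P HP] := @Cantiderivative R (fun x => F (x +i* y)) a b M.
- by move=> x xab; have [D FD] := dF xab y0r; exact: Cdiff_horizontal FD.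
- by move=> x xab; exact: FM.
by exists P => _; exact: HP.
Qed.

Lemma vertical_antiderivative : exists Q : R -> R -> R[i],
  forall x y, a < x < b -> 0 < y < r ->
    Cis_derive (Q x) y (F (x +i* y) * 'i).
Proof.
suff /choice[Q HQ] : forall x, exists Q : R -> R[i], a < x < b ->
    forall y, 0 < y < r -> Cis_derive Q y (F (x +i* y) * 'i).
  by exists Q => x y xab yr; exact: HQ.
move=> x; case: (boolP (a < x < b)) => [xab|_]; last by exists (fun=> 0).
have [||Q HQ] := @Cantiderivative R (fun y => F (x +i* y) * 'i) 0 r M.
- move=> y y0r; apply: Ccontinuous_eps => e e0.
  have [D FD] := dF xab y0r.
  have [d d0 Fd] := Cdiff_continuous FD e0; exists d => // t td.
  have -> : t = y + (t - y) by ring.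
  rewrite -mulrBl modcM modc_i mulr1.
  have -> : x +i* (y + (t - y)) = x +i* y + (t - y)%:C * 'i.
    by apply: complex_ext; rewrite !ReImE/=; lra.
  by apply: Fd; rewrite modcM modc_i mulr1 modc_real.
- by move=> y y0r; rewrite modcM modc_i mulr1; exact: FM.
by exists Q => _; exact: HQ.
Qed.

(** The second Taylor polynomial of a primitive of [F], at a point where [F]
    has the value [A] and the derivative [D]. *)
Definition taylor (z0 A D w : R[i]) : R[i] :=
  A * (w - z0) + D * ((w - z0) * (w - z0)) * 2^-1.

Lemma taylor_derive z0 A D p q (t : R) :
  Cis_derive (fun s : R => taylor z0 A D (p + s%:C * q)) t
    ((A + D * (p + t%:C * q - z0)) * q).
Proof.
have dw : Cis_derive (fun s : R => p + s%:C * q - z0) t (q - 0).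
  exact: (Cis_deriveB (Cis_derive_line _ _ _) (Cis_derive_cst _ _)).
rewrite /taylor; apply: Cis_derive_eq.
  apply: Cis_deriveD; first exact: (Cis_deriveM (Cis_derive_cst _ _) dw).
  apply: Cis_deriveM; last exact: Cis_derive_cst.
  by apply: (Cis_deriveM (Cis_derive_cst _ _)); exact: (Cis_deriveM dw dw).
by cbv beta; field.
Qed.

Section Increments.
Variables (P Q : R -> R -> R[i]).
Hypothesis dP : forall x y, a < x < b -> 0 < y < r ->
  Cis_derive (fun s => P s y) x (F (x +i* y)).
Hypothesis dQ : forall x y, a < x < b -> 0 < y < r ->
  Cis_derive (Q x) y (F (x +i* y) * 'i).

(** Along a segment, the difference of an antiderivative of [F] and the Taylor
    polynomial has the derivative [F] minus its affine approximation, so the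
    mean value inequality applies. *)
Lemma horizontal_increment x1 x2 y z0 A D K : x1 <= x2 -> a < x1 -> x2 < b ->
  0 < y < r -> (forall x, x1 <= x <= x2 ->
    modc (F (x +i* y) - A - D * (x +i* y - z0)) <= K) ->
  modc ((P x2 y - P x1 y) -
    (taylor z0 A D (x2 +i* y) - taylor z0 A D (x1 +i* y))) <= 2 * (K * (x2 - x1)).
Proof.
move=> x12 ax1 x2b y0r FK.
have lineE x : x +i* y = (0 +i* y) + x%:C * 1 by apply: complex_ext; rewrite !ReImE/=; lra.
have := @Cmean_value_le R (fun s => P s y - taylor z0 A D (s +i* y))
  (fun s => F (s +i* y) - (A + D * (s +i* y - z0))) x1 x2 K x12.
have -> : P x2 y - P x1 y - (taylor z0 A D (x2 +i* y) - taylor z0 A D (x1 +i* y)) =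
  P x2 y - taylor z0 A D (x2 +i* y) - (P x1 y - taylor z0 A D (x1 +i* y)) by ring.
apply => x x12'; last by rewrite opprD addrA; exact: FK.
apply: Cis_deriveB; first by apply: dP => //; lra.
rewrite (_ : (fun s => _) = fun s => taylor z0 A D ((0 +i* y) + s%:C * 1)).
  by rewrite lineE -[X in Cis_derive _ _ X]mulr1; exact: taylor_derive.
by apply/funext => s; rewrite -lineE.
Qed.

Lemma vertical_increment x y1 y2 z0 A D K : y1 <= y2 -> 0 < y1 -> y2 < r ->
  a < x < b -> (forall y, y1 <= y <= y2 ->
    modc (F (x +i* y) - A - D * (x +i* y - z0)) <= K) ->
  modc ((Q x y2 - Q x y1) -
    (taylor z0 A D (x +i* y2) - taylor z0 A D (x +i* y1))) <= 2 * (K * (y2 - y1)).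
Proof.
move=> y12 y10 y2r xab FK.
have lineE y : x +i* y = x%:C + y%:C * 'i by apply: complex_ext; rewrite !ReImE/=; lra.
have := @Cmean_value_le R (fun s => Q x s - taylor z0 A D (x +i* s))
  (fun s => (F (x +i* s) - (A + D * (x +i* s - z0))) * 'i) y1 y2 K y12.
have -> : Q x y2 - Q x y1 - (taylor z0 A D (x +i* y2) - taylor z0 A D (x +i* y1)) =
  Q x y2 - taylor z0 A D (x +i* y2) - (Q x y1 - taylor z0 A D (x +i* y1)) by ring.
apply => y y12'; last first.
  by rewrite modcM modc_i mulr1 opprD addrA; exact: FK.
rewrite mulrBl; apply: Cis_deriveB; first by apply: dQ => //; lra.
rewrite (_ : (fun s => _) = fun s => taylor z0 A D (x%:C + s%:C * 'i)).
  by rewrite lineE; exact: taylor_derive.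
by apply/funext => s; rewrite -lineE.
Qed.

(** The integral of [F] around the rectangle with lower left corner [x + iy],
    width [l] and height [m], in terms of antiderivatives along the sides. *)
Let E x y l m := (P (x + l) y - P x y) + (Q (x + l) (y + m) - Q (x + l) y)
  - (P (x + l) (y + m) - P x (y + m)) - (Q x (y + m) - Q x y).

Lemma quarter x y l m : exists p : R * R,
  [/\ p.1 = x \/ p.1 = x + l / 2, p.2 = y \/ p.2 = y + m / 2 &
      modc (E x y l m) <= 4 * modc (E p.1 p.2 (l / 2) (m / 2))].
Proof.
have EE : E x y l m = E x y (l / 2) (m / 2) + E (x + l / 2) y (l / 2) (m / 2) +
    E x (y + m / 2) (l / 2) (m / 2) + E (x + l / 2) (y + m / 2) (l / 2) (m / 2).
  have xl : x + l / 2 + l / 2 = x + l by lra.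
  have ym : y + m / 2 + m / 2 = y + m by lra.
  by rewrite /E xl ym; ring.
apply: contrapT => H.
have {}H p1 p2 : p1 = x \/ p1 = x + l / 2 -> p2 = y \/ p2 = y + m / 2 ->
    4 * modc (E p1 p2 (l / 2) (m / 2)) < modc (E x y l m).
  move=> h1 h2; rewrite ltNge; apply/negP => h3; apply: H.
  by exists (p1, p2).
have h1 := H _ _ (or_introl erefl) (or_introl erefl).
have h2 := H _ _ (or_intror erefl) (or_introl erefl).
have h3 := H _ _ (or_introl erefl) (or_intror erefl).
have h4 := H _ _ (or_intror erefl) (or_intror erefl).
have := modcD (E x y (l / 2) (m / 2) + E (x + l / 2) y (l / 2) (m / 2) +
    E x (y + m / 2) (l / 2) (m / 2)) (E (x + l / 2) (y + m / 2) (l / 2) (m / 2)).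
have := modcD (E x y (l / 2) (m / 2) + E (x + l / 2) y (l / 2) (m / 2))
    (E x (y + m / 2) (l / 2) (m / 2)).
have := modcD (E x y (l / 2) (m / 2)) (E (x + l / 2) y (l / 2) (m / 2)).
rewrite -EE; lra.
Qed.

(** The four Taylor increments add up to zero: the integral of the affine
    approximation of [F] around the rectangle vanishes, so only the error [e] of
    the approximation contributes. *)
Lemma small_rectangle x y l m z0 A D e : 0 <= l -> 0 <= m -> a < x ->
  x + l < b -> 0 < y -> y + m < r ->
  (forall x' y', x <= x' <= x + l -> y <= y' <= y + m ->
    modc (F (x' +i* y') - A - D * (x' +i* y' - z0)) <= e) ->
  modc (E x y l m) <= 4 * (e * (l + m)).
Proof.
move=> l0 m0 ax xb y0 yr FK.
have xl : x <= x + l by lra.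
have ym : y <= y + m by lra.
have [xx xe] : x <= x <= x + l /\ x <= x + l <= x + l by rewrite !lexx xl.
have [yy ye] : y <= y <= y + m /\ y <= y + m <= y + m by rewrite !lexx ym.
have [x1 x2] : a < x < b /\ a < x + l < b by split; lra.
have [y1 y2] : 0 < y < r /\ 0 < y + m < r by split; lra.
have h1 := horizontal_increment xl ax xb y1 (fun t ht => FK t y ht yy).
have h2 := horizontal_increment xl ax xb y2 (fun t ht => FK t (y + m) ht ye).
have v1 := vertical_increment ym y0 yr x2 (fun t ht => FK (x + l) t xe ht).
have v2 := vertical_increment ym y0 yr x1 (fun t ht => FK x t xx ht).
move: h1; set H1 := (X in modc X) => h1; move: h2; set H2 := (X in modc X) => h2.
move: v1; set V1 := (X in modc X) => v1; move: v2; set V2 := (X in modc X) => v2.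
have -> : E x y l m = H1 + V1 - H2 - V2 by rewrite /E/H1/H2/V1/V2; ring.
have := modcB (H1 + V1 - H2) V2; have := modcB (H1 + V1) H2.
have := modcD H1 V1; lra.
Qed.

(** Repeated quartering keeps the integral around a quarter from dropping below
    a fourth of the previous one, which contradicts [small_rectangle] at the
    point to which the quarters shrink. *)
Lemma goursat x y l m : 0 <= l -> 0 <= m -> a < x -> x + l < b ->
  0 < y -> y + m < r -> E x y l m = 0.
Proof.
move=> l0 m0 ax xb y0 yr; apply: modc_eq0; apply/eqP.
rewrite eq_le modc_ge0 andbT leNgt; apply/negP => E0.
pose ln n : R := l / 2 ^+ n; pose mn n : R := m / 2 ^+ n.
have p2 n : 0 < 2 ^+ n :> R by rewrite exprn_gt0.
have ln0 n : 0 <= ln n by rewrite divr_ge0// ltW.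
have mn0 n : 0 <= mn n by rewrite divr_ge0// ltW.
have lnS n : ln n / 2 = ln n.+1 by rewrite /ln exprSr invfM mulrA.
have mnS n : mn n / 2 = mn n.+1 by rewrite /mn exprSr invfM mulrA.
have [f [f0 Hf]] : exists f : nat -> R * R, f 0%N = (x, y) /\ forall n,
    [/\ (f n.+1).1 = (f n).1 \/ (f n.+1).1 = (f n).1 + ln n.+1,
    (f n.+1).2 = (f n).2 \/ (f n.+1).2 = (f n).2 + mn n.+1 &
    modc (E (f n).1 (f n).2 (ln n) (mn n)) <=
      4 * modc (E (f n.+1).1 (f n.+1).2 (ln n.+1) (mn n.+1))].
  have [g Hg] := choice (fun np : nat * (R * R) =>
    quarter np.2.1 np.2.2 (ln np.1) (mn np.1)).
  pose p := fix p n := if n is n'.+1 then g (n', p n') else (x, y).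
  exists p; split => // n.
  by rewrite -lnS -mnS; exact: (Hg (n, p n)).
have EP n : modc (E x y l m) <=
    4 ^+ n * modc (E (f n).1 (f n).2 (ln n) (mn n)).
  elim: n => [|n IHn]; first by rewrite f0 mul1r /ln /mn expr0 !divr1.
  apply: (le_trans IHn); rewrite exprSr -mulrA ler_wpM2l ?exprn_ge0//.
  by have [] := Hf n.
have [cx cxP] : exists c, forall n, (f n).1 <= c <= (f n).1 + ln n.
  apply: nested_segments => n; have [h1 _ _] := Hf n; have := ln0 n.+1;
    have := lnS n; by move=> e; case: h1 => h1; lra.
have [cy cyP] : exists c, forall n, (f n).2 <= c <= (f n).2 + mn n.
  apply: nested_segments => n; have [_ h1 _] := Hf n; have := mn0 n.+1;
    have := mnS n; by move=> e; case: h1 => h1; lra.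
have fx n : x <= (f n).1 /\ (f n).1 + ln n <= x + l.
  elim: n => [|n [h1 h2]]; first by rewrite f0 /ln expr0 divr1.
  have [h _ _] := Hf n; have := ln0 n.+1; have := lnS n.
  by case: h => h; lra.
have fy n : y <= (f n).2 /\ (f n).2 + mn n <= y + m.
  elim: n => [|n [h1 h2]]; first by rewrite f0 /mn expr0 divr1.
  have [_ h _] := Hf n; have := mn0 n.+1; have := mnS n.
  by case: h => h; lra.
have [D FD] : exists D, Cdiff F (cx +i* cy) D.
  apply: dF; first by have := cxP 0%N; rewrite f0 /= /ln expr0 divr1; lra.
  by have := cyP 0%N; rewrite f0 /= /mn expr0 divr1; lra.
have lm0 : 0 < l + m.
  rewrite lt_neqAle addr_ge0// andbT; apply/eqP => lm.
  have [le me] : l = 0 /\ m = 0 by lra.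
  by move: E0; rewrite /E le me !addr0 !subrr !addr0 !subr0 modc0 ltxx.
pose e := modc (E x y l m) / (8 * (l + m) ^+ 2).
have e0 : 0 < e by rewrite divr_gt0// mulr_gt0// exprn_gt0.
have [d d0 Fd] := FD _ e0.
have [n nd] := exists_halving (l + m) d0.
have lmn : ln n + mn n = (l + m) / 2 ^+ n by rewrite /ln /mn -mulrDl.
have [fx1 fx2] := fx n; have [fy1 fy2] := fy n.
have inR : [/\ a < (f n).1, (f n).1 + ln n < b, 0 < (f n).2 & (f n).2 + mn n < r].
  by split; lra.
case: inR => fa fb fpos fr.
have H := @small_rectangle _ _ _ _ (cx +i* cy) (F (cx +i* cy)) D
  (e * (ln n + mn n)) (ln0 n) (mn0 n) fa fb fpos fr.
have {}H : modc (E (f n).1 (f n).2 (ln n) (mn n)) <=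
    4 * (e * (ln n + mn n) * (ln n + mn n)).
  apply: H => x' y' hx' hy'.
  have -> : x' +i* y' = cx +i* cy + (x' +i* y' - (cx +i* cy)) by ring.
  have hh : modc (x' +i* y' - (cx +i* cy)) <= ln n + mn n.
    apply: (le_trans (modc_le _)); rewrite !ReImE /=; have := cxP n.
    by have := cyP n => ? ?; apply: lerD; rewrite ler_norml; lra.
    set w := x' +i* y' - (cx +i* cy) in hh *.
  have -> : cx +i* cy + w - (cx +i* cy) = w by ring.
  apply: (le_trans (Fd _ _)); first by apply: (le_trans hh); rewrite lmn.
  by rewrite ler_wpM2l// ltW.
have := EP n.
have {}H := ler_wpM2l (exprn_ge0 n (ler0n R 4)) H.
move=> /le_trans /(_ H); apply/negP; rewrite -ltNge.
rewrite lmn; set k := (l + m) / 2 ^+ n.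
have -> : 4 ^+ n * (4 * (e * k * k)) = 4 * e * (l + m) ^+ 2.
  have -> : 4 ^+ n = 2 ^+ n * 2 ^+ n :> R by rewrite -exprMn; congr (_ ^+ n); ring.
  by rewrite /k; field; rewrite gt_eqF.
have -> : 4 * e * (l + m) ^+ 2 = modc (E x y l m) / 2.
  by rewrite /e; field; rewrite gt_eqF.
lra.
Qed.

Lemma goursat_rectangle x1 x2 y1 y2 : a < x1 < b -> a < x2 < b ->
  0 < y1 < r -> 0 < y2 < r ->
  P x2 y1 - P x1 y1 + (Q x2 y2 - Q x2 y1) =
  Q x1 y2 - Q x1 y1 + (P x2 y2 - P x1 y2).
Proof.
wlog x12 : x1 x2 / x1 <= x2 => [H hx1 hx2 hy1 hy2|].
  have [/H|/ltW/H] := leP x1 x2; first by apply.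
  move=> /(_ hx2 hx1 hy1 hy2) e; apply/eqP; rewrite -subr_eq0; apply/eqP.
  transitivity (- (P x1 y1 - P x2 y1 + (Q x1 y2 - Q x1 y1)
    - (Q x2 y2 - Q x2 y1 + (P x1 y2 - P x2 y2)))); first by ring.
  by rewrite e subrr oppr0.
wlog y12 : y1 y2 / y1 <= y2 => [H hx1 hx2 hy1 hy2|].
  have [/H|/ltW/H] := leP y1 y2; first by apply.
  move=> /(_ hx1 hx2 hy2 hy1) e; apply/eqP; rewrite -subr_eq0; apply/eqP.
  transitivity (- (P x2 y2 - P x1 y2 + (Q x2 y1 - Q x2 y2)
    - (Q x1 y1 - Q x1 y2 + (P x2 y1 - P x1 y1)))); first by ring.
  by rewrite e subrr oppr0.
move=> hx1 hx2 hy1 hy2.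
have := @goursat x1 y1 (x2 - x1) (y2 - y1).
have -> : x1 + (x2 - x1) = x2 by ring.
have -> : y1 + (y2 - y1) = y2 by ring.
move=> /(_ ltac:(lra) ltac:(lra) ltac:(lra) ltac:(lra) ltac:(lra) ltac:(lra)).
rewrite /E; have -> : x1 + (x2 - x1) = x2 by ring.
have -> : y1 + (y2 - y1) = y2 by ring.
move=> e; apply/eqP; rewrite -subr_eq0; apply/eqP; rewrite -[RHS]e; ring.
Qed.
End Increments.

(** The value at [x + iy] is the integral of [F] along a vertical and then a
    horizontal segment from a base point. By Goursat's theorem the corner can be
    cut the other way round, which gives the derivative in the other
    direction. *)
Lemma primitive : a < b -> 0 < r -> exists G : R -> R -> R[i],
  forall x y, a < x < b -> 0 < y < r ->
    Cis_derive (fun s => G s y) x (F (x +i* y)) /\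
    Cis_derive (G x) y (F (x +i* y) * 'i).
Proof.
move=> ab r0; have [P dP] := horizontal_antiderivative.
have [Q dQ] := vertical_antiderivative.
pose c := (a + b) / 2; pose y0 := r / 2.
have cab : a < c < b by rewrite /c; lra.
have y0r : 0 < y0 < r by rewrite /y0; lra.
exists (fun x y => P x y - P c y + (Q c y - Q c y0)) => x y xab yr; split.
  rewrite -[F _]addr0; apply: Cis_deriveD; last exact: Cis_derive_cst.
  rewrite -[F _]subr0; apply: Cis_deriveB; last exact: Cis_derive_cst.
  exact: dP.
have : Cis_derive (fun t => P x y0 - P c y0 + (Q x t - Q x y0)) y (F (x +i* y) * 'i).
  rewrite -[F _ * _]add0r; apply: Cis_deriveD; first exact: Cis_derive_cst.
  rewrite -[F _ * _]subr0; apply: Cis_deriveB; last exact: Cis_derive_cst.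
  exact: dQ.
have eqG : \forall t \near y, P x y0 - P c y0 + (Q x t - Q x y0) =
    P x t - P c t + (Q c t - Q c y0).
  near=> t; rewrite (goursat_rectangle dP dQ cab xab y0r) 1?addrC//.
  near: t; have yy : y \in `]0, r[ by rewrite in_itv.
  by have := near_in_itvoo yy; apply: filterS => t; rewrite in_itv.
move=> [h1 h2]; split.
- apply: (near_eq_is_derive _ h1).
  by apply: filterS eqG => t <-.
- apply: (near_eq_is_derive _ h2).
  by apply: filterS eqG => t <-.
Unshelve. all: by end_near. Qed.

End Primitive.

(** * Lipschitz functions *)

Section Lipschitz.
Context {R : realType}.

Lemma derive_bounded_lipschitz (f f' : R -> R) (a b K x y : R) :
  (forall t, a < t < b -> is_derive t 1 f (f' t)) ->
  (forall t, a < t < b -> `|f' t| <= K) ->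
  a < x < b -> a < y < b -> `|f x - f y| <= K * `|x - y|.
Proof.
move=> df f'K; wlog yx : x y / y <= x => [H hx hy|hx hy].
  have [/H|/ltW/H] := leP y x; first by apply.
  by rewrite (distrC (f x)) (distrC x); apply.
rewrite (@ger0_norm _ (x - y)) ?subr_ge0//.
by apply: (mean_value_le (f' := f')) => // t ht; [apply: df|apply: f'K]; lra.
Qed.

(** McShane's formula: the largest extension with the same constant. It
    provides the values of the primitive on the boundary of the rectangle. *)
Lemma lipschitz_extension (T : Type) (dist : T -> T -> R) (S : set T)
    (f : T -> R) (L : R) : 0 <= L ->
  (forall p, dist p p = 0) -> (forall p q, dist p q = dist q p) ->
  (forall p q s, dist p s <= dist p q + dist q s) -> S !=set0 ->
  (forall p q, S p -> S q -> `|f p - f q| <= L * dist p q) ->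
  exists g : T -> R, (forall p, S p -> g p = f p) /\
    forall p q, `|g p - g q| <= L * dist p q.
Proof.
move=> L0 d0 dC dtri [s0 Ss0] fL.
pose E p := [set f s + L * dist p s | s in S].
have E0 p : E p !=set0 by exists (f s0 + L * dist p s0); exists s0.
have lbE p s' : S s' -> lbound (E p) (f s' - L * dist p s').
  move=> Ss' _ [s Ss <-]; have := fL _ _ Ss' Ss; rewrite ler_norml => /andP[_ h].
  have := ler_wpM2l L0 (dtri s' p s); rewrite mulrDr (dC s' p); lra.
have infP p s : S s -> inf (E p) <= f s + L * dist p s.
  move=> Ss; apply: ge_inf; last by exists s.
  by exists (f s0 - L * dist p s0); exact: lbE.
exists (fun p => inf (E p)); split => [p Sp|].
  apply/eqP; rewrite eq_le; apply/andP; split.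
    by apply: le_trans (infP p p Sp) _; rewrite d0 mulr0 addr0.
  by have := lbE p p Sp; rewrite d0 mulr0 subr0; exact: lb_le_inf.
have one p q : inf (E p) <= inf (E q) + L * dist p q.
  rewrite -lerBlDr; apply: lb_le_inf => // _ [s Ss <-].
  have := infP p s Ss; have := ler_wpM2l L0 (dtri p q s); rewrite mulrDr; lra.
move=> p q; rewrite ler_norml.
by have := one p q; have := one q p; rewrite (dC q p); lra.
Qed.

End Lipschitz.

(** * Second order expansions *)

Section Expansion.
Context {R : realType}.
Implicit Types (r s b H K : R[i] -> R[i]) (z h : R[i]).

Definition little_o2 r := forall e : R, 0 < e -> exists2 d : R, 0 < d &
  forall h, modc h <= d -> modc (r h) <= e * modc h ^+ 2.

Definition bounded_near0 b := exists (C d : R), 0 < d /\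
  forall h, modc h <= d -> modc (b h) <= C.

Lemma little_o2_near r s d : 0 < d -> (forall h, modc h <= d -> r h = s h) ->
  little_o2 s -> little_o2 r.
Proof.
move=> d0 rs os e /os[d' d'0 Hd]; exists (Num.min d d'); first by rewrite lt_min d0.
by move=> h; rewrite le_min => /andP[/rs -> /Hd].
Qed.

Lemma little_o2_ext r s : (forall h, r h = s h) -> little_o2 s -> little_o2 r.
Proof. by move=> rs; apply: (little_o2_near ltr01) => h _; exact: rs. Qed.

Lemma little_o2D r s : little_o2 r -> little_o2 s -> little_o2 (fun h => r h + s h).
Proof.
move=> hr hs e e0; have e20 : 0 < e / 2 by rewrite divr_gt0.
have [d d0 Hd] := hr _ e20; have [d' d'0 Hd'] := hs _ e20.
exists (Num.min d d'); first by rewrite lt_min d0.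
move=> h; rewrite le_min => /andP[/Hd h1 /Hd' h2].
by apply: (le_trans (modcD _ _)); lra.
Qed.

Lemma little_o2M r b : little_o2 r -> bounded_near0 b ->
  little_o2 (fun h => r h * b h).
Proof.
move=> hr [C [d [d0 bC]]] e e0.
have C0 : 0 < `|C| + 1 by rewrite ltr_wpDl.
have [d' d'0 Hd'] := hr (e / (`|C| + 1)) (divr_gt0 e0 C0).
exists (Num.min d d'); first by rewrite lt_min d0.
move=> h; rewrite le_min => /andP[/bC h1 /Hd' h2]; rewrite modcM.
have {}h1 : modc (b h) <= `|C| + 1 by have := ler_norm C; lra.
apply: le_trans (ler_pM (modc_ge0 _) (modc_ge0 _) h2 h1) _.
by rewrite mulrAC divfK ?gt_eqF.
Qed.

Lemma little_o2_cube : little_o2 (fun h => h * h * h).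
Proof.
move=> e e0; exists e => // h he; rewrite !modcM expr2 [leRHS]mulrC.
by rewrite ler_wpM2l// mulr_ge0// modc_ge0.
Qed.

Lemma bounded_near0_cst c : bounded_near0 (fun=> c).
Proof. by exists (modc c), 1. Qed.

Lemma bounded_near0_id : bounded_near0 id.
Proof. by exists 1, 1. Qed.

Lemma bounded_near0D r b : bounded_near0 r -> bounded_near0 b ->
  bounded_near0 (fun h => r h + b h).
Proof.
move=> [C [d [d0 rC]]] [C' [d' [d'0 bC']]]; exists (C + C'), (Num.min d d').
split=> [|h]; first by rewrite lt_min d0.
rewrite le_min => /andP[/rC h1 /bC' h2].
by apply: (le_trans (modcD _ _)); exact: lerD.
Qed.

Lemma bounded_near0M r b : bounded_near0 r -> bounded_near0 b ->
  bounded_near0 (fun h => r h * b h).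
Proof.
move=> [C [d [d0 rC]]] [C' [d' [d'0 bC']]]; exists (C * C'), (Num.min d d').
split=> [|h]; first by rewrite lt_min d0.
rewrite le_min => /andP[/rC h1 /bC' h2].
by rewrite modcM; exact: ler_pM (modc_ge0 _) (modc_ge0 _) h1 h2.
Qed.

Lemma little_o2_bounded r : little_o2 r -> bounded_near0 r.
Proof.
move=> /(_ 1 ltr01)[d d0 Hd]; exists (d ^+ 2), d; split=> // h hd.
by rewrite (le_trans (Hd h hd))// mul1r lerXn2r ?nnegrE ?modc_ge0// ltW.
Qed.

(** Peano's form of Taylor's formula at a single point; it holds for a
    primitive of a differentiable function, where the second derivative is not
    known to be continuous. *)
Definition expansion2 H z := exists p1 p2 : R[i],
  little_o2 (fun h => H (z + h) - (H z + p1 * h + p2 * (h * h))).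

Lemma expansion2_cst c z : expansion2 (fun=> c) z.
Proof.
exists 0, 0; apply: (@little_o2_ext _ (fun h => (h * h * h) * 0)) => [h|]; first by ring.
exact: little_o2M little_o2_cube (bounded_near0_cst 0).
Qed.

Lemma expansion2_id z : expansion2 id z.
Proof.
exists 1, 0; apply: (@little_o2_ext _ (fun h => (h * h * h) * 0)) => [h|]; first by ring.
exact: little_o2M little_o2_cube (bounded_near0_cst 0).
Qed.

Lemma expansion2D H K z : expansion2 H z -> expansion2 K z ->
  expansion2 (fun w => H w + K w) z.
Proof.
move=> [p1 [p2 ho]] [q1 [q2 ko]]; exists (p1 + q1), (p2 + q2).
by apply: (little_o2_ext _ (little_o2D ho ko)) => h; ring.
Qed.

Lemma expansion2M H K z : expansion2 H z -> expansion2 K z ->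
  expansion2 (fun w => H w * K w) z.
Proof.
move=> [p1 [p2 ho]] [q1 [q2 ko]].
exists (p1 * K z + H z * q1), (p2 * K z + p1 * q1 + H z * q2).
set r := (X in little_o2 X) in ho; set s := (X in little_o2 X) in ko.
have bquad (A p q : R[i]) : bounded_near0 (fun h => A + p * h + q * (h * h)).
  have cst := bounded_near0_cst; have id0 := bounded_near0_id.
  apply: bounded_near0D; first apply: bounded_near0D => //.
    exact: bounded_near0M (cst p) id0.
  apply: bounded_near0M (cst q) _; exact: bounded_near0M.
apply: (@little_o2_ext _ (fun h => s h * (H z + p1 * h + p2 * (h * h)) +
  (r h * (K z + q1 * h + q2 * (h * h)) + (r h * s h +
  (h * h * h) * (p1 * q2 + p2 * q1 + p2 * q2 * h + 0 * (h * h)))))) => [h|].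
  by rewrite /r /s; ring.
apply: little_o2D; first exact: little_o2M.
apply: little_o2D; first exact: little_o2M.
apply: little_o2D; first by apply: little_o2M => //; exact: little_o2_bounded.
exact: little_o2M little_o2_cube _.
Qed.

Lemma expansion2X H z n : expansion2 H z -> expansion2 (fun w => H w ^+ n) z.
Proof.
move=> hH; elim: n => [|n IHn]; first exact: expansion2_cst.
rewrite (_ : (fun w => _) = fun w => H w * H w ^+ n); first exact: expansion2M.
by apply/funext => w; rewrite exprS.
Qed.

Lemma expansion2_inv q z : z != q -> expansion2 (fun w => (w - q)^-1) z.
Proof.
move=> zq; pose w := z - q; have w0 : w != 0 by rewrite subr_eq0.
have mw : 0 < modc w.
  by rewrite lt_neqAle modc_ge0 andbT eq_sym; apply/eqP => /modc_eq0/eqP; exact/negP.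
exists (- w ^- 2), (w ^- 3).
have wh h : modc h <= modc w / 2 -> modc w / 2 <= modc (w + h).
  move=> hw; have := modcB (w + h) h; rewrite (_ : w + h - h = w); last by ring.
  lra.
apply: (@little_o2_near _ (fun h => (h * h * h) * (- w ^- 3 * (w + h)^-1)) (modc w / 2)).
- by rewrite divr_gt0.
- move=> h /wh hw; have wh0 : w + h != 0.
    by apply/eqP => e; move: hw; rewrite e modc0; lra.
  rewrite (_ : z + h - q = w + h); last by rewrite /w; ring.
  by rewrite -/w; field; rewrite wh0.
- apply: little_o2M little_o2_cube _; apply: bounded_near0M (bounded_near0_cst _) _.
  exists ((modc w / 2)^-1), (modc w / 2); split; first by rewrite divr_gt0.
  by move=> h /wh hw; rewrite modcV lef_pV2 ?posrE ?divr_gt0// (lt_le_trans _ hw)// divr_gt0.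
Qed.

Lemma expansion2_affine H (p : R[i]) (c : R) z : 0 < c ->
  expansion2 H (p + c%:C * z) -> expansion2 (fun w => H (p + c%:C * w)) z.
Proof.
move=> c0 [p1 [p2 ho]]; exists (p1 * c%:C), (p2 * (c%:C * c%:C)) => e e0.
have [d d0 Hd] := ho (e / c ^+ 2) (divr_gt0 e0 (exprn_gt0 2 c0)).
exists (d / c); first by rewrite divr_gt0.
move=> h; rewrite ler_pdivlMr// => hd.
have mch : modc (c%:C * h) = modc h * c by rewrite modcM modc_real gtr0_norm// mulrC.
have := Hd (c%:C * h); rewrite mch => /(_ hd).
rewrite (_ : e / c ^+ 2 * (modc h * c) ^+ 2 = e * modc h ^+ 2); last first.
  by field; rewrite gt_eqF.
apply: le_trans; rewrite le_eqVlt; apply/orP; left; apply/eqP; congr modc.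
by rewrite (_ : p + c%:C * (z + h) = p + c%:C * z + c%:C * h); ring.
Qed.

End Expansion.

Section PrimitiveExpansion.
Context {R : realType}.
Variables (F : R[i] -> R[i]) (a b r : R) (G : R -> R -> R[i]).
Hypothesis dG1 : forall x y, a < x < b -> 0 < y < r ->
  Cis_derive (fun s => G s y) x (F (x +i* y)).
Hypothesis dG2 : forall x y, a < x < b -> 0 < y < r ->
  Cis_derive (G x) y (F (x +i* y) * 'i).

(** On the horizontal and the vertical segment which lead from [z] to [z + h]
    the affine approximation of [F] has an error of order [o(|h|)]; integrated
    over lengths of at most [|h|] this is [o(|h|^2)]. *)
Lemma primitive_expansion2 x y D : a < x < b -> 0 < y < r ->
  Cdiff F (x +i* y) D ->
  expansion2 (fun w => G (complex.Re w) (complex.Im w)) (x +i* y).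
Proof.
move=> xab yr FD; pose z := x +i* y.
exists (F z), (D * 2^-1) => e e0; have e80 : 0 < e / 8 by rewrite divr_gt0.
have [d d0 Fd] := FD _ e80.
exists (Num.min (d / 2) (Num.min ((x - a) / 2) (Num.min ((b - x) / 2)
  (Num.min (y / 2) ((r - y) / 2))))); first by rewrite !lt_min; lra.
move=> h; rewrite !le_min => /and5P[hd hx1 hx2 hy1 hy2].
have mh0 := modc_ge0 h.
pose h1 := complex.Re h; pose h2 := complex.Im h.
have := modc_Re h; have := modc_Im h.
rewrite -/h1 -/h2 => h2h h1h.
have [nh1 nh1'] : - `|h1| <= h1 /\ h1 <= `|h1|.
  by apply/andP; rewrite -ler_norml.
have [nh2 nh2'] : - `|h2| <= h2 /\ h2 <= `|h2|.
  by apply/andP; rewrite -ler_norml.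
have inner x' y' : `|x' - x| <= `|h1| -> `|y' - y| <= `|h2| ->
    modc (F (x' +i* y') - F z - D * (x' +i* y' - z)) <= e / 4 * modc h.
  move=> hx' hy'; pose k := x' +i* y' - z.
  have -> : x' +i* y' = z + k by rewrite /k; ring.
  have -> : z + k - z = k by ring.
  have kh : modc k <= 2 * modc h.
    by apply: (le_trans (modc_le _)); rewrite /k !ReImE /=; lra.
  by apply: (le_trans (Fd k _)); [lra|nra].
pose T := taylor z (F z) D.
have [[ax xb] [y0 yr']] : (a < x /\ x < b) /\ (0 < y /\ y < r) by clear -xab yr; split; split; lra.
have [axh xhb] : a < x + h1 /\ x + h1 < b by clear -hx1 hx2 nh1 nh1' h1h mh0 ax xb; split; lra.
have [y0h yhr] : 0 < y + h2 /\ y + h2 < r by clear -hy1 hy2 nh2 nh2' h2h mh0 y0 yr'; split; lra.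
have xhab : a < x + h1 < b by rewrite axh.
have H1 : modc ((G (x + h1) y - G x y) - (T ((x + h1) +i* y) - T (x +i* y)))
    <= 2 * (e / 4 * modc h * `|h1|).
  have [h10|h10] := leP 0 h1.
    have -> : `|h1| = x + h1 - x by rewrite ger0_norm//; ring.
    apply: (horizontal_increment dG1) => //; first by rewrite lerDl.
    by move=> t ht; apply: inner; rewrite ?subrr ?normr0// ger0_norm ?ger0_norm//; clear -ht h10; lra.
  have -> : `|h1| = x - (x + h1) by rewrite ltr0_norm//; ring.
  have xhx : x + h1 <= x by rewrite gerDl ltW.
  have H := @horizontal_increment _ F a b r G dG1 (x + h1) x y z (F z) D
    (e / 4 * modc h) xhx axh xb yr.
  rewrite -modcN (_ : - _ = G x y - G (x + h1) y - (T (x +i* y) - T ((x + h1) +i* y))).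
    apply: H => t ht; apply: inner; rewrite ?subrr ?normr0//.
    by rewrite ler0_norm ?ltr0_norm//; clear -ht h10; lra.
  by ring.
have H2 : modc ((G (x + h1) (y + h2) - G (x + h1) y) -
    (T ((x + h1) +i* (y + h2)) - T ((x + h1) +i* y)))
    <= 2 * (e / 4 * modc h * `|h2|).
  have [h20|h20] := leP 0 h2.
    have -> : `|h2| = y + h2 - y by rewrite ger0_norm//; ring.
    apply: (vertical_increment dG2) => //; first by rewrite lerDl.
    move=> t ht; apply: inner; first by rewrite addrAC subrr add0r.
    by rewrite ger0_norm ?ger0_norm//; clear -ht h20; lra.
  have -> : `|h2| = y - (y + h2) by rewrite ltr0_norm//; ring.
  have yhy : y + h2 <= y by rewrite gerDl ltW.
  have H := @vertical_increment _ F a b r G dG2 (x + h1) (y + h2) y z (F z) D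
    (e / 4 * modc h) yhy y0h yr' xhab.
  rewrite -modcN (_ : - _ = G (x + h1) y - G (x + h1) (y + h2) -
      (T ((x + h1) +i* y) - T ((x + h1) +i* (y + h2)))).
    apply: H => t ht; apply: inner; first by rewrite addrAC subrr add0r.
    by rewrite ler0_norm ?ltr0_norm//; clear -ht h20; lra.
  by ring.
have zh : z + h = (x + h1) +i* (y + h2) by apply: complex_ext; rewrite !ReImE.
have Tz : T z = 0 by rewrite /T /taylor subrr !mulr0 mul0r addr0.
have Th : T (z + h) = F z * h + D * 2^-1 * (h * h).
  by rewrite /T /taylor (_ : z + h - z = h); ring.
rewrite (_ : _ - _ =
  ((G (x + h1) y - G x y) - (T ((x + h1) +i* y) - T (x +i* y))) +
  ((G (x + h1) (y + h2) - G (x + h1) y) -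
    (T ((x + h1) +i* (y + h2)) - T ((x + h1) +i* y)))); last first.
  have e1 : T (x +i* y) = 0 by exact: Tz.
  by rewrite e1 -zh Th !ReImE /= -/h1 -/h2; ring.
apply: (le_trans (modcD _ _)); apply: le_trans (lerD H1 H2) _.
have em0 : 0 <= e / 2 * modc h by rewrite mulr_ge0// divr_ge0// ltW.
have := ler_wpM2l em0 (lerD h1h h2h); lra.
Qed.

End PrimitiveExpansion.

(** * The maximum principle and a two-constants estimate *)

Section MaximumPrinciple.
Context {R : realType}.
Implicit Types (P H : R[i] -> R[i]) (z h : R[i]).

Lemma expansion2_continuous P z : expansion2 P z -> forall e : R, 0 < e ->
  exists2 d : R, 0 < d & forall h, modc h <= d -> modc (P (z + h) - P z) <= e.
Proof.
move=> [p1 [p2 /(_ 1 ltr01)[d d0 Hd]]] e e0.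
pose C := modc p1 + modc p2 + 1.
have C0 : 0 < C by rewrite /C; have := modc_ge0 p1; have := modc_ge0 p2; lra.
exists (Num.min d (Num.min 1 (e / C))); first by rewrite !lt_min d0 ltr01 divr_gt0.
move=> h; rewrite !le_min ler_pdivlMr// => /and3P[/Hd h1 h2 h3].
set r := (X in modc X) in h1.
rewrite (_ : _ - _ = r + p1 * h + p2 * (h * h)); last by rewrite /r; ring.
apply: (le_trans (modcD _ _)); have := modcD r (p1 * h); rewrite !modcM.
have mh := modc_ge0 h; have m1 := modc_ge0 p1; have m2 := modc_ge0 p2.
move: h1; rewrite mul1r expr2 => h1 h4.
have hh : modc h * modc h <= modc h by rewrite ler_piMr.
have := ler_wpM2l m2 hh; move: h3; rewrite /C; lra.
Qed.

(** The mixed terms disappear because [t], [-t], [it] and [-it] have sum zero,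
    and so have their squares. *)
Lemma mean_of_four (A p q : R[i]) (t : R) :
  modc (A + p * t%:C + q * (t%:C * t%:C)) ^+ 2 +
  modc (A + p * (- t)%:C + q * ((- t)%:C * (- t)%:C)) ^+ 2 +
  modc (A + p * (0 +i* t) + q * ((0 +i* t) * (0 +i* t))) ^+ 2 +
  modc (A + p * (0 +i* (- t)) + q * ((0 +i* (- t)) * (0 +i* (- t)))) ^+ 2 =
  4 * modc A ^+ 2 + 4 * modc p ^+ 2 * t ^+ 2 + 4 * modc q ^+ 2 * t ^+ 4.
Proof. by rewrite !modc_sqr !ReImE /=; ring. Qed.

(** If [|P|] exceeded its bound [A] somewhere, then for small [eta > 0] the
    function [|P z|^2 + eta * |z|^2] would have its maximum at an interior
    point. The mean of its values at the four points [z + t], [z - t],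
    [z + it], [z - it] exceeds the value at [z] by at least
    [eta * t^2 - o(t^2)], because the terms of first and second order in the
    expansion of [P] cancel in the mean. *)
Lemma maximum_principle (K : set (R * R)) P (A : R) : compact K -> 0 <= A ->
  (forall x y, K (x, y) -> expansion2 P (x +i* y)) ->
  (forall x y, K (x, y) -> modc (P (x +i* y)) <= A \/
     exists2 d : R, 0 < d &
       forall h, modc h <= d -> K (x + complex.Re h, y + complex.Im h)) ->
  forall x y, K (x, y) -> modc (P (x +i* y)) <= A.
Proof.
move=> cK A0 eP bK x0 y0 Kp0; rewrite leNgt; apply/negP => AP.
have K0 : K !=set0 by exists (x0, y0).
pose sq (p : R * R) : R := p.1 ^+ 2 + p.2 ^+ 2.
have csq : continuous sq.
  by move=> p; apply: cvgD; apply: cvgM; [exact: cvg_fst|exact: cvg_fst|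
    exact: cvg_snd|exact: cvg_snd].
have [pB _ HB] := compact_EVT_max K0 cK (continuous_subspaceT csq).
pose B := sq pB.
have B0 : 0 <= B by rewrite addr_ge0// sqr_ge0.
(* Less than half of the excess over [A ^+ 2] when multiplied by [B]. *)
pose eta := (modc (P (x0 +i* y0)) ^+ 2 - A ^+ 2) / (2 * (B + 1)).
have AP2 : 0 < modc (P (x0 +i* y0)) ^+ 2 - A ^+ 2.
  by rewrite subr_gt0 ltrXn2r// ?nnegrE// modc_ge0.
have eta0 : 0 < eta by rewrite divr_gt0//; lra.
pose Phi (p : R * R) := modc (P (p.1 +i* p.2)) ^+ 2 + eta * sq p.
have cP p : K p -> {for p, continuous (fun q : R * R => complex.Re (P (q.1 +i* q.2)))} /\
    {for p, continuous (fun q : R * R => complex.Im (P (q.1 +i* q.2)))}.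
  case: p => x y /eP ePp.
  have cont (e : R) : 0 < e -> \forall q \near (x, y),
      modc (P (q.1 +i* q.2) - P (x +i* y)) <= e.
    move=> e0; have [d d0 Hd] := expansion2_continuous ePp e0.
    apply/nbhs_ballP; exists (d / 2); rewrite /=; first by rewrite divr_gt0.
    move=> [x' y'] [/= h1 h2]; rewrite /ball /= in h1 h2.
    rewrite (_ : x' +i* y' = x +i* y + (x' +i* y' - (x +i* y))); last by ring.
    apply: Hd; apply: (le_trans (modc_le _)); rewrite !ReImE/=.
    by rewrite (distrC x') (distrC y'); lra.
  split; apply/(@cvgrPdist_le _ R^o) => e /cont; apply: filterS => q hq.
    by apply: le_trans hq; rewrite distrC -ReN -ReD; exact: modc_Re.
  by apply: le_trans hq; rewrite distrC -ImN -ImD; exact: modc_Im.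
have cPhi : {within K, continuous Phi}.
  apply: continuous_in_subspaceT => p; rewrite inE => /cP[c1 c2].
  rewrite (_ : Phi = fun q => complex.Re (P (q.1 +i* q.2)) * complex.Re (P (q.1 +i* q.2)) +
    complex.Im (P (q.1 +i* q.2)) * complex.Im (P (q.1 +i* q.2)) + eta * sq q); last first.
    by apply/funext => q; rewrite /Phi modc_sqr !expr2.
  apply: cvgD; first by apply: cvgD; apply: cvgM.
  by apply: cvgM; [exact: cvg_cst|exact: csq].
have [[x y]] := compact_EVT_max K0 cK cPhi.
rewrite inE => Kxy maxP.
have {}maxP q : K q -> Phi q <= Phi (x, y) by move=> Kq; apply: maxP; rewrite inE.
have {}HB q : K q -> sq q <= B by move=> Kq; apply: HB; rewrite inE.
have [PA|[d d0 Hd]] := bK _ _ Kxy.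
  have := maxP _ Kp0; rewrite /Phi /= => h.
  have h1 : modc (P (x +i* y)) ^+ 2 <= A ^+ 2 by rewrite lerXn2r ?nnegrE ?modc_ge0.
  have h2 : eta * sq (x, y) <= eta * B by rewrite ler_wpM2l ?HB// ltW.
  have h3 : 0 <= eta * sq (x0, y0) by rewrite mulr_ge0 ?(ltW eta0)// addr_ge0// sqr_ge0.
  have h4 : eta * B < modc (P (x0 +i* y0)) ^+ 2 - A ^+ 2.
    by rewrite /eta mulrAC ltr_pdivrMr ?ltr_pM2l//; lra.
  lra.
have [p1 [p2 ho]] := eP _ _ Kxy.
pose C := modc (P (x +i* y)) + modc p1 + modc p2.
have C0 : 0 <= C by rewrite !addr_ge0// modc_ge0.
(* The remainder changes [|P|^2] by at most [2 C e t^2], which must stay below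
   [eta t^2]. *)
pose e := eta / (4 * (C + 1)).
have e0 : 0 < e by rewrite divr_gt0//; lra.
have [d' d'0 Hd'] := ho _ e0.
pose t := Num.min 1 (Num.min d d').
have t0 : 0 < t by rewrite !lt_min ltr01 d0.
have [t1 td td'] : [/\ t <= 1, t <= d & t <= d'] by apply/and3P; rewrite -!le_min.
have key h : modc h = t ->
    modc (P (x +i* y) + p1 * h + p2 * (h * h)) ^+ 2 - 2 * C * e * t ^+ 2 +
    eta * sq (x + complex.Re h, y + complex.Im h) <=
    modc (P (x +i* y)) ^+ 2 + eta * sq (x, y).
  move=> ht; apply: (@le_trans _ _ (Phi (x + complex.Re h, y + complex.Im h))); last first.
    by apply: maxP; apply: Hd; rewrite ht.
  rewrite /Phi lerD2r /=.
  have -> : (x + complex.Re h) +i* (y + complex.Im h) = x +i* y + h.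
    by apply: complex_ext; rewrite !ReImE.
  have := Hd' h; rewrite ht => /(_ td').
  set a := P (x +i* y) + p1 * h + p2 * (h * h) => hr.
  have aC : modc a <= C.
    apply: (le_trans (modcD _ _)); have := modcD (P (x +i* y)) (p1 * h).
    rewrite !modcM ht /C => h1.
    have h2 : modc p1 * t <= modc p1 by rewrite ler_piMr// modc_ge0.
    have h3 : modc p2 * (t * t) <= modc p2.
      by rewrite ler_piMr ?modc_ge0//; rewrite mulr_ile1// ltW.
    lra.
  have ax : modc a - e * t ^+ 2 <= modc (P (x +i* y + h)).
    have := modc_trans (P (x +i* y + h)) a 0.
    rewrite !subr0 modc_distC; lra.
  have et : 0 <= e * t ^+ 2 by rewrite mulr_ge0 ?ltW// exprn_gt0.
  have := modc_ge0 a; have := modc_ge0 (P (x +i* y + h)).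
  have : modc a * (e * t ^+ 2) <= C * (e * t ^+ 2) by rewrite ler_wpM2r.
  rewrite (_ : 2 * C * e * t ^+ 2 = 2 * (C * (e * t ^+ 2))); last by ring.
  move: ax et; set s := e * t ^+ 2; set u := modc a; set v := modc (P _) => ax et us v0 u0.
  have : u ^+ 2 - 2 * (u * s) <= v ^+ 2; last by lra.
  have [su|su] := leP s u.
    have : (u - s) ^+ 2 <= v ^+ 2 by rewrite lerXn2r ?nnegrE// subr_ge0.
    by rewrite sqrrB; have := sqr_ge0 s; lra.
  apply: (@le_trans _ _ 0); last exact: sqr_ge0.
  by have := ler_wpM2l u0 (ltW su); have := sqr_ge0 u; rewrite expr2; lra.
have mt : modc (t%:C) = t by rewrite modc_real gtr0_norm.
have mnt : modc ((- t)%:C) = t by rewrite modc_real normrN gtr0_norm.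
have mit : modc (0 +i* t) = t.
  by rewrite modcE /= expr0n add0r sqrtr_sqr gtr0_norm.
have mnit : modc (0 +i* (- t)) = t.
  by rewrite modcE /= expr0n add0r sqrtr_sqr normrN gtr0_norm.
have := key _ mt; have := key _ mnt; have := key _ mit; have := key _ mnit.
have := mean_of_four (P (x +i* y)) p1 p2 t.
rewrite /sq /= !addr0.
have q1 : 0 <= modc p1 ^+ 2 * t ^+ 2 by rewrite mulr_ge0// sqr_ge0.
have q2 : 0 <= modc p2 ^+ 2 * t ^+ 4.
  by rewrite mulr_ge0// ?sqr_ge0// exprn_ge0// ltW.
have q3 : 2 * C * e * t ^+ 2 <= eta * t ^+ 2 / 2.
  have -> : 2 * C * e * t ^+ 2 = (eta * t ^+ 2 / 2) * (C / (C + 1)).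
    by rewrite /e; field; lra.
  apply: ler_piMr; first by rewrite divr_ge0// mulr_ge0 ?sqr_ge0// ltW.
  by rewrite ler_pdivrMr; lra.
have q4 : 0 < eta * t ^+ 2 by rewrite mulr_gt0// exprn_gt0.
move: (modc _ ^+ 2) (modc _ ^+ 2) (modc _ ^+ 2) (modc _ ^+ 2) => m1 m2 m3 m4.
move: (modc _ ^+ 2) => m5 h1 h2 h3 h4 h5.
have e1 : eta * ((x + t) ^+ 2 + y ^+ 2) + eta * ((x - t) ^+ 2 + y ^+ 2) +
  eta * (x ^+ 2 + (y + t) ^+ 2) + eta * (x ^+ 2 + (y - t) ^+ 2) =
  4 * (eta * (x ^+ 2 + y ^+ 2)) + 4 * (eta * t ^+ 2) by ring.
lra.
Qed.

End MaximumPrinciple.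

Section TwoConstants.
Context {R : realType}.

Lemma exists_power_ge (m C : R) : 1 < m -> exists n : nat, C <= m ^+ n.
Proof.
move=> m1; have m10 : 0 < m - 1 by lra.
have bern n : 1 + n%:R * (m - 1) <= m ^+ n.
  elim: n => [|n IHn]; first by rewrite mul0r addr0 expr0.
  rewrite exprS; have := ler_wpM2l (ltW (lt_trans ltr01 m1)) IHn.
  apply: le_trans; rewrite -natr1.
  have : 0 <= n%:R * (m - 1) * (m - 1) by rewrite !mulr_ge0// ltW.
  lra.
exists (Num.bound (C / (m - 1))); apply: le_trans (bern _).
have [C0|C0] := leP 0 C; last first.
  by have := mulr_ge0 (ler0n R (Num.bound (C / (m - 1)))) (ltW m10); lra.
have Cm : 0 <= C / (m - 1) by rewrite divr_ge0// ltW.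
by have := archi_boundP Cm; rewrite ltr_pdivrMr//; lra.
Qed.

(** The part above the real axis of the disc with center [1 + iY] whose boundary
    passes through 0 and 2. *)
Lemma lens_compact (Y : R) : 0 <= Y ->
  compact [set p : R * R | 0 <= p.2 /\
    (p.1 - 1) ^+ 2 + p.2 ^+ 2 <= 1 + 2 * Y * p.2].
Proof.
move=> Y0.
have cfst : continuous (fst : R * R -> R) by move=> p; exact: cvg_fst.
have csnd : continuous (snd : R * R -> R) by move=> p; exact: cvg_snd.
apply: (@subclosed_compact _ _
    (`[- (Y + 1), Y + 3]%classic `*` `[0, 2 * Y + 1]%classic)); last first.
- move=> [x y] /= [y0 xy].
  have h : (x - 1) ^+ 2 + (y - Y) ^+ 2 <= 1 + Y ^+ 2 by move: xy; rewrite !expr2; lra.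
  have hx : `|x - 1| <= Y + 1.
    rewrite -(@ler_pXn2r _ 2%N) ?nnegrE ?addr_ge0// real_normK ?num_real//.
    by have := sqr_ge0 (y - Y); move: h; rewrite !expr2; lra.
  have hy : `|y - Y| <= Y + 1.
    rewrite -(@ler_pXn2r _ 2%N) ?nnegrE ?addr_ge0// real_normK ?num_real//.
    by have := sqr_ge0 (x - 1); move: h; rewrite !expr2; lra.
  by move: hx hy; rewrite !in_itv/= !ler_norml; lra.
- by apply: compact_setX; exact: segment_compact.
apply: closedI.
  apply: (@closed_comp _ _ (snd : R * R -> R) [set y | 0 <= y]).
    by move=> p _; exact: csnd.
  exact: closed_ge.
rewrite [X in closed X](_ : _ = (fun p : R * R => 1 + 2 * Y * p.2 -
    (p.1 - 1) * (p.1 - 1) - p.2 * p.2) @^-1` [set y | 0 <= y]).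
  apply: closed_comp; last exact: closed_ge.
  move=> p _; apply: cvgB; last by apply: cvgM; exact: csnd.
  apply: cvgB.
    apply: cvgD; first exact: cvg_cst.
    by apply: cvgM; [exact: cvg_cst|exact: csnd].
  by apply: cvgM; apply: cvgB; try exact: cvg_cst; exact: cfst.
by apply/seteqP; split => -[x y] /=; rewrite !expr2; lra.
Qed.

(** The point [-1 + i eta] is connected to the segment [0, 2] inside the part
    above the real axis of a disc which cuts the axis exactly in [0, 2]. The
    Moebius map [m] below has modulus 1 on the circle and a modulus larger
    than 1 inside, at most 2 above the axis. The maximum principle for [H m^n]
    therefore bounds [|H|] at [-1 + i eta] by [|m|^-n] times the larger of its
    bound on the arc and [2^n] times its bound on the segment. *)
Lemma two_constants (eta : R) : 0 < eta -> eta <= 1 ->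
  exists2 B : R, 0 < B & forall C e, 0 <= C -> 0 < e ->
  exists2 d : R, 0 < d & forall H : R[i] -> R[i],
    (forall x y, 0 <= y -> `|x| <= B -> y <= B ->
       expansion2 H (x +i* y) /\ modc (H (x +i* y)) <= C) ->
    (forall x, 0 <= x <= 2 -> modc (H x%:C) <= d) ->
    modc (H ((-1) +i* eta)) <= e.
Proof.
move=> eta0 eta1; have [b bE] : exists b, eta = 8 * b by exists (eta / 8); field.
have b0 : 0 < b by lra.
have b1 : b <= 1 / 8 by lra.
have bb : 0 < b * b by rewrite mulr_gt0.
have bb1 : b * b <= 1 / 64 by nra.
(* The height of the center. The circle through 0 and 2 is an Apollonius circle
   of the points [q] and [s] below the axis, that is, the ratio of the distances
   to them is constant on it; [k2] normalizes the square of this ratio to 1. The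
   choice of [b] puts the point [-1 + i eta] inside the disc. *)
pose Y := (2 - 4 * b ^+ 2) / (3 * b) / 2.
have YE : 6 * b * Y = 2 - 4 * b ^+ 2 by rewrite /Y; field; lra.
have Y0 : 0 <= Y.
  by rewrite /Y divr_ge0// divr_ge0; rewrite ?expr2; lra.
pose K := [set p : R * R | 0 <= p.2 /\
    (p.1 - 1) ^+ 2 + p.2 ^+ 2 <= 1 + 2 * Y * p.2].
pose q : R[i] := 1 +i* (- b); pose s : R[i] := 1 +i* (- (2 * b)).
pose k2 := (1 + b ^+ 2) / (1 + 4 * b ^+ 2).
have den0 : 0 < 1 + 4 * b ^+ 2 by rewrite expr2; lra.
have k20 : 0 < k2 by rewrite divr_gt0// expr2; lra.
have k21 : k2 <= 1 by rewrite ler_pdivrMr// expr2; lra.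
pose m (w : R[i]) : R[i] := (Num.sqrt k2)%:C * ((w - s) * (w - q)^-1).
have wq x y : 0 <= y -> b <= modc (x +i* y - q).
  by move=> y0; apply: le_trans (modc_Im _); rewrite !ReImE /= ger0_norm; lra.
have wq0 x y : 0 <= y -> 0 < modc (x +i* y - q) by move=> /(wq x); lra.
have mE x y : 0 <= y -> modc (m (x +i* y)) ^+ 2 - 1 =
    3 * b ^+ 2 * (1 + 2 * Y * y - (x - 1) ^+ 2 - y ^+ 2) /
    ((1 + 4 * b ^+ 2) * modc (x +i* y - q) ^+ 2).
  move=> /(wq0 x) w0; rewrite /m !modcM modcV !exprMn exprVn modc_real.
  rewrite real_normK ?num_real// sqr_sqrtr ?(ltW k20)//.
  have -> : 3 * b ^+ 2 * (1 + 2 * Y * y - (x - 1) ^+ 2 - y ^+ 2) =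
    (1 + b ^+ 2) * modc (x +i* y - s) ^+ 2 -
    (1 + 4 * b ^+ 2) * modc (x +i* y - q) ^+ 2.
    have -> : 3 * b ^+ 2 * (1 + 2 * Y * y - (x - 1) ^+ 2 - y ^+ 2) =
      3 * b ^+ 2 * (1 - (x - 1) ^+ 2 - y ^+ 2) + b * (6 * b * Y) * y by ring.
    by rewrite YE !modc_sqr !ReImE /=; ring.
  by rewrite /k2; field; rewrite !gt_eqF.
have m2 x y : 0 <= y -> modc (m (x +i* y)) <= 2.
  move=> y0; rewrite /m !modcM modcV modc_real ger0_norm ?sqrtr_ge0//.
  have k1 : Num.sqrt k2 <= 1 by rewrite -sqrtr1 ler_wsqrtr.
  have h : modc (x +i* y - s) / modc (x +i* y - q) <= 2.
    rewrite ler_pdivrMr ?wq0//.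
    have -> : x +i* y - s = (x +i* y - q) + 0 +i* b.
      by apply: complex_ext; rewrite !ReImE /=; lra.
    apply: (le_trans (modcD _ _)).
    have -> : modc (0 +i* b) = b by rewrite modcE /= expr0n add0r sqrtr_sqr gtr0_norm.
    by have := wq x y y0; lra.
  rewrite -[2]mul1r; apply: ler_pM => //.
  by rewrite divr_ge0// modc_ge0.
have mge x y : K (x, y) -> 1 <= modc (m (x +i* y)).
  move=> [/= y0 xy]; rewrite -(@ler_pXn2r _ 2%N) ?nnegrE ?modc_ge0// expr1n -subr_ge0 mE//.
  apply: divr_ge0; last by rewrite mulr_ge0 ?(ltW den0)// sqr_ge0.
  by apply: mulr_ge0; [rewrite mulr_ge0 ?sqr_ge0|lra].
have m1 : 1 < modc (m ((-1) +i* eta)).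
  rewrite -(@ltr_pXn2r _ 2%N) ?nnegrE ?modc_ge0// expr1n -subr_gt0 mE ?(ltW eta0)//.
  apply: divr_gt0; last by rewrite mulr_gt0// exprn_gt0// wq0// ltW.
  apply: mulr_gt0; first by rewrite mulr_gt0// exprn_gt0.
  have : 6 * b * (2 * Y * eta) = 2 * (2 - 4 * b ^+ 2) * eta by rewrite -YE; ring.
  rewrite (_ : 6 * b * (2 * Y * eta) = 3 / 4 * eta * (2 * Y * eta)); last by rewrite bE; field.
  rewrite (_ : 2 * (2 - 4 * b ^+ 2) * eta = eta * (4 - 8 * (b * b))); last by rewrite expr2; ring.
  rewrite -mulrA [LHS]mulrCA => /(mulfI (lt0r_neq0 eta0)) h.
  have e2 : eta * eta <= 1 by nra.
  rewrite !expr2; lra.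
exists (2 * Y + 4); first lra.
move=> C e C0 e0; have [n Cn] := exists_power_ge (C / e) m1.
pose M := modc (m ((-1) +i* eta)) ^+ n.
have M0 : 0 < M by rewrite exprn_gt0//; lra.
exists (e * M / 2 ^+ n); first by rewrite divr_gt0 ?exprn_gt0// mulr_gt0.
move=> H HC Hd.
have KB x y : K (x, y) -> [/\ 0 <= y, `|x| <= 2 * Y + 4 & y <= 2 * Y + 4].
  move=> [/= y0 xy].
  have h : (x - 1) ^+ 2 + (y - Y) ^+ 2 <= 1 + Y ^+ 2 by move: xy; rewrite !expr2; lra.
  have hx : `|x - 1| <= Y + 1.
    rewrite -(@ler_pXn2r _ 2%N) ?nnegrE ?addr_ge0// real_normK ?num_real//.
    by have := sqr_ge0 (y - Y); move: h; rewrite !expr2; lra.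
  have hy : `|y - Y| <= Y + 1.
    rewrite -(@ler_pXn2r _ 2%N) ?nnegrE ?addr_ge0// real_normK ?num_real//.
    by have := sqr_ge0 (x - 1); move: h; rewrite !expr2; lra.
  by move: hx hy; rewrite !ler_norml => hx hy; clear -y0 hx hy Y0; split=> //; lra.
have Kz : K (-1, eta).
  split; first exact: ltW.
  have := mE (-1) eta (ltW eta0) => h.
  have : 0 < modc (m ((-1) +i* eta)) ^+ 2 - 1.
    by rewrite subr_gt0 expr_gt1// modc_ge0.
  have c0 : 0 < 3 * b ^+ 2 by rewrite mulr_gt0// exprn_gt0.
  have d0 : 0 < (1 + 4 * b ^+ 2) * modc ((-1) +i* eta - q) ^+ 2.
    by rewrite mulr_gt0// exprn_gt0// wq0// ltW.
  by rewrite h pmulr_lgt0 ?invr_gt0// pmulr_rgt0//=; lra.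
have := @maximum_principle R K (fun w => H w * m w ^+ n) (e * M) (lens_compact Y0) _ _ _
  _ _ Kz.
rewrite modcM modcX -/M ler_pM2r//; apply.
- by rewrite mulr_ge0 ?ltW.
- move=> x y /KB[y0 xB yB]; apply: expansion2M; first by have [] := HC x y y0 xB yB.
  apply: expansion2X; apply: expansion2M; first exact: expansion2_cst.
  apply: expansion2M.
    by apply: expansion2D; [exact: expansion2_id|exact: expansion2_cst].
  apply: expansion2_inv; apply/eqP => h.
  by have := wq0 x y y0; rewrite h subrr modc0 ltxx.
move=> x y Kxy; have [y0 xB yB] := KB _ _ Kxy; have [_ HxC] := HC x y y0 xB yB.
have xy : (x - 1) ^+ 2 + y ^+ 2 <= 1 + 2 * Y * y by case: Kxy.
rewrite modcM modcX.
have [y00|yne] := eqVneq y 0.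
  left; rewrite y00 -/(x%:C); have hx : 0 <= x <= 2.
    by move: xy; rewrite y00 expr0n mulr0 !addr0 expr2; nra.
  have := Hd _ hx; rewrite ler_pdivlMr ?exprn_gt0// => h.
  apply: le_trans h; rewrite ler_wpM2l ?modc_ge0// lerXn2r ?nnegrE ?modc_ge0//.
  exact: m2.
have {yne}y0' : 0 < y by rewrite lt_neqAle eq_sym yne.
have [Phi0|Phi0] := leP (1 + 2 * Y * y) ((x - 1) ^+ 2 + y ^+ 2).
  left; have /eqP : modc (m (x +i* y)) ^+ 2 - 1 = 0.
    rewrite mE// (_ : 1 + 2 * Y * y - (x - 1) ^+ 2 - y ^+ 2 = 0); last by lra.
    by rewrite mulr0 mul0r.
  rewrite subr_eq0 sqrp_eq1 ?modc_ge0// => /eqP ->; rewrite expr1n mulr1.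
  by apply: (le_trans HxC); move: Cn; rewrite ler_pdivrMr// mulrC.
right; pose g := 1 + 2 * Y * y - (x - 1) ^+ 2 - y ^+ 2.
have g0 : 0 < g by rewrite /g; lra.
pose N := 2 * `|x - 1| + 2 * y + 2 * Y + 2.
have N0 : 0 < N by rewrite /N; have := normr_ge0 (x - 1); lra.
(* Moving by at most 1 changes [g] by at most [N] times the distance. *)
exists (Num.min y (Num.min 1 (g / N))); first by rewrite !lt_min y0' ltr01 divr_gt0.
move=> h; rewrite !le_min ler_pdivlMr// => /and3P[h1 h2 h3].
have := modc_Re h; have := modc_Im h; have mh := modc_ge0 h.
set h' := modc h in h1 h2 h3 mh *; move: (complex.Re h) (complex.Im h) => u v hv hu.
have [hv1 hv2] : - h' <= v /\ v <= h' by apply/andP; rewrite -ler_norml.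
split => /=; first by clear -h1 hv1; lra.
have u2 : u ^+ 2 <= h'.
  rewrite -(real_normK (num_real u)) expr2; apply: (@le_trans _ _ (h' * h')).
    exact: ler_pM.
  by rewrite ler_piMr.
have v2 : v ^+ 2 <= h'.
  rewrite -(real_normK (num_real v)) expr2; apply: (@le_trans _ _ (h' * h')).
    exact: ler_pM.
  by rewrite ler_piMr.
have xu : (x - 1) * u <= `|x - 1| * h'.
  apply: (le_trans (ler_norm _)); rewrite normrM; exact: ler_wpM2l.
have yv : y * v <= y * h' by rewrite ler_wpM2l// ltW.
have Yv : Y * (- v) <= Y * h' by rewrite ler_wpM2l//; clear -hv1; lra.
have : g = 1 + 2 * Y * y - (x - 1) ^+ 2 - y ^+ 2 by [].
have : h' * N = 2 * (`|x - 1| * h') + 2 * (y * h') + 2 * (Y * h') + 2 * h' by rewrite /N; ring.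
have -> : (x + u - 1) ^+ 2 + (y + v) ^+ 2 = (x - 1) ^+ 2 + y ^+ 2 +
  2 * ((x - 1) * u) + 2 * (y * v) + u ^+ 2 + v ^+ 2 by ring.
clear -xu yv Yv u2 v2 h3; lra.
Qed.

End TwoConstants.

(** * The density of a Lipschitz function *)

Section Density.
Context {R : realType}.

Lemma stieltjes_oc (f : cumulative R R) (x y : R) : x <= y ->
  lebesgue_stieltjes_measure f `]x, y]%classic = (f y - f x)%:E.
Proof.
move=> xy; rewrite /lebesgue_stieltjes_measure /measure_extension.
rewrite measurable_mu_extE; last exact: is_ocitv.
exact: (@wlength_itv_bnd _ f x y false false).
Qed.

(** A nondecreasing function which grows at most as fast as the identity has a
    Stieltjes measure which is a summand of the Lebesgue measure, hence a
    density by the theorem of Radon and Nikodym. *)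
Lemma contraction_density (h k : cumulative R R) (a b : R) :
  (forall x, h x + k x = x) -> a < b ->
  exists f : R -> R, mu.-integrable setT (EFin \o f) /\
    forall x y, a <= x -> x <= y -> y <= b ->
      \int[mu]_(t in `]x, y]) f t = h y - h x.
Proof.
move=> hk ab; pose D : set (measurableTypeR R) := `]a, b]%classic.
have mD : measurable D by exact: measurable_itv.
have muE : forall A, measurable A -> (mu : set (measurableTypeR R) -> \bar R) A =
    measure_add (lebesgue_stieltjes_measure h) (lebesgue_stieltjes_measure k) A.
  apply: lebesgue_measure_unique => X [[x y] _ <-].
  transitivity (lebesgue_stieltjes_measure h `]x, y]%classic +
    lebesgue_stieltjes_measure k `]x, y]%classic)%E; last first.
    by rewrite -measure_addE.
  rewrite /lebesgue_measure -[(x, y).1]/x -[(x, y).2]/y.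
  have [xy|yx] := leP x y; last first.
    by rewrite set_itv_ge ?bnd_simp -?leNgt ?(ltW yx)// !measure0 adde0.
  by rewrite !stieltjes_oc//= -EFinD -{1}(hk x) -{1}(hk y); congr EFin; ring.
have Dfin : (lebesgue_stieltjes_measure h D < +oo)%E.
  by rewrite stieltjes_oc ?ltW// ltry.
pose nu : {finite_measure set (measurableTypeR R) -> \bar R} := mfrestr mD Dfin.
have nu_mu : nu `<< (mu : set (measurableTypeR R) -> \bar R).
  apply/null_content_dominatesP => A mA muA0.
  apply/eqP; rewrite eq_le measure_ge0 andbT /nu /= /mfrestr /mrestr /=.
  have : (0 = lebesgue_stieltjes_measure h A + lebesgue_stieltjes_measure k A)%E.
    by rewrite -measure_addE; apply: etrans (muE A mA); exact: esym muA0.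
  move=> ->.
  apply: (@le_trans _ _ (lebesgue_stieltjes_measure h A)).
    by apply: le_measure; rewrite ?inE//; exact: measurableI.
  by rewrite leeDl// measure_ge0.
have [f [f0 ffin fint fE]] := radon_nikodym_sigma_finite nu_mu.
exists (fine \o f); have fEE : EFin \o (fine \o f) = f.
  by apply/funext => t /=; rewrite fineK.
split; first by rewrite fEE.
move=> x y ax xy yb; rewrite /Rintegral.
have -> : (\int[mu]_(t in `]x, y]) ((fine \o f) t)%:E = \int[mu]_(t in `]x, y]) f t)%E.
  by apply: eq_integral => t _ /=; rewrite fineK.
rewrite -fE; last exact: measurable_itv.
rewrite /nu /= /mfrestr /mrestr /=.
rewrite (_ : _ `&` D = `]x, y]%classic) ?stieltjes_oc//.
apply/seteqP; split => t /=; first by case.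
by move=> xty; split=> //; move: xty; rewrite /D /= !in_itv/=; lra.
Qed.

Lemma cumulative_of (h : R -> R) : {homo h : x y / x <= y} ->
  continuous h -> exists f : cumulative R R, f = h :> (R -> R).
Proof.
move=> nd ch.
pose f : cumulative R R := HB.pack h
  (isCumulative.Build R _ R h nd (right_continuousW ch)).
by exists f.
Qed.

Lemma lipschitz_continuous (w : R -> R) (L : R) :
  (forall x y, `|w x - w y| <= L * `|x - y|) -> continuous w.
Proof.
move=> wL x; apply/(@cvgrPdist_le _ R^o) => e e0.
have L0 : 0 < `|L| + 1 by rewrite ltr_wpDl.
apply/nbhs_normP; exists (e / (`|L| + 1)); first by rewrite /= divr_gt0.
move=> y /=; rewrite ltr_pdivlMr// => xy; apply: (le_trans (wL x y)).
apply: le_trans (ltW xy); rewrite mulrC ler_wpM2l//.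
by have := ler_norm L; lra.
Qed.

(** The functions [(x + w x / L) / 2] and [(x - w x / L) / 2] are nondecreasing
    with sum [x], so [contraction_density] gives a density. By the Lebesgue
    differentiation theorem it is the derivative almost everywhere. *)
Lemma lipschitz_density (w : R -> R) (L a b : R) : 0 < L -> a < b ->
  (forall x y, `|w x - w y| <= L * `|x - y|) ->
  exists K : R -> R,
    [/\ mu.-integrable `]a, b] (EFin \o K),
        \int[mu]_(t in `]a, b]) K t = w b - w a &
        {ae mu, forall x : R, a < x < b -> is_derive x 1 w (K x)}].
Proof.
move=> L0 ab wL.
have wd x y : x <= y -> w y - w x <= L * (y - x) /\ w x - w y <= L * (y - x).
  move=> xy; have := wL y x; rewrite (@ger0_norm _ (y - x)) ?subr_ge0// ler_norml => /andP[h1 h2].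
  by split; lra.
have cw := lipschitz_continuous wL.
have cL (s : R) : continuous (fun x => (x + s * w x) / 2).
  move=> x; apply: cvgM; last exact: cvg_cst.
  apply: cvgD; first exact: cvg_id.
  by apply: cvgM; [exact: cvg_cst|exact: cw].
have [h hE] : exists h : cumulative R R, h = (fun x => (x + L^-1 * w x) / 2) :> (R -> R).
  apply: cumulative_of; last exact: cL.
  move=> x y xy; have [_ h2] := wd x y xy.
  rewrite ler_wpM2r ?invr_ge0// -(ler_pM2l L0) !mulrDr !mulrA mulfV ?gt_eqF// !mul1r.
  lra.
have [k kE] : exists k : cumulative R R, k = (fun x => (x + (- L^-1) * w x) / 2) :> (R -> R).
  apply: cumulative_of; last exact: cL.
  move=> x y xy; have [h2 _] := wd x y xy.
  rewrite ler_wpM2r ?invr_ge0// -(ler_pM2l L0) !mulrDr !mulrA mulrN mulfV ?gt_eqF// !mulN1r.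
  lra.
have [x|f [fint fE]] := @contraction_density h k a b _ ab.
  by rewrite hE kE; field; rewrite gt_eqF.
have intf (i : interval R) : mu.-integrable [set` i] (EFin \o f).
  by apply: integrableS fint.
have muab : (mu (`]a, b] : set R) < +oo)%E.
  by rewrite lebesgue_measure_itv/=; case: ifP; rewrite ?ltry// -EFinB ltry.
have intc (c : R) : mu.-integrable `]a, b] (EFin \o (cst c)).
  apply: measurable_bounded_integrable => //.
  exists `|c|; split; first by rewrite num_real.
  by move=> M /ltW cM t _; exact: cM.
exists (fun x => L * (2 * f x - 1)); split.
- rewrite (_ : EFin \o _ = (fun x => (2 * L)%:E * (EFin \o f) x - (EFin \o cst L) x)%E).
    by apply: integrableB => //; exact: integrableZl.
  by apply/funext => x /=; rewrite -EFinM -EFinB; congr EFin; ring.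
- rewrite (_ : (fun t => L * (2 * f t - 1)) = (fun t => (2 * L) * f t - L)); last first.
    by apply/funext => t; ring.
  have i2 : mu.-integrable `]a, b] (EFin \o (fun t => (2 * L) * f t)).
    rewrite (_ : EFin \o _ = (fun x => (2 * L)%:E * (EFin \o f) x)%E).
      exact: integrableZl.
    by apply/funext => x /=; rewrite EFinM.
  rewrite RintegralB//; last exact: (intc L).
  rewrite RintegralZl; [|by []|exact: intf].
  rewrite (fE a b) ?(ltW ab)// hE Rintegral_cst; last exact: measurable_itv.
  have -> : fine (mu (`]a, b] : set R)) = b - a.
    by rewrite lebesgue_measure_itv/= lte_fin ab.
  by field; rewrite gt_eqF.
have lf : locally_integrable [set: R] f.
  by have := integrable_locally measurableT fint; rewrite patch_setT.
have := FTC1 (a := BRight a) (fun y => intf _) lf.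
apply: filterS; first exact: (ae_filter_ringOfSetsType mu).
move=> x H /andP[ax xb]; have [dF F'] := H ax.
have dh : is_derive x 1 h (f x).
  apply: (@near_eq_is_derive _ _ _ (fun y => h a + \int[mu]_(t in `]a, y]) f t)).
    have : x \in `]a, b[ by rewrite in_itv/= ax.
    move=> /near_in_itvoo; apply: filterS => y; rewrite in_itv/= => /andP[ay yb].
    by rewrite (fE a y (lexx a) (ltW ay) (ltW yb)) addrC subrK.
  rewrite -[f x]add0r; apply: is_deriveD.
  exact: is_derive_derive1 dF F'.
have -> : w = (fun y => L * (2 * h y - y)).
  by apply/funext => y; rewrite hE; field; rewrite gt_eqF.
apply: is_derive_eq; rewrite /GRing.scale/=; ring.
Qed.

End Density.

(** * Smooth functions and a smooth step *)

Section NDerivable.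
Context {R : realType}.
Implicit Types (f g : R -> R) (n : nat).

Fixpoint nderivable n f : Prop :=
  if n is n'.+1 then (forall x : R, derivable f x 1) /\ nderivable n' (derive1 f)
  else True.

Lemma nderivableS n f (f' : R -> R) : (forall x : R, is_derive x 1 f (f' x)) ->
  nderivable n f' -> nderivable n.+1 f.
Proof.
move=> df nf'; split=> [x|]; first by case: (df x).
rewrite (_ : derive1 f = f')//; apply/funext => x.
by rewrite derive1E; case: (df x).
Qed.

Lemma nderivable_is_derive n f : nderivable n.+1 f ->
  forall x : R, is_derive x 1 f (derive1 f x).
Proof. by move=> [df _] x; exact: is_derive_derive1 (df x) erefl. Qed.

Lemma nderivableW n f : nderivable n.+1 f -> nderivable n f.
Proof. by elim: n f => // n IHn f [df nf']; split => //; exact: IHn. Qed.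

Lemma nderivable_cst n (c : R) : nderivable n (fun=> c).
Proof.
elim: n c => // n IHn c; apply: (@nderivableS _ _ (fun=> 0)) => //.
Qed.

Lemma nderivableD n f g : nderivable n f -> nderivable n g ->
  nderivable n (fun x => f x + g x).
Proof.
elim: n f g => // n IHn f g nf ng.
apply: (@nderivableS _ _ (fun x => derive1 f x + derive1 g x)).
  move=> x; have df := nderivable_is_derive nf x.
  by have dg := nderivable_is_derive ng x; exact: (is_deriveD df dg).
by apply: IHn; [case: nf|case: ng].
Qed.

Lemma nderivableM n f g : nderivable n f -> nderivable n g ->
  nderivable n (fun x => f x * g x).
Proof.
elim: n f g => // n IHn f g nf ng.
apply: (@nderivableS _ _ (fun x => f x * derive1 g x + g x * derive1 f x)).
  move=> x; have df := nderivable_is_derive nf x.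
  by have dg := nderivable_is_derive ng x; exact: (is_deriveM df dg).
apply: nderivableD; apply: IHn.
- exact: nderivableW.
- by case: ng.
- exact: nderivableW.
- by case: nf.
Qed.

Lemma nderivableV n f : (forall x, f x != 0) -> nderivable n f ->
  nderivable n (fun x => (f x)^-1).
Proof.
move=> f0; elim: n => // n IHn nf.
apply: (@nderivableS _ _ (fun x => - 1 * ((f x)^-1 * (f x)^-1 * derive1 f x))).
  move=> x; have df := nderivable_is_derive nf x.
  have := @is_deriveV R f x _ 1 (f0 x) df.
  by rewrite /GRing.scale/= expr2 invfM mulN1r mulNr.
apply: nderivableM; first exact: nderivable_cst.
apply: nderivableM; last by case: nf.
by apply: nderivableM; apply: IHn; exact: nderivableW.
Qed.

Lemma is_derive_affine (f : R -> R) (d c e x : R) :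
  is_derive ((x - c) / e) 1 f d -> is_derive x 1 (fun t => f ((t - c) / e)) (e^-1 * d).
Proof.
move=> df; have dl : is_derive x 1 (fun t : R => (t - c) / e) e^-1.
  by apply: is_derive_eq; rewrite /GRing.scale/=; ring.
have := @is_derive1_comp R f (fun t => (t - c) / e) x d e^-1 df dl.
by rewrite /GRing.scale/= mulrC.
Qed.

Lemma nderivable_affine n f (c e : R) : nderivable n f ->
  nderivable n (fun t => f ((t - c) / e)).
Proof.
elim: n f => // n IHn f nf.
apply: (@nderivableS _ _ (fun t => e^-1 * derive1 f ((t - c) / e))).
  by move=> x; apply: is_derive_affine; exact: nderivable_is_derive nf _.
by apply: nderivableM; [exact: nderivable_cst|apply: IHn; case: nf].
Qed.

(** A class of functions vanishing to infinite order at 0 which is closed under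
    differentiation, and so consists of smooth functions. *)
Definition flat (p : {poly R}) (x : R) : R :=
  if 0 < x then p.[x^-1] * expR (- x^-1) else 0.

Lemma expR_ge_power k (t : R) : 0 <= t -> t ^+ k <= k.+1%:R ^+ k * expR t.
Proof.
move=> t0; have k0 : 0 < k.+1%:R :> R by rewrite ltr0n.
have h : (t / k.+1%:R) ^+ k <= expR (t / k.+1%:R) ^+ k.
  have h0 : 0 <= t / k.+1%:R by rewrite divr_ge0// ltW.
  rewrite lerXn2r ?nnegrE ?expR_ge0//.
  by apply: le_trans (expR_ge1Dx _); rewrite lerDr.
have h2 : expR (t / k.+1%:R) ^+ k <= expR t.
  rewrite -expRM_natl ler_expR mulrCA ler_piMr// ler_pdivrMr// mul1r.
  by rewrite ler_nat.
have -> : t ^+ k = k.+1%:R ^+ k * (t / k.+1%:R) ^+ k.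
  by rewrite -exprMn mulrCA mulfV ?gt_eqF// mulr1.
by rewrite ler_wpM2l ?exprn_ge0// (le_trans h).
Qed.

Lemma horner_le_expR (p : {poly R}) :
  exists2 C : R, 0 <= C & forall t, 0 <= t -> `|p.[t]| <= C * expR t.
Proof.
exists (\sum_(i < size p) `|p`_i| * i.+1%:R ^+ i).
  by apply: sumr_ge0 => i _; rewrite mulr_ge0// exprn_ge0.
move=> t t0; rewrite horner_coef mulr_suml.
apply: (le_trans (ler_norm_sum _ _ _)); apply: ler_sum => i _.
rewrite normrM normrX (ger0_norm t0) -mulrA ler_wpM2l//.
exact: expR_ge_power.
Qed.

Lemma flat_le_sqr p : exists2 C : R, 0 <= C &
  forall x, `|flat p x| <= C * x ^+ 2.
Proof.
have [C C0 HC] := horner_le_expR ('X^2 * p); exists C => // x.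
rewrite /flat; case: ifP => [x0|_]; last by rewrite normr0 mulr_ge0// sqr_ge0.
have xi : 0 <= x^-1 by rewrite invr_ge0 ltW.
have := HC _ xi; rewrite hornerM hornerXn normrM [`|_ ^+ 2|]ger0_norm ?sqr_ge0//.
rewrite normrM (ger0_norm (expR_ge0 _)) expRN ler_pdivrMr ?expR_gt0// => h.
have := ler_wpM2l (sqr_ge0 x) h; rewrite mulrA -exprMn mulfV ?gt_eqF// expr1n mul1r.
by rewrite mulrA [x ^+ 2 * C]mulrC.
Qed.

(** At 0 the difference quotient tends to 0 by [flat_le_sqr]. *)
Lemma flat_derive p (x : R) :
  is_derive x 1 (flat p) (flat ('X^2 * (p - p^`())) x).
Proof.
have [x0|x0|->] := ltgtP x 0.
- have -> : flat ('X^2 * (p - p^`())) x = 0 by rewrite /flat ltNge (ltW x0).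
  apply: (@near_eq_is_derive _ _ _ (cst 0)).
  have xx : x \in `]x - 1, 0[ by rewrite in_itv/= x0 andbT; lra.
  apply: filterS (near_in_itvoo xx) => t; rewrite in_itv/= => /andP[_ t0].
  by rewrite /flat ltNge (ltW t0).
- rewrite (_ : flat ('X^2 * (p - p^`())) x =
    ('X^2 * (p - p^`())).[x^-1] * expR (- x^-1)); last by rewrite /flat x0.
  apply: (@near_eq_is_derive _ _ _ (fun t : R => p.[t^-1] * expR (- t^-1))).
    have xx : x \in `]0, x + 1[ by rewrite in_itv/= x0; lra.
    apply: filterS (near_in_itvoo xx) => t; rewrite in_itv/= => /andP[t0 _].
    by rewrite /flat t0.
  have dinv : is_derive x 1 (fun t : R => t^-1) (- x ^- 2).
    have := @is_deriveV R id x 1 1 (lt0r_neq0 x0) (is_derive_id _ _).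
    by rewrite /GRing.scale/= mulr1.
  have dp : is_derive x 1 (fun t : R => p.[t^-1]) (- x ^- 2 * p^`().[x^-1]).
    have := @is_derive1_comp R (horner p) (fun t => t^-1) x _ _ (is_derive_poly p x^-1) dinv.
    by rewrite /GRing.scale/= mulrC.
  have de : is_derive x 1 (fun t : R => expR (- t^-1)) (x ^- 2 * expR (- x^-1)).
    have dn : is_derive x 1 (fun t : R => - t^-1) (x ^- 2).
      by rewrite -[x ^- 2]opprK; exact: is_deriveN.
    have := @is_derive1_comp R expR (fun t => - t^-1) x _ _ (is_derive_expR _) dn.
    by rewrite /GRing.scale/= mulrC.
  apply: is_derive_eq (is_deriveM dp de) _.
  rewrite hornerM hornerXn hornerD hornerN /GRing.scale/= exprVn; ring.
have -> : flat ('X^2 * (p - p^`())) 0 = 0 by rewrite /flat ltxx.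
have [C C0 HC] := flat_le_sqr p.
have lim0 : h^-1 *: (flat p (h + 0) - flat p 0) @[h --> 0^'] --> 0.
  apply/(@cvgrPdist_le _ R^o) => e e0; rewrite near_withinE.
  apply/nbhs_normP; exists (e / (C + 1)); first by rewrite /= divr_gt0//; lra.
  move=> h /=; rewrite !sub0r !normrN ltr_pdivlMr; last lra.
  move=> hC h0; rewrite addr0 [X in _ - X](_ : _ = 0); last by rewrite /flat ltxx.
  rewrite subr0 normrM normfV ler_pdivrMl ?normr_gt0//.
  apply: (le_trans (HC h)); rewrite -(real_normK (num_real h)) expr2 mulrCA.
  by rewrite ler_wpM2l//; apply: le_trans (ltW hC); rewrite mulrC ler_wpM2l//; lra.
have lim1 : h^-1 *: ((flat p \o shift 0) (h *: 1) - flat p 0) @[h --> 0^'] --> (0 : R).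
  rewrite (_ : (fun h : R => _) = (fun h => h^-1 *: (flat p (h + 0) - flat p 0)))//.
  by apply/funext => h /=; rewrite /GRing.scale/= mulr1.
apply: DeriveDef; first by apply/cvg_ex; exists 0.
exact: cvg_lim lim1.
Qed.

Lemma nderivable_flat n p : nderivable n (flat p).
Proof.
elim: n p => // n IHn p; apply: nderivableS; first exact: flat_derive.
exact: IHn.
Qed.

(** The denominator is positive because one of [x] and [1 - x] is. *)
Lemma smooth_step : exists S : R -> R,
  [/\ forall n, nderivable n S, forall x, x <= 0 -> S x = 0 &
      forall x, 1 <= x -> S x = 1].
Proof.
pose s := flat 1.
have sE (x : R) : 0 < x -> s x = expR (- x^-1) by move=> x0; rewrite /s /flat x0 hornerC mul1r.
have s0 (x : R) : x <= 0 -> s x = 0 by move=> x0; rewrite /s /flat ltNge x0.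
have sge0 (x : R) : 0 <= s x.
  by have [/s0 ->//|/sE ->] := leP x 0; exact: expR_ge0.
have spos (x : R) : 0 < x -> 0 < s x by move=> /sE ->; exact: expR_gt0.
pose t (x : R) := s ((x - 1) / (- 1)).
have tE x : t x = s (1 - x) by rewrite /t; congr s; field.
have den x : 0 < s x + t x.
  rewrite tE; have [x0|x0] := leP x 0; last by rewrite ltr_pwDl// spos.
  by rewrite ltr_wpDl// spos//; lra.
exists (fun x => s x * (s x + t x)^-1); split.
- move=> n; apply: nderivableM; first exact: nderivable_flat.
  apply: nderivableV; first by move=> x; rewrite gt_eqF.
  apply: nderivableD; first exact: nderivable_flat.
  by apply: nderivable_affine; exact: nderivable_flat.
- by move=> x /s0 ->; rewrite mul0r.
- move=> x x1; rewrite tE (s0 (1 - x)) ?addr0; last by lra.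
  by rewrite mulfV// gt_eqF// spos//; lra.
Qed.

End NDerivable.

(** * Test functions *)

Section TestFunctions.
Context {R : realType}.
Implicit Types (phi W g : R -> R[i]).

Lemma Cis_derive_val W x d : Cis_derive W x d -> Cderive W x = d.
Proof.
by move=> [[_ h1] [_ h2]]; apply: complex_ext; rewrite /Cderive /= derive1E.
Qed.

Lemma smoothP phi : smooth phi <-> forall n,
  nderivable n (fun t => complex.Re (phi t)) /\
  nderivable n (fun t => complex.Im (phi t)).
Proof.
split=> [sphi n|H n].
  elim: n phi sphi => // n IHn phi sphi.
  have sphi' : smooth (Cderive phi) by move=> m x; have := sphi m.+1 x; rewrite iterSr.
  have [h1 h2] := IHn _ sphi'.
  by split; (split; [move=> x; case: (sphi 0%N x)|assumption]).
elim: n phi H => [|n IHn] phi H x.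
  by have [[h1 _] [h2 _]] := H 1%N; split; [exact: h1|exact: h2].
rewrite iterSr; apply: IHn => m.
by have [[_ h1] [_ h2]] := H m.+1.
Qed.

Lemma smooth_is_derive phi x : smooth phi -> Cis_derive phi x (Cderive phi x).
Proof.
by move=> /(_ 0%N x)[h1 h2]; split; [exact: is_derive_derive1 h1 erefl|
  exact: is_derive_derive1 h2 erefl].
Qed.

Lemma smooth_derive phi : smooth phi -> smooth (Cderive phi).
Proof. by move=> sphi n x; have := sphi n.+1 x; rewrite iterSr. Qed.

Lemma Cis_derive_continuous W x d : Cis_derive W x d -> Ccontinuous_at W x.
Proof.
move=> [[h1 _] [h2 _]]; split.
  by have /derivable1_diffP/differentiable_continuous := h1.
by have /derivable1_diffP/differentiable_continuous := h2.
Qed.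

Lemma smooth_continuous phi x : smooth phi -> Ccontinuous_at phi x.
Proof. by move=> /(smooth_is_derive x); exact: Cis_derive_continuous. Qed.

(** Products with continuous functions and derivatives of test functions stay in
    this class, and [Cintegral] is linear on it. *)
Definition carried (c d : R) g := (forall x, Ccontinuous_at g x) /\
  forall x, ~~ (c <= x <= d) -> g x = 0.

Lemma smooth_carried phi c d : smooth phi ->
  (forall x, ~~ (c <= x <= d) -> phi x = 0) -> carried c d phi.
Proof. by move=> sphi phi0; split => // x; exact: smooth_continuous. Qed.

Lemma derive_carried phi c d : smooth phi ->
  (forall x, ~~ (c <= x <= d) -> phi x = 0) -> carried c d (Cderive phi).
Proof.
move=> sphi phi0; apply: smooth_carried; first exact: smooth_derive.
move=> x xcd; apply: Cis_derive_val.
have near0 : \forall t \near x, 0 = phi t.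
  move: xcd; rewrite negb_and -!ltNge => /orP[xc|dx].
    have xx : x \in `]x - 1, c[ by rewrite in_itv/= xc andbT; lra.
    apply: filterS (near_in_itvoo xx) => t; rewrite in_itv/= => /andP[_ tc].
    by rewrite phi0// negb_and -ltNge tc.
  have xx : x \in `]d, x + 1[ by rewrite in_itv/= dx; lra.
  apply: filterS (near_in_itvoo xx) => t; rewrite in_itv/= => /andP[td _].
  by rewrite phi0// negb_and -!ltNge td orbT.
split.
- apply: (@near_eq_is_derive _ _ _ (cst 0)).
  by apply: filterS near0 => t <-.
- apply: (@near_eq_is_derive _ _ _ (cst 0)).
  by apply: filterS near0 => t <-.
Qed.

Lemma supp_out phi x : ~ supp phi x -> phi x = 0.
Proof.
move=> nx; apply/eqP; apply: contrapT => /negP h; apply: nx.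
exact: subset_closure.
Qed.

Lemma compact_hull (K : set R) : compact K -> K !=set0 ->
  exists c d : R, [/\ K c, K d & K `<=` `[c, d]].
Proof.
move=> cK K0; have cid : {within K, continuous (id : R -> R)}.
  by apply: continuous_subspaceT => x; exact: cvg_id.
have [c Kc Hc] := compact_EVT_min K0 cK cid.
have [d Kd Hd] := compact_EVT_max K0 cK cid.
rewrite inE in Kc; rewrite inE in Kd; exists c, d; split=> // x Kx /=.
by rewrite in_itv/= Hc ?inE// Hd ?inE.
Qed.

Lemma test_function_oo (a b : R) phi : a < b -> test_function `]a, b[ phi ->
  exists c d : R, [/\ a < c, c <= d, d < b &
    forall x, ~~ (c <= x <= d) -> phi x = 0].
Proof.
move=> ab [_ cS SU]; have [S0|S0] := pselect (supp phi !=set0).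
  have [c [d [Sc Sd cd]]] := compact_hull cS S0; exists c, d.
  have := SU _ Sc; have := SU _ Sd; rewrite /= !in_itv/= => /andP[_ db] /andP[ac _].
  split=> //; first by have := cd _ Sc; rewrite /= in_itv/= => /andP[].
  move=> x /negP xcd; apply: supp_out => /cd; rewrite /= in_itv; exact: xcd.
exists ((a + b) / 2), ((a + b) / 2); split; try lra.
by move=> x _; apply: supp_out => Sx; apply: S0; exists x.
Qed.

Lemma test_function_T phi : test_function setT phi ->
  exists2 B : R, 0 < B & forall x, ~~ (- B <= x <= B) -> phi x = 0.
Proof.
move=> [_ cS _]; have [S0|S0] := pselect (supp phi !=set0).
  have [c [d [Sc Sd cd]]] := compact_hull cS S0.
  exists (`|c| + `|d| + 1); first by have := normr_ge0 c; have := normr_ge0 d; lra.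
  move=> x /negP xcd; apply: supp_out => /cd; rewrite /= in_itv/= => /andP[h1 h2].
  apply: xcd; have := ler_norm d; have := ler_norm (- c); rewrite normrN.
  by have := normr_ge0 c; have := normr_ge0 d; lra.
by exists 1 => // x _; apply: supp_out => Sx; apply: S0; exists x.
Qed.

Lemma carried_test_function (U : set R) phi c d : smooth phi ->
  (forall x, ~~ (c <= x <= d) -> phi x = 0) -> `[c, d] `<=` U ->
  test_function U phi.
Proof.
move=> sphi phi0 cdU.
have scd : supp phi `<=` `[c, d].
  rewrite (iffLR (closure_id `[c, d]%classic)); last exact: itv_closed.
  apply: closureS => x /= phix; apply: contrapT => /negP xcd.
  by move: phix; rewrite phi0 ?eqxx//; move: xcd; rewrite in_itv.
split => //; last exact: subset_trans scd cdU.
apply: subclosed_compact scd; last exact: segment_compact.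
exact: closed_closure.
Qed.

Lemma test_function_sub (U V : set R) phi : U `<=` V ->
  test_function U phi -> test_function V phi.
Proof. by move=> UV [s c sU]; split=> //; exact: subset_trans sU UV. Qed.

Definition dilate (x0 e : R) phi : R -> R[i] :=
  fun t => (e^-1)%:C * phi ((t - x0) / e).

Lemma smooth_dilate x0 e phi : smooth phi -> smooth (dilate x0 e phi).
Proof.
move=> /smoothP sphi; apply/smoothP => n; have [h1 h2] := sphi n; split.
- rewrite (_ : (fun t => _) = (fun t => e^-1 * complex.Re (phi ((t - x0) / e)))).
    apply: nderivableM; first exact: nderivable_cst.
    exact: (nderivable_affine x0 e h1).
  by apply/funext => t; rewrite /dilate CReM /= mul0r subr0.
- rewrite (_ : (fun t => _) = (fun t => e^-1 * complex.Im (phi ((t - x0) / e)))).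
    apply: nderivableM; first exact: nderivable_cst.
    exact: (nderivable_affine x0 e h2).
  by apply/funext => t; rewrite /dilate CImM /= mul0r addr0.
Qed.

Lemma dilate_out x0 e phi c d : 0 < e ->
  (forall x, ~~ (c <= x <= d) -> phi x = 0) ->
  forall t, ~~ (x0 + e * c <= t <= x0 + e * d) -> dilate x0 e phi t = 0.
Proof.
move=> e0 phi0 t ht; rewrite /dilate phi0 ?mulr0//; apply: contra ht.
rewrite ler_pdivlMr// ler_pdivrMr// => /andP[h1 h2].
by rewrite mulrC in h1; rewrite mulrC in h2; lra.
Qed.

Lemma Cis_derive_affine W (c e x : R) d : Cis_derive W ((x - c) / e) d ->
  Cis_derive (fun t => W ((t - c) / e)) x ((e^-1)%:C * d).
Proof.
move=> [h1 h2]; split.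
- by rewrite CReM /= mul0r subr0; exact: (is_derive_affine h1).
- by rewrite CImM /= mul0r addr0; exact: (is_derive_affine h2).
Qed.

Lemma Cderive_dilate x0 e phi : smooth phi ->
  Cderive (dilate x0 e phi) =
  fun t => (e^-1)%:C * ((e^-1)%:C * Cderive phi ((t - x0) / e)).
Proof.
move=> sphi; apply/funext => t; apply: Cis_derive_val.
rewrite -[X in Cis_derive _ _ X]add0r -[X in X + _](mul0r (phi ((t - x0) / e))).
apply: (Cis_deriveM (Cis_derive_cst _ _)).
by apply: Cis_derive_affine; exact: smooth_is_derive.
Qed.

Lemma smooth_real (f : R -> R) : (forall n, nderivable n f) -> smooth (fun t => (f t)%:C).
Proof.
move=> nf; apply/smoothP => n; split; first exact: nf.
exact: nderivable_cst.
Qed.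

End TestFunctions.

From mathcomp Require Import measurable_realfun.

(** * Integrals of compactly supported functions *)

Section Integrals.
Context {R : realType}.
Implicit Types (c d : R) (A : set R).

Lemma patch_carried (f : R -> R) c d A : `[c, d] `<=` A ->
  (forall x, ~~ (c <= x <= d) -> f x = 0) -> f \_ A = f \_ `[c, d].
Proof.
move=> cdA f0; apply/funext => x; rewrite !patchE.
have [xA|xA] := boolP (x \in A); have [xcd|xcd] := boolP (x \in `[c, d]%classic) => //.
  by rewrite f0//; move: xcd; rewrite notin_setE /= in_itv/= => /negP.
by move: xA; rewrite notin_setE => /(_ (cdA _ (set_mem xcd))).
Qed.

Lemma carried_Rintegral (f : R -> R) c d A : `[c, d] `<=` A ->
  (forall x, ~~ (c <= x <= d) -> f x = 0) ->
  \int[mu]_(x in A) f x = \int[mu]_(x in `[c, d]) f x.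
Proof.
move=> cdA f0; rewrite Rintegral_mkcond [RHS]Rintegral_mkcond.
by rewrite (patch_carried cdA f0).
Qed.

Lemma carried_integrable (f : R -> R) c d A : measurable A -> `[c, d] `<=` A ->
  continuous f -> (forall x, ~~ (c <= x <= d) -> f x = 0) ->
  mu.-integrable A (EFin \o f).
Proof.
move=> mA cdA cf f0; apply/integrable_mkcond => //.
rewrite restrict_EFin (patch_carried cdA f0) -restrict_EFin.
have mcd : measurable (`[c, d]%classic : set R) by exact: measurable_itv.
apply: (proj1 (@integrable_mkcond _ _ _ mu `[c, d]%classic (EFin \o f) mcd)).
apply: continuous_compact_integrable; first exact: segment_compact.
exact: continuous_subspaceT.
Qed.

Lemma Rintegral_le (f : R -> R) c d M : c <= d -> continuous f ->
  (forall x, c <= x <= d -> `|f x| <= M) ->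
  `|\int[mu]_(x in `[c, d]) f x| <= M * (d - c).
Proof.
move=> cd cf fM.
have cint (g : R -> R) : continuous g -> mu.-integrable `[c, d] (EFin \o g).
  move=> cg; apply: continuous_compact_integrable; first exact: segment_compact.
  exact: continuous_subspaceT.
have mcd : measurable (`[c, d] : set R) by exact: measurable_itv.
have h1 : `|\int[mu]_(x in `[c, d]) f x| <= \int[mu]_(x in `[c, d]) `|f x|.
  by apply: le_normr_Rintegral => //; exact: cint.
apply: (le_trans h1).
have -> : M * (d - c) = \int[mu]_(x in `[c, d]) (cst M) x.
  rewrite Rintegral_cst//.
  have -> : fine (mu (`[c, d] : set R)) = d - c.
    rewrite lebesgue_measure_itv/= lte_fin; move: cd.
    by rewrite le_eqVlt => /predU1P[->|->//]; rewrite ltxx subrr.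
  by [].
apply: le_Rintegral => //.
- apply: (cint (fun x => `|f x|)) => x.
  by apply: continuous_comp; [exact: cf|exact: norm_continuous].
- by apply: cint => x; exact: cvg_cst.
Qed.

Lemma Rintegral_derive (f F : R -> R) c d : c <= d -> continuous f ->
  (forall x, c <= x <= d -> is_derive x 1 F (f x)) ->
  \int[mu]_(x in `[c, d]) f x = F d - F c.
Proof.
rewrite le_eqVlt => /predU1P[->|cd] cf dF.
  by rewrite subrr set_itv1 Rintegral_set1.
have cF x : c <= x <= d -> {for x, continuous F}.
  by move=> /dF[/derivable1_diffP/differentiable_continuous].
rewrite /Rintegral (@continuous_FTC2 R f F c d cd) //=.
- exact: continuous_subspaceT.
- split.
  + by move=> x; rewrite in_itv/= => /andP[cx xd]; have [] := dF x ltac:(lra).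
  + by apply: cvg_at_right_filter; apply: cF; lra.
  + by apply: cvg_at_left_filter; apply: cF; lra.
- move=> x; rewrite in_itv/= => /andP[cx xd].
  by rewrite derive1E; have [] := dF x ltac:(lra).
Qed.

End Integrals.

Section ComplexIntegrals.
Context {R : realType}.
Implicit Types (c d : R) (A : set R) (g h w W : R -> R[i]).

Lemma carriedW c d c' d' g : c' <= c -> d <= d' -> carried c d g -> carried c' d' g.
Proof.
move=> cc dd [cg g0]; split => // x xcd; apply: g0; apply: contra xcd; lra.
Qed.

Lemma Ccontinuous_cst (z : R[i]) x : Ccontinuous_at (fun=> z) x.
Proof. by split; exact: cvg_cst. Qed.

Lemma Ccontinuous_atD g h x : Ccontinuous_at g x -> Ccontinuous_at h x ->
  Ccontinuous_at (fun t => g t + h t) x.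
Proof.
move=> [g1 g2] [h1 h2]; split.
- rewrite (_ : (fun t => _) = (fun t => complex.Re (g t) + complex.Re (h t))).
    exact: cvgD.
  by apply/funext => t; rewrite ReD.
- rewrite (_ : (fun t => _) = (fun t => complex.Im (g t) + complex.Im (h t))).
    exact: cvgD.
  by apply/funext => t; rewrite ImD.
Qed.

Lemma Ccontinuous_atM g h x : Ccontinuous_at g x -> Ccontinuous_at h x ->
  Ccontinuous_at (fun t => g t * h t) x.
Proof.
move=> [g1 g2] [h1 h2]; split.
- rewrite (_ : (fun t => _) = (fun t => complex.Re (g t) * complex.Re (h t) -
    complex.Im (g t) * complex.Im (h t))).
    by apply: cvgB; exact: cvgM.
  by apply/funext => t; rewrite CReM.
- rewrite (_ : (fun t => _) = (fun t => complex.Re (g t) * complex.Im (h t) +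
    complex.Im (g t) * complex.Re (h t))).
    by apply: cvgD; exact: cvgM.
  by apply/funext => t; rewrite CImM.
Qed.

Lemma carriedM c d w g : (forall x, Ccontinuous_at w x) -> carried c d g ->
  carried c d (fun x => w x * g x).
Proof.
move=> cw [cg g0]; split => [x|x xcd]; first exact: Ccontinuous_atM.
by rewrite g0// mulr0.
Qed.

Lemma carriedD c d g h : carried c d g -> carried c d h ->
  carried c d (fun x => g x + h x).
Proof.
move=> [cg g0] [ch h0]; split => [x|x xcd]; first exact: Ccontinuous_atD.
by rewrite g0// h0// addr0.
Qed.

Lemma carriedZ c d z g : carried c d g -> carried c d (fun x => z * g x).
Proof. by apply: carriedM => x; exact: Ccontinuous_cst. Qed.

Lemma Cintegral_carried c d A g : `[c, d] `<=` A -> carried c d g ->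
  Cintegral A g = Cintegral `[c, d] g.
Proof.
move=> cdA [_ g0]; rewrite /Cintegral; congr Complex;
  by apply: carried_Rintegral => // x /g0 ->.
Qed.

Lemma carried_Cintegrable c d A g : measurable A -> `[c, d] `<=` A ->
  carried c d g -> mu.-integrable A (EFin \o (fun x => complex.Re (g x))) /\
    mu.-integrable A (EFin \o (fun x => complex.Im (g x))).
Proof.
move=> mA cdA [cg g0]; split; apply: (carried_integrable mA cdA).
- by move=> x; have [] := cg x.
- by move=> x /g0 ->.
- by move=> x; have [] := cg x.
- by move=> x /g0 ->.
Qed.

Lemma CintegralD c d A g h : measurable A -> `[c, d] `<=` A ->
  carried c d g -> carried c d h ->
  Cintegral A (fun x => g x + h x) = Cintegral A g + Cintegral A h.
Proof.
move=> mA cdA /(carried_Cintegrable mA cdA)[g1 g2] /(carried_Cintegrable mA cdA)[h1 h2].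
apply: complex_ext; rewrite ?ReD ?ImD /=.
- by rewrite -RintegralD//; congr Rintegral; apply/funext => x; rewrite ReD.
- by rewrite -RintegralD//; congr Rintegral; apply/funext => x; rewrite ImD.
Qed.

Lemma CintegralZ c d A z g : measurable A -> `[c, d] `<=` A ->
  carried c d g -> Cintegral A (fun x => z * g x) = z * Cintegral A g.
Proof.
move=> mA cdA /(carried_Cintegrable mA cdA)[g1 g2].
have Zint (r : R) (f : R -> R) : mu.-integrable A (EFin \o f) ->
    mu.-integrable A (EFin \o (fun x => r * f x)).
  move=> fint; have : mu.-integrable A (fun x => r%:E * (EFin \o f) x)%E.
    exact: integrableZl.
  by [].
apply: complex_ext; rewrite ?CReM ?CImM /=.
- rewrite -!RintegralZl// -RintegralB//; try exact: Zint.
  by congr Rintegral; apply/funext => x; rewrite CReM.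
- rewrite -!RintegralZl// -RintegralD//; try exact: Zint.
  by congr Rintegral; apply/funext => x; rewrite CImM.
Qed.

Lemma Cintegral_le c d A g M : c <= d -> `[c, d] `<=` A -> carried c d g ->
  (forall x, c <= x <= d -> modc (g x) <= M) ->
  modc (Cintegral A g) <= 2 * (M * (d - c)).
Proof.
move=> cd cdA cg gM; rewrite (Cintegral_carried cdA cg); apply: modc_le2 => /=.
- apply: Rintegral_le => // x; first by have [] := cg.1 x.
  by move=> /gM; apply: le_trans; exact: modc_Re.
- apply: Rintegral_le => // x; first by have [] := cg.1 x.
  by move=> /gM; apply: le_trans; exact: modc_Im.
Qed.

Lemma Cintegral_derive c d W g : c <= d -> (forall x, Ccontinuous_at g x) ->
  (forall x, c <= x <= d -> Cis_derive W x (g x)) ->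
  Cintegral `[c, d] g = W d - W c.
Proof.
move=> cd cg dW; apply: complex_ext; rewrite ?ReD ?ImD ?ReN ?ImN /=.
- apply: (@Rintegral_derive _ _ (fun x => complex.Re (W x)) _ _ cd) => x;
    first by have [] := cg x.
  by move=> /dW[].
- apply: (@Rintegral_derive _ _ (fun x => complex.Im (W x)) _ _ cd) => x;
    first by have [] := cg x.
  by move=> /dW[].
Qed.

End ComplexIntegrals.

(** * Integration by parts for Lipschitz functions *)

Section IntegrationByParts.
Context {R : realType}.

Lemma carried_bounded (f : R -> R) (c d : R) : continuous f ->
  (forall x, ~~ (c <= x <= d) -> f x = 0) ->
  exists2 B : R, 0 < B & forall x, `|f x| <= B.
Proof.
move=> cf f0; have [cd|dc] := leP c d; last first.
  by exists 1 => // x; rewrite f0 ?normr0//; apply/negP; lra.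
have cn : {within `[c, d], continuous (fun x => `|f x|)}.
  apply: continuous_subspaceT => x.
  by apply: continuous_comp; [exact: cf|exact: norm_continuous].
have [t _ Ht] := EVT_max cd cn; exists (`|f t| + 1); first by rewrite ltr_wpDl.
move=> x; have [xcd|/f0 ->] := boolP (c <= x <= d); last by rewrite normr0 addr_ge0.
by apply: (le_trans (Ht x _)); rewrite ?lerDl// in_itv.
Qed.

(** The product [w * phi] is Lipschitz, so its density, which is
    [k * phi + w * phi'] almost everywhere, has integral zero. *)
Lemma lipschitz_by_parts (w k phi phi' : R -> R) (L a b c d : R) : 0 < L ->
  a < c -> c <= d -> d < b ->
  (forall x y, `|w x - w y| <= L * `|x - y|) ->
  measurable_fun `]a, b[ k ->
  {ae mu, forall x : R, a < x < b -> is_derive x 1 w (k x)} ->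
  (forall x : R, is_derive x 1 phi (phi' x)) -> continuous phi' ->
  (forall x, ~~ (c <= x <= d) -> phi x = 0) ->
  (forall x, ~~ (c <= x <= d) -> phi' x = 0) ->
  mu.-integrable `]a, b[ (EFin \o (fun x => k x * phi x)) /\
  \int[mu]_(x in `]a, b[) (k x * phi x) = - \int[mu]_(x in `]a, b[) (w x * phi' x).
Proof.
move=> L0 ac cd db wL mk dw dphi cphi' phi0 phi'0.
have ab : a < b by lra.
have mab : measurable (`]a, b[ : set R) by exact: measurable_itv.
have cdab : `[c, d] `<=` `]a, b[.
  exact: segment_sub_oo.
have cphi : continuous phi.
  by move=> x; have [/derivable1_diffP/differentiable_continuous] := dphi x.
have cw := lipschitz_continuous wL.
have [B B0 HB] := carried_bounded cphi phi0.
have [B' B'0 HB'] := carried_bounded cphi' phi'0.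
have phiL x y : `|phi x - phi y| <= B' * `|x - y|.
  by apply: (@derive_bounded_lipschitz _ phi phi' (Num.min x y - 1) (Num.max x y + 1)) => //;
    rewrite ltrBlDr ltr_pwDr ?ge_min ?lexx ?orbT//= -ltrBlDr ?lt_max; lra.
pose Bw := `|w c| + L * (d - c).
have wB x : c <= x <= d -> `|w x| <= Bw.
  move=> /andP[cx xd]; have := wL x c; rewrite (@ger0_norm _ (x - c)) ?subr_ge0//.
  have := ler_normD (w x - w c) (w c); rewrite subrK /Bw.
  have := ler_wpM2l (ltW L0) (lerB xd (lexx c)); lra.
have Bw0 : 0 <= Bw by rewrite addr_ge0// mulr_ge0 ?(ltW L0)//; lra.
pose M := Bw * B' + L * B.
have M0 : 0 < M by rewrite ltr_wpDl ?mulr_gt0// mulr_ge0// ltW.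
have one x y : c <= x <= d -> `|w x * phi x - w y * phi y| <= M * `|x - y|.
  move=> xcd; have -> : w x * phi x - w y * phi y =
    w x * (phi x - phi y) + (w x - w y) * phi y by ring.
  apply: (le_trans (ler_normD _ _)); rewrite !normrM /M mulrDl.
  apply: lerD; first by rewrite -mulrA; apply: ler_pM => //; exact: wB.
  by rewrite mulrAC; apply: ler_pM.
have WL x y : `|w x * phi x - w y * phi y| <= M * `|x - y|.
  have [/one//|x0] := boolP (c <= x <= d).
  have [/one h|y0] := boolP (c <= y <= d); first by rewrite distrC (distrC x).
  by rewrite !phi0// !mulr0 subrr normr0 mulr_ge0// ltW.
have [K [Kint K0 dK]] := lipschitz_density M0 ab WL.
have {}K0 : \int[mu]_(x in `]a, b]) K x = 0.
  by rewrite K0 !phi0 ?mulr0 ?subrr//; apply/negP; lra.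
have Kint' : mu.-integrable `]a, b[ (EFin \o K).
  by apply: integrableS Kint => //; exact: subset_itv_oo_oc.
have {}K0 : \int[mu]_(x in `]a, b[) K x = 0 by rewrite Rintegral_itv_bndo_bndc.
have mphi (f : R -> R) : continuous f -> measurable_fun `]a, b[ f.
  by move=> cf; apply: continuous_oo_measurable => x _; exact: cf.
have mE : measurable_fun `]a, b[ (fun x => k x * phi x + w x * phi' x).
  apply: measurable_funD; apply: measurable_funM => //; exact: mphi.
have Kae : ae_eq mu `]a, b[%classic (EFin \o (fun x => k x * phi x + w x * phi' x)) (EFin \o K).
  apply: filterS2 dw dK; first exact: (ae_filter_ringOfSetsType mu).
  move=> x wx Kx /=; rewrite in_itv/= => xab; congr EFin.
  have [_ e1] := Kx xab; have [_ e2] := is_deriveM (wx xab) (dphi x).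
  have -> : K x = w x *: phi' x + phi x *: k x by exact: etrans (esym e1) e2.
  by rewrite /GRing.scale/=; ring.
have Eint : mu.-integrable `]a, b[ (EFin \o (fun x => k x * phi x + w x * phi' x)).
  have mE' := (iffRL (measurable_EFinP _ _)) mE.
  have mabs (f : R -> \bar R) : measurable_fun `]a, b[ f ->
      measurable_fun `]a, b[ (fun x => `|f x|%E).
    by move=> mf; apply: measurableT_comp.
  have /integrableP[mK Klt] := Kint'.
  apply/integrableP; split; first exact: mE'.
  apply: le_lt_trans Klt; rewrite le_eqVlt; apply/orP; left; apply/eqP.
  apply: ge0_ae_eq_integral => //; last exact: ae_eq_abse Kae.
  - exact: (mabs _ mE').
  - exact: (mabs _ mK).
have E0 : \int[mu]_(x in `]a, b[) (k x * phi x + w x * phi' x) = 0.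
  rewrite -K0 /Rintegral; congr fine; apply: ae_eq_integral => //.
    exact: (iffRL (measurable_EFinP _ _)) mE.
  by case/integrableP : Kint'.
have wphi : mu.-integrable `]a, b[ (EFin \o (fun x => w x * phi' x)).
  apply: (carried_integrable mab cdab).
    by move=> x; apply: cvgM; [exact: cw|exact: cphi'].
  by move=> x /phi'0 ->; rewrite mulr0.
have kphi : mu.-integrable `]a, b[ (EFin \o (fun x => k x * phi x)).
  pose E1 x := k x * phi x + w x * phi' x; pose E2 x := w x * phi' x.
  rewrite (_ : EFin \o _ = (fun x => (EFin \o E1) x - (EFin \o E2) x)%E).
    exact: integrableB.
  by apply/funext => x /=; rewrite -EFinB addrK.
split => //; apply/eqP; rewrite -addr_eq0 -RintegralD//; exact/eqP.
Qed.

End IntegrationByParts.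

Section ComplexParts.
Context {R : realType}.
Implicit Types (w k phi : R -> R[i]).

Definition Clipschitz (L : R) w :=
  (forall x y, `|complex.Re (w x) - complex.Re (w y)| <= L * `|x - y|) /\
  (forall x y, `|complex.Im (w x) - complex.Im (w y)| <= L * `|x - y|).

Lemma Clipschitz_continuous L w : Clipschitz L w -> forall x, Ccontinuous_at w x.
Proof. by move=> [w1 w2] x; split; exact: lipschitz_continuous. Qed.

Lemma Clipschitz_modc L w x y : Clipschitz L w -> modc (w x - w y) <= 2 * (L * `|x - y|).
Proof. by move=> [w1 w2]; apply: modc_le2; rewrite ?ReD ?ReN ?ImD ?ImN. Qed.

Lemma Cby_parts w k phi (L a b : R) : 0 < L -> a < b -> Clipschitz L w ->
  measurable_fun `]a, b[ (fun x => complex.Re (k x)) ->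
  measurable_fun `]a, b[ (fun x => complex.Im (k x)) ->
  {ae mu, forall x : R, a < x < b -> Cis_derive w x (k x)} ->
  test_function `]a, b[ phi ->
  Cintegral `]a, b[ (fun x => k x * phi x) =
  - Cintegral `]a, b[ (fun x => w x * Cderive phi x).
Proof.
move=> L0 ab [w1L w2L] mk1 mk2 dw tphi.
have [c [d [ac cd db phi0]]] := test_function_oo ab tphi.
have [sphi _ _] := tphi.
have [cphi' phi'0] := derive_carried sphi phi0.
have aeR : {ae mu, forall x : R, a < x < b ->
    is_derive x 1 (fun t => complex.Re (w t)) (complex.Re (k x))}.
  apply: filterS dw; first exact: (ae_filter_ringOfSetsType mu).
  by move=> x /= H /H[].
have aeI : {ae mu, forall x : R, a < x < b ->
    is_derive x 1 (fun t => complex.Im (w t)) (complex.Im (k x))}.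
  apply: filterS dw; first exact: (ae_filter_ringOfSetsType mu).
  by move=> x /= H /H[].
have p1 (x : R) : is_derive x 1 (fun t => complex.Re (phi t)) (complex.Re (Cderive phi x)).
  by have [] := smooth_is_derive x sphi.
have p2 (x : R) : is_derive x 1 (fun t => complex.Im (phi t)) (complex.Im (Cderive phi x)).
  by have [] := smooth_is_derive x sphi.
have c1 : continuous (fun x => complex.Re (Cderive phi x)) by move=> x; have [] := cphi' x.
have c2 : continuous (fun x => complex.Im (Cderive phi x)) by move=> x; have [] := cphi' x.
have z1 x : ~~ (c <= x <= d) -> complex.Re (phi x) = 0 by move=> /phi0 ->.
have z2 x : ~~ (c <= x <= d) -> complex.Im (phi x) = 0 by move=> /phi0 ->.
have y1 x : ~~ (c <= x <= d) -> complex.Re (Cderive phi x) = 0 by move=> /phi'0 ->.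
have y2 x : ~~ (c <= x <= d) -> complex.Im (Cderive phi x) = 0 by move=> /phi'0 ->.
have [i11 e11] := lipschitz_by_parts L0 ac cd db w1L mk1 aeR p1 c1 z1 y1.
have [i12 e12] := lipschitz_by_parts L0 ac cd db w1L mk1 aeR p2 c2 z2 y2.
have [i21 e21] := lipschitz_by_parts L0 ac cd db w2L mk2 aeI p1 c1 z1 y1.
have [i22 e22] := lipschitz_by_parts L0 ac cd db w2L mk2 aeI p2 c2 z2 y2.
have mab : measurable (`]a, b[ : set R) by exact: measurable_itv.
have cdab : `[c, d] `<=` `]a, b[.
  exact: segment_sub_oo.
have int (f g : R -> R) : continuous f -> continuous g ->
    (forall x, ~~ (c <= x <= d) -> g x = 0) ->
    mu.-integrable `]a, b[ (EFin \o (fun x => f x * g x)).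
  move=> cf cg g0; apply: (carried_integrable mab cdab).
    by move=> x; apply: cvgM; [exact: cf|exact: cg].
  by move=> x /g0 ->; rewrite mulr0.
have cw1 := lipschitz_continuous w1L; have cw2 := lipschitz_continuous w2L.
apply: complex_ext; rewrite ?ReN ?ImN /=.
- transitivity (\int[mu]_(x in `]a, b[) (complex.Re (k x) * complex.Re (phi x) -
    complex.Im (k x) * complex.Im (phi x))).
    by congr Rintegral; apply/funext => x; rewrite CReM.
  rewrite RintegralB// e11 e22 opprK -[LHS]opprK; congr (- _).
  rewrite opprD opprK -RintegralB//; try exact: int.
  by congr Rintegral; apply/funext => x; rewrite CReM.
- transitivity (\int[mu]_(x in `]a, b[) (complex.Re (k x) * complex.Im (phi x) +
    complex.Im (k x) * complex.Re (phi x))).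
    by congr Rintegral; apply/funext => x; rewrite CImM.
  rewrite RintegralD// e12 e21 -opprD; congr (- _).
  rewrite -RintegralD//; try exact: int.
  by congr Rintegral; apply/funext => x; rewrite CImM.
Qed.

Lemma lipschitz_derive_le (w : R -> R) (L x K : R) :
  (forall x y, `|w x - w y| <= L * `|x - y|) -> is_derive x 1 w K -> `|K| <= L.
Proof.
move=> wL [dw wK]; rewrite leNgt; apply/negP => LK.
have e0 : 0 < (`|K| - L) / 2 by rewrite divr_gt0// subr_gt0.
move/cvg_ex : (dw) => [K' hK'].
have KK' : K' = K by rewrite -wK; apply/esym/cvg_lim.
rewrite {K'}KK' in hK'.
move/(@cvgrPdist_le _ R^o) : hK' => /(_ _ e0).
rewrite near_withinE => /nbhs_normP[d /= d0 Hd].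
have d20 : 0 < d / 2 by rewrite divr_gt0.
have d2d : `|0 - d / 2| < d by rewrite sub0r normrN gtr0_norm//; lra.
have := Hd (d / 2) d2d (lt0r_neq0 d20).
rewrite /GRing.scale/= mulr1 => h.
have := wL (d / 2 + x) x; rewrite addrK (gtr0_norm d20) => h2.
have h3 : `|(d / 2)^-1 * (w (d / 2 + x) - w x)| <= L.
  by rewrite normrM normfV (gtr0_norm d20) ler_pdivrMl// [_ * L]mulrC.
have := ler_distD ((d / 2)^-1 * (w (d / 2 + x) - w x)) K 0; rewrite !subr0; lra.
Qed.

Lemma Clipschitz_density w (L a b : R) : 0 < L -> a < b -> Clipschitz L w ->
  exists k, Linfty `]a, b[ k /\
    {ae mu, forall x : R, a < x < b -> Cis_derive w x (k x)}.
Proof.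
move=> L0 ab [w1 w2].
have [K1 [i1 _ d1]] := lipschitz_density L0 ab w1.
have [K2 [i2 _ d2]] := lipschitz_density L0 ab w2.
have mK (K : R -> R) : mu.-integrable `]a, b] (EFin \o K) -> measurable_fun `]a, b[ K.
  move=> /integrableP[/measurable_EFinP mK _]; apply: measurable_funS mK => //.
  exact: subset_itv_oo_oc.
have dk : {ae mu, forall x : R, a < x < b -> Cis_derive w x (K1 x +i* K2 x)}.
  apply: filterS2 d1 d2; first exact: (ae_filter_ringOfSetsType mu).
  by move=> x h1 h2 xab; split; [exact: h1|exact: h2].
exists (fun x => K1 x +i* K2 x); split=> //; split=> /=; try exact: mK.
exists (2 * L); apply: filterS dk; first exact: (ae_filter_ringOfSetsType mu).
move=> x /= h; rewrite in_itv/= => /h[/= h1 h2]; rewrite le_normC.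
by apply: modc_le2 => /=; [exact: (lipschitz_derive_le w1)|exact: (lipschitz_derive_le w2)].
Qed.

(** The primitive is defined on the whole line with a global Lipschitz constant,
    as [lipschitz_by_parts] requires. *)
Lemma bounded_primitive (f : R -> R) (a b M : R) : measurable_fun setT f ->
  (forall x, `|f x| <= M) -> (forall x, ~~ (a < x < b) -> f x = 0) ->
  exists W : R -> R,
    [/\ forall x y, `|W x - W y| <= M * `|x - y|,
        forall x y, x <= y -> W y - W x = \int[mu]_(t in `[x, y]) f t &
        {ae mu, forall x : R, is_derive x 1 W (f x)}].
Proof.
move=> mf fM f0.
have fab : f \_ `]a, b[ = f.
  apply/funext => x; rewrite patchE; case: ifPn => // h; rewrite f0//.
  by move: h; rewrite notin_setE /= in_itv/= => /negP.
have iab : mu.-integrable `]a, b[ (EFin \o f).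
  apply: (bounded_itv_integrable (a := a) (b := b) (K := M)) => //.
  exact: measurable_funTS.
have iT : mu.-integrable setT (EFin \o f).
  have := proj1 (@integrable_mkcond _ _ _ mu `]a, b[%classic (EFin \o f)
    (measurable_itv _)) iab.
  by rewrite restrict_EFin fab.
have int (i : interval R) : mu.-integrable [set` i] (EFin \o f).
  by apply: integrableS iT.
pose W x := \int[mu]_(t in `]-oo, x]) f t.
have WE x y : x <= y -> W y - W x = \int[mu]_(t in `]x, y]) f t.
  by move=> xy; rewrite /W (@Rintegral_itvB _ f -oo%O (BRight y) x).
have WL x y : x <= y -> `|W y - W x| <= M * (y - x).
  move=> xy; rewrite WE//.
  have mxy : measurable (`]x, y] : set R) by exact: measurable_itv.
  have h1 : `|\int[mu]_(t in `]x, y]) f t| <= \int[mu]_(t in `]x, y]) `|f t|.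
    by apply: le_normr_Rintegral => //; exact: int.
  apply: (le_trans h1).
  have muxy : fine (mu (`]x, y] : set R)) = y - x.
    rewrite lebesgue_measure_itv/= lte_fin; move: xy.
    by rewrite le_eqVlt => /predU1P[->|->//]; rewrite ltxx subrr.
  have -> : M * (y - x) = \int[mu]_(t in `]x, y]) (cst M) t.
    by rewrite Rintegral_cst// muxy.
  have muo : (mu (`]x, y] : set R) < +oo)%E.
    by rewrite lebesgue_measure_itv/=; case: ifP; rewrite ?ltry// -EFinB ltry.
  apply: le_Rintegral => //.
  - exact: (integrable_abse (int _)).
  - apply: measurable_bounded_integrable => //.
    exists `|M|; split; first by rewrite num_real.
    by move=> N /ltW MN t _; exact: MN.
exists W; split.
- move=> x y; have [xy|/ltW yx] := leP x y.
    by rewrite distrC (distrC x) (ger0_norm _ : `|y - x| = _) ?subr_ge0//; exact: WL.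
  by rewrite (ger0_norm _ : `|x - y| = _) ?subr_ge0//; exact: WL.
- by move=> x y xy; rewrite WE// Rintegral_itv_obnd_cbnd.
have lf : locally_integrable [set: R] f.
  by have := integrable_locally measurableT iT; rewrite patch_setT.
have := FTC1Ny (fun y => int _) lf.
apply: filterS; first exact: (ae_filter_ringOfSetsType mu).
by move=> x [dF F']; exact: is_derive_derive1 dF F'.
Qed.

End ComplexParts.

(** * Smooth approximations of characteristic functions of intervals *)

Section Bumps.
Context {R : realType}.

(** [psi k c d] approximates the characteristic function of the segment from
    [c] to [d]. It is the difference of two smooth steps of width [k], so its
    derivative is the difference of two approximate identities, at [c] and at
    [d]. The constant is uniform in all parameters, and dilation preserves the
    family, which makes the estimate usable in a limit of dilations. *)
Lemma exists_bumps : exists (psi : R -> R -> R -> R -> R) (C : R), 0 < C /\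
  forall k c d, 0 < k -> c <= d ->
  [/\ forall n, nderivable n (psi k c d),
      forall t, ~~ (c <= t <= d + k) -> psi k c d t = 0,
      forall x0 e t, 0 < e ->
        psi k c d ((t - x0) / e) = psi (e * k) (x0 + e * c) (x0 + e * d) t &
      forall (w : R -> R) L a b, 0 <= L ->
        (forall x y, `|w x - w y| <= L * `|x - y|) -> a < c -> d + k < b ->
        `|(- \int[mu]_(t in `]a, b[) (w t * derive1 (psi k c d) t)) - (w d - w c)|
          <= C * (L * k)].
Proof.
have [S [nS S0 S1]] := @smooth_step R.
pose S' := derive1 S.
have dS (x : R) : is_derive x 1 S (S' x) := nderivable_is_derive (nS 1%N) x.
have cS' : continuous S'.
  by move=> x; have [_ [/(_ x)/derivable1_diffP/differentiable_continuous]] := nS 2%N.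
have S'0 (x : R) : ~~ (0 <= x <= 1) -> S' x = 0.
  move=> x01; rewrite /S' derive1E.
  suff [s sx] : exists s : R, \forall t \near x, s = S t.
    have [_ ->//] : is_derive x 1 S 0.
    by apply: (@near_eq_is_derive _ _ _ (cst s)).
  move: x01; rewrite negb_and -!ltNge => /orP[x0|x1].
    exists 0; have xx : x \in `]x - 1, 0[ by rewrite in_itv/= x0 andbT; lra.
    apply: filterS (near_in_itvoo xx) => t; rewrite in_itv/= => /andP[_ t0].
    by rewrite S0// ltW.
  exists 1; have xx : x \in `]1, x + 1[ by rewrite in_itv/= x1; lra.
  apply: filterS (near_in_itvoo xx) => t; rewrite in_itv/= => /andP[t1 _].
  by rewrite S1// ltW.
have [B B0 HB] := carried_bounded cS' S'0.
exists (fun k c d t => S ((t - c) / k) - S ((t - d) / k)), (2 * B).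
split=> [|k c d k0 cd]; first by rewrite mulr_gt0.
have in01 s t : (0 <= (t - s) / k <= 1) = (s <= t <= s + k).
  by rewrite ler_pdivlMr// ler_pdivrMr// mul0r mul1r subr_ge0 lerBlDl.
pose rho (s t : R) := k^-1 * S' ((t - s) / k).
have drho (s t : R) : is_derive t 1 (fun t => S ((t - s) / k)) (rho s t).
  exact: is_derive_affine.
have crho s : continuous (rho s).
  move=> t; apply: cvgM; first exact: cvg_cst.
  apply: (@continuous_comp _ _ _ (fun t => (t - s) / k) S'); last exact: cS'.
  apply: cvgM; last exact: cvg_cst.
  by apply: cvgB; [exact: cvg_id|exact: cvg_cst].
have rho0 s t : ~~ (s <= t <= s + k) -> rho s t = 0.
  by rewrite -in01 => /S'0 h; rewrite /rho h mulr0.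
have rhoB s t : `|rho s t| <= k^-1 * B.
  by rewrite /rho normrM gtr0_norm ?invr_gt0// ler_wpM2l// invr_ge0 ltW.
split.
- move=> n; rewrite (_ : (fun t => _) =
    (fun t => S ((t - c) / k) + (- 1) * S ((t - d) / k))); last first.
    by apply/funext => t; rewrite mulN1r.
  apply: nderivableD; first exact: nderivable_affine.
  by apply: nderivableM; [exact: nderivable_cst|exact: nderivable_affine].
- move=> t; rewrite negb_and -!ltNge => /orP[tc|dt].
    by rewrite !S0 ?subrr// ler_pdivrMr// mul0r; lra.
  by rewrite !S1 ?subrr// ler_pdivlMr// mul1r; lra.
- move=> x0 e t e0; congr (S _ - S _); field; rewrite ?(gt_eqF e0) ?(gt_eqF k0)//.
move=> w L a b L0 wL ac db.
have cw := lipschitz_continuous wL.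
have mab : measurable (`]a, b[ : set R) by exact: measurable_itv.
pose J s := \int[mu]_(t in `]a, b[) (w t * rho s t).
have Jint s : a < s -> s + k < b ->
    mu.-integrable `]a, b[ (EFin \o (fun t => w t * rho s t)).
  move=> as_ sb; apply: (@carried_integrable _ _ s (s + k)) => //.
  - exact: segment_sub_oo.
  - by move=> t; apply: cvgM; [exact: cw|exact: crho].
  - by move=> t /rho0 ->; rewrite mulr0.
have JE s : a < s -> s + k < b -> `|J s - w s| <= B * (L * k).
  move=> as_ sb; have sk : s <= s + k by lra.
  have sub : `[s, s + k] `<=` `]a, b[.
    exact: segment_sub_oo.
  have cint (g : R -> R) : continuous g -> mu.-integrable `[s, s + k] (EFin \o g).
    move=> cg; apply: continuous_compact_integrable; first exact: segment_compact.
    exact: continuous_subspaceT.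
  have rho1 : \int[mu]_(t in `[s, s + k]) rho s t = 1.
    rewrite (Rintegral_derive sk (crho s) (fun t _ => drho s t)) S1 ?S0 ?subr0//.
      by rewrite subrr mul0r.
    by rewrite addrAC subrr add0r mulfV// gt_eqF.
  rewrite /J (carried_Rintegral sub); last by move=> t /rho0 ->; rewrite mulr0.
  rewrite -[X in _ - X]mulr1 -rho1 -RintegralZl//; last exact: cint.
  rewrite -RintegralB//; first last.
  - by apply: cint => t; apply: cvgM; [exact: cvg_cst|exact: crho].
  - by apply: cint => t; apply: cvgM; [exact: cw|exact: crho].
  have -> : B * (L * k) = (B * L) * (s + k - s) by ring.
  apply: Rintegral_le => //.
    by move=> t; apply: cvgB; apply: cvgM; rewrite ?cvg_cst//;
      [exact: cw|exact: crho|exact: cvg_cst|exact: crho].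
  move=> t /andP[st tk]; rewrite -mulrBl normrM.
  have -> : B * L = (L * k) * (k^-1 * B) by field; rewrite gt_eqF.
  apply: ler_pM => //; apply: (le_trans (wL t s)).
  by rewrite ler_wpM2l// ger0_norm; lra.
have -> : \int[mu]_(t in `]a, b[) (w t * derive1 (fun t => S ((t - c) / k) - S ((t - d) / k)) t) =
    J c - J d.
  rewrite /J -RintegralB//; try by apply: Jint; lra.
  congr Rintegral; apply/funext => t; rewrite -mulrBr; congr (_ * _).
  by rewrite derive1E; have [_ ->] := is_deriveB (drho c t) (drho d t).
have hJc : `|J c - w c| <= B * (L * k) by apply: JE => //; lra.
have hJd : `|J d - w d| <= B * (L * k) by apply: JE => //; lra.
rewrite -mulrA; move: (J c) (J d) (w c) (w d) (B * (L * k)) hJc hJd => Jc Jd wc wd e.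
rewrite (distrC Jd) !ler_norml => /andP[? ?] /andP[? ?].
by apply/andP; split; lra.
Qed.

End Bumps.

(** * The Lipschitz primitive and its boundary function *)

Section LipschitzPrimitive.
Context {R : realType}.

Lemma expansion2_near (H K : R[i] -> R[i]) z (d : R) : 0 < d ->
  (forall h, modc h <= d -> H (z + h) = K (z + h)) ->
  expansion2 K z -> expansion2 H z.
Proof.
move=> d0 HK [p1 [p2 ho]]; exists p1, p2; apply: (little_o2_near d0 _ ho) => h hd.
have := HK 0; rewrite modc0 addr0 => /(_ (ltW d0)) ->.
by rewrite HK.
Qed.

Variables (F : R[i] -> R[i]) (a b r M : R).
Hypotheses (ab : a < b) (r0 : 0 < r) (M0 : 0 < M).
Hypothesis dF : forall x y, a < x < b -> 0 < y < r ->
  exists D, Cdiff F (x +i* y) D.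
Hypothesis FM : forall x y, a < x < b -> 0 < y < r -> modc (F (x +i* y)) <= M.

(** The real and imaginary parts are extended separately from the rectangle,
    where the derivatives in both directions are bounded by [M]. *)
Lemma lipschitz_primitive : exists G : R -> R -> R[i],
  [/\ forall x y x' y',
        `|complex.Re (G x y) - complex.Re (G x' y')| <= M * (`|x - x'| + `|y - y'|),
      forall x y x' y',
        `|complex.Im (G x y) - complex.Im (G x' y')| <= M * (`|x - x'| + `|y - y'|),
      forall x y, a < x < b -> 0 < y < r ->
        Cis_derive (fun s => G s y) x (F (x +i* y)) &
      forall x y, a < x < b -> 0 < y < r ->
        expansion2 (fun w => G (complex.Re w) (complex.Im w)) (x +i* y)].
Proof.
have mid : a < (a + b) / 2 < b /\ 0 < r / 2 < r.
  by rewrite !midf_lt// divr_gt0// ltr_pdivrMr// ltr_pMr// ltr1n.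
have [G dG] := primitive dF FM ab r0.
pose S := [set p : R * R | a < p.1 < b /\ 0 < p.2 < r].
pose dist (p q : R * R) := `|p.1 - q.1| + `|p.2 - q.2|.
have ext (h : R[i] -> R) : (forall c d, h (c - d) = h c - h d) ->
    (forall c, `|h c| <= modc c) ->
    (forall x y, a < x < b -> 0 < y < r ->
      is_derive x 1 (fun s => h (G s y)) (h (F (x +i* y))) /\
      is_derive y 1 (fun s => h (G x s)) (h (F (x +i* y) * 'i))) ->
    exists g : R * R -> R, (forall p, S p -> g p = h (G p.1 p.2)) /\
      forall p q, `|g p - g q| <= M * dist p q.
  move=> hB hM dh.
  apply: (@lipschitz_extension _ _ dist S (fun p => h (G p.1 p.2)) M); first exact: ltW.
  - by move=> p; rewrite /dist !subrr normr0 addr0.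
  - by move=> p q; rewrite /dist distrC (distrC p.2).
  - by move=> p q s; rewrite /dist; have := ler_distD q.1 p.1 s.1;
      have := ler_distD q.2 p.2 s.2; lra.
  - by exists ((a + b) / 2, r / 2).
  move=> [x y] [x' y'] [/= hx hy] [/= hx' hy'].
  have -> : h (G x y) - h (G x' y') =
    (h (G x y) - h (G x' y)) + (h (G x' y) - h (G x' y')) by ring.
  apply: (le_trans (ler_normD _ _)); rewrite /dist /= mulrDr; apply: lerD.
    apply: (@derive_bounded_lipschitz _ (fun s => h (G s y)) (fun s => h (F (s +i* y))) a b) => //.
      by move=> t ht; have [] := dh _ _ ht hy.
    by move=> t ht; apply: (le_trans (hM _)); exact: FM.
  apply: (@derive_bounded_lipschitz _ (fun s => h (G x' s))
    (fun s => h (F (x' +i* s) * 'i)) 0 r) => //.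
    by move=> t ht; have [] := dh _ _ hx' ht.
  by move=> t ht; apply: (le_trans (hM _)); rewrite modcM modc_i mulr1; exact: FM.
have [g1 [g1E g1L]] : exists g : R * R -> R,
    (forall p, S p -> g p = complex.Re (G p.1 p.2)) /\
    forall p q, `|g p - g q| <= M * dist p q.
  apply: ext; [by move=> c d; rewrite ReD ReN|exact: modc_Re|].
  by move=> x y hx hy; have [[? ?] [? ?]] := dG x y hx hy.
have [g2 [g2E g2L]] : exists g : R * R -> R,
    (forall p, S p -> g p = complex.Im (G p.1 p.2)) /\
    forall p q, `|g p - g q| <= M * dist p q.
  apply: ext; [by move=> c d; rewrite ImD ImN|exact: modc_Im|].
  by move=> x y hx hy; have [[? ?] [? ?]] := dG x y hx hy.
exists (fun x y => g1 (x, y) +i* g2 (x, y)); split.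
- by move=> x y x' y'; exact: g1L.
- by move=> x y x' y'; exact: g2L.
- move=> x y hx hy; have [[h1 h2] _] := dG x y hx hy.
  have xab : x \in `]a, b[ by rewrite in_itv.
  split.
    apply: (near_eq_is_derive _ h1); apply: filterS (near_in_itvoo xab) => t.
    by rewrite in_itv/= => ht; rewrite g1E.
  apply: (near_eq_is_derive _ h2); apply: filterS (near_in_itvoo xab) => t.
  by rewrite in_itv/= => ht; rewrite g2E.
- move=> x y hx hy; have [D FD] := dF hx hy.
  pose d := Num.min (Num.min ((x - a) / 2) ((b - x) / 2)) (Num.min (y / 2) ((r - y) / 2)).
  apply: (@expansion2_near _ (fun w => G (complex.Re w) (complex.Im w)) _ d).
  + by rewrite /d !lt_min; lra.
  + move=> h; rewrite /d !le_min => /andP[/andP[h1 h2] /andP[h3 h4]].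
    have := modc_Re h; have := modc_Im h; rewrite !ler_norml => hi hr.
    have Sh : S (complex.Re (x +i* y + h), complex.Im (x +i* y + h)).
      by rewrite /S /= !ReImE /=; lra.
    by apply: complex_ext; rewrite /= ?g1E ?g2E.
  have dG1 u v : a < u < b -> 0 < v < r -> Cis_derive (fun s => G s v) u (F (u +i* v)).
    by move=> hu hv; have [] := dG u v hu hv.
  have dG2 u v : a < u < b -> 0 < v < r -> Cis_derive (G u) v (F (u +i* v) * 'i).
    by move=> hu hv; have [] := dG u v hu hv.
  exact: primitive_expansion2 dG1 dG2 _ _ _ hx hy FD.
Qed.

End LipschitzPrimitive.

(** * A one-sided derivative of the boundary function is two-sided *)

Section LeftDerivative.
Context {R : realType}.
Variables (G : R -> R -> R[i]) (a b r L : R) (x0 : R) (g : R[i]).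
Hypotheses (L0 : 0 < L) (x0ab : a < x0 < b) (r0 : 0 < r).
Hypothesis GL : forall x y x' y',
  modc (G x y - G x' y') <= L * (`|x - x'| + `|y - y'|).
Hypothesis eG : forall x y, a < x < b -> 0 < y < r ->
  expansion2 (fun w => G (complex.Re w) (complex.Im w)) (x +i* y).
Hypothesis rightD : forall e, 0 < e -> exists2 d : R, 0 < d &
  forall h, 0 < h -> h <= d -> modc (G (x0 + h) 0 - G x0 0 - g * h%:C) <= e * h.

(** The estimate [two_constants] is applied to the difference of [G] and its
    expected affine approximation, rescaled so that the point [x0 - h]
    corresponds to -1, and shifted upwards into the rectangle. *)
Lemma left_derivative : forall e, 0 < e -> exists2 d : R, 0 < d &
  forall h, 0 < h -> h <= d -> modc (G (x0 - h) 0 - G x0 0 + g * h%:C) <= e * h.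
Proof.
have Lpos := L0; have x0_in := x0ab; have rpos := r0.
move=> e e0; have mg := modc_ge0 g.
pose N := L + modc g + 1; have N0 : 0 < N by rewrite /N; lra.
(* Three errors of [e / 3]: the height [eta] of the point which replaces -1, the
   upward shift [s], and the two-constants estimate. *)
pose eta := Num.min 1 (e / (3 * N)).
have eta0 : 0 < eta by rewrite lt_min ltr01 divr_gt0// mulr_gt0.
have eta1 : eta <= 1 by rewrite ge_min lexx.
have etaN : N * eta <= e / 3.
  rewrite (_ : e / 3 = N * (e / (3 * N))); last by field; rewrite gt_eqF.
  by rewrite ler_wpM2l ?(ltW N0)// ge_min lexx orbT.
move: (eta) eta0 eta1 etaN => {}eta eta0 eta1 etaN.
have [B B0 HB] := two_constants eta0 eta1.
pose C := L * (2 * B + 1) + modc g * (2 * B).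
have C0 : 0 <= C by rewrite addr_ge0// mulr_ge0//; lra.
have e30 : 0 < e / 3 by rewrite divr_gt0.
have [d d0 Hd] := HB C (e / 3) C0 e30.
pose s := Num.min 1 (Num.min (d / (2 * L)) (e / (3 * L))).
have s0 : 0 < s by rewrite !lt_min ltr01 !divr_gt0// mulr_gt0.
have [s1 sd se] : [/\ s <= 1, L * s <= d / 2 & L * s <= e / 3].
  split; first by rewrite ge_min lexx.
  - rewrite (_ : d / 2 = L * (d / (2 * L))); last by field; rewrite gt_eqF.
    by rewrite ler_wpM2l ?(ltW L0)// !ge_min lexx orbT.
  - rewrite (_ : e / 3 = L * (e / (3 * L))); last by field; rewrite gt_eqF.
    by rewrite ler_wpM2l ?(ltW L0)// !ge_min lexx !orbT.
move: (s) s0 s1 sd se => {}s s0 s1 sd se.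
have d40 : 0 < d / 4 by rewrite divr_gt0.
have [d' d'0 Hd'] := rightD d40.
pose m := Num.min (Num.min (x0 - a) (b - x0)) r.
have m0 : 0 < m by rewrite !lt_min; lra.
exists (Num.min (m / (2 * (B + 1))) (d' / 2)).
  by rewrite lt_min !divr_gt0// mulr_gt0//; lra.
move=> eps eps0; rewrite le_min => /andP[epsm epsd'].
have {}epsm : eps * (B + 1) <= m / 2.
  by move: epsm; rewrite ler_pdivlMr ?mulr_gt0//; lra.
have mm : [/\ m <= x0 - a, m <= b - x0 & m <= r] by rewrite !ge_min !lexx ?orbT.
move: (m) m0 mm epsm => {}m m0 mm epsm.
have eB0 : 0 <= eps * B by rewrite mulr_ge0// ltW.
pose Gf w := G (complex.Re w) (complex.Im w).
pose H (w : R[i]) : R[i] := (eps^-1)%:C *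
  (Gf (x0 +i* (eps * s) + eps%:C * w) + (- G x0 0 + (- (g * eps%:C)) * w)).
have HE x y : H (x +i* y) = (eps^-1)%:C *
    (G (x0 + eps * x) (eps * s + eps * y) - G x0 0 - g * eps%:C * (x +i* y)).
  by rewrite /H /Gf !ReImE /= !mul0r !subr0 !addr0; ring.
have modH x y : modc (H (x +i* y)) = eps^-1 *
    modc (G (x0 + eps * x) (eps * s + eps * y) - G x0 0 - g * eps%:C * (x +i* y)).
  by rewrite HE modcM modc_real gtr0_norm ?invr_gt0.
have Hzeta : modc (H ((-1) +i* eta)) <= e / 3.
  apply: Hd.
  - move=> x y y0; rewrite ler_norml => /andP[xB xB'] yB.
    have ex : - (eps * B) <= eps * x /\ eps * x <= eps * B.
      by rewrite -mulrN !ler_wpM2l// ltW.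
    have ey : 0 <= eps * y /\ eps * y <= eps * B by rewrite mulr_ge0 ?ler_wpM2l// ltW.
    have es : 0 < eps * s /\ eps * s <= eps by rewrite mulr_gt0// ger_pMr.
    have [m1 m2 m3] := mm; split.
      apply: expansion2M; first exact: expansion2_cst.
      apply: expansion2D; last first.
        apply: expansion2D; first exact: expansion2_cst.
        by apply: expansion2M; [exact: expansion2_cst|exact: expansion2_id].
      apply: expansion2_affine => //.
      rewrite (_ : _ + _ = (x0 + eps * x) +i* (eps * s + eps * y)).
        by apply: eG; lra.
      by apply: complex_ext; rewrite !ReImE /=; ring.
    rewrite modH ler_pdivrMl//; apply: (le_trans (modcB _ _)).
    have := GL (x0 + eps * x) (eps * s + eps * y) x0 0.
    rewrite addrAC subrr add0r subr0 [`|eps * s + _|]ger0_norm; last lra.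
    rewrite !modcM modc_real (gtr0_norm eps0).
    have xN : `|eps * x| <= eps * B by rewrite ler_norml; lra.
    have mxy : modc (x +i* y) <= 2 * B.
      apply: (le_trans (modc_le _)) => /=; rewrite (ger0_norm y0).
      have : `|x| <= B by rewrite ler_norml xB.
      lra.
    have := ler_wpM2l (mulr_ge0 mg (ltW eps0)) mxy.
    have : L * (`|eps * x| + (eps * s + eps * y)) <= L * (eps * (2 * B + 1)).
      by rewrite ler_wpM2l ?(ltW L0)//; lra.
    rewrite /C; lra.
  - move=> x x02; rewrite -[x%:C]/(x +i* 0) modH mulr0 addr0 ler_pdivrMl//.
    rewrite (_ : _ - _ = (G (x0 + eps * x) (eps * s) - G (x0 + eps * x) 0) +
      (G (x0 + eps * x) 0 - G x0 0 - g * (eps * x)%:C)); last first.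
      have -> : (eps * x)%:C = eps%:C * (x +i* 0) by rewrite rmorphM.
      by ring.
    apply: (le_trans (modcD _ _)).
    have := GL (x0 + eps * x) (eps * s) (x0 + eps * x) 0.
    rewrite subrr normr0 add0r subr0 (gtr0_norm (mulr_gt0 eps0 s0)) => h1.
    have h2 : modc (G (x0 + eps * x) 0 - G x0 0 - g * (eps * x)%:C) <= d / 2 * eps.
      have [->|xn0] := eqVneq x 0.
        rewrite mulr0 addr0 subrr sub0r mulr0 oppr0 modc0.
        by rewrite mulr_ge0 ?divr_ge0// ltW.
      have x0' : 0 < x by rewrite lt_neqAle eq_sym xn0; lra.
      have ex : eps * x <= d'.
        have : eps * x <= eps * 2 by rewrite ler_wpM2l ?(ltW eps0)//; lra.
        lra.
      apply: (le_trans (Hd' _ (mulr_gt0 eps0 x0') ex)).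
      rewrite (_ : d / 2 * eps = d / 4 * (eps * 2)); last by field.
      by rewrite ler_wpM2l ?(ltW d40)// ler_wpM2l ?(ltW eps0)//; lra.
    have := ler_wpM2l (ltW eps0) sd; lra.
move: Hzeta; rewrite modH ler_pdivrMl// => h1.
have h2 := GL (x0 - eps) 0 (x0 + eps * (-1)) (eps * s + eps * eta).
have -> : G (x0 - eps) 0 - G x0 0 + g * eps%:C =
  (G (x0 - eps) 0 - G (x0 + eps * (-1)) (eps * s + eps * eta)) +
  (G (x0 + eps * (-1)) (eps * s + eps * eta) - G x0 0 - g * eps%:C * ((-1) +i* eta)) +
  g * (eps * eta)%:C * 'i.
  have -> : (-1) +i* eta = - 1 + eta%:C * 'i.
    by apply: complex_ext; rewrite !ReImE /=; ring.
  by rewrite rmorphM /=; ring.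
apply: (le_trans (modcD _ _)).
have := modcD (G (x0 - eps) 0 - G (x0 + eps * (-1)) (eps * s + eps * eta))
  (G (x0 + eps * (-1)) (eps * s + eps * eta) - G x0 0 - g * eps%:C * ((-1) +i* eta)).
rewrite !modcM modc_i mulr1 modc_real (ger0_norm (mulr_ge0 (ltW eps0) (ltW eta0))).
move: h2; rewrite (_ : x0 - eps - (x0 + eps * (-1)) = 0); last by ring.
rewrite normr0 add0r sub0r normrN ger0_norm; last first.
  by rewrite addr_ge0// mulr_ge0// ltW.
have := ler_wpM2l (ltW eps0) se; have := ler_wpM2l (ltW eps0) etaN; rewrite /N.
have := mulr_gt0 eps0 eta0; lra.
Qed.

End LeftDerivative.

(** * The distributional derivative of a Lipschitz function *)

Section DerivativeFunctional.
Context {R : realType}.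
Implicit Types (g phi : R -> R[i]).

Lemma CcvgP (T : Type) (X : set_system T) (FX : Filter X) (h : T -> R[i]) (l : R[i]) :
  h @ X --> (l : R[i]^o) <->
  forall e : R, 0 < e -> \forall x \near X, modc (h x - l) <= e.
Proof.
split=> [/(@cvgrPdist_le _ R[i]^o) H e e0|H].
  have e0C : 0 < e%:C by rewrite ltcR.
  apply: filterS (H _ e0C) => x.
  by rewrite le_normC modc_distC.
apply/(@cvgrPdist_le _ R[i]^o) => e e0.
have eE : e = (complex.Re e)%:C.
  by move: e0; rewrite ltcE => /andP[/eqP]; case: e => ? ? /= ->.
have e0R : 0 < complex.Re e by rewrite -ltcR -eE.
apply: filterS (H _ e0R) => x.
by rewrite eE le_normC modc_distC.
Qed.

Lemma carried_modc_bounded c d phi : carried c d phi ->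
  exists2 B : R, 0 < B & forall x, modc (phi x) <= B.
Proof.
move=> [cc c0].
have [B1 B10 HB1] : exists2 B : R, 0 < B & forall x, `|complex.Re (phi x)| <= B.
  apply: (@carried_bounded R _ c d); first by move=> x; have [] := cc x.
  by move=> x /c0 ->.
have [B2 B20 HB2] : exists2 B : R, 0 < B & forall x, `|complex.Im (phi x)| <= B.
  apply: (@carried_bounded R _ c d); first by move=> x; have [] := cc x.
  by move=> x /c0 ->.
exists (B1 + B2); first by rewrite addr_gt0.
by move=> x; apply: (le_trans (modc_le _)); apply: lerD.
Qed.

Definition derivative_functional (a b : R) g phi : R[i] :=
  - Cintegral `]a, b[ (fun x => g x * Cderive phi x).

Lemma test_function_carried (a b : R) phi : a < b -> test_function `]a, b[ phi ->
  exists c d : R, [/\ a < c, c <= d, d < b, `[c, d] `<=` `]a, b[ &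
    carried c d (Cderive phi)].
Proof.
move=> ab tphi; have [c [d [ac cd db phi0]]] := test_function_oo ab tphi.
have [sphi _ _] := tphi; exists c, d; split=> //; last exact: derive_carried.
exact: segment_sub_oo.
Qed.

Lemma derivative_functional_distribution (a b L : R) g : 0 < L -> a < b ->
  Clipschitz L g -> is_distribution `]a, b[ (derivative_functional a b g).
Proof.
move=> L0 ab gL; have cg := Clipschitz_continuous gL.
have mab : measurable (`]a, b[ : set R) by exact: measurable_itv.
split.
  move=> z phi psi tphi tpsi.
  have [c [d [ac cd db sub cphi]]] := test_function_carried ab tphi.
  have [c' [d' [ac' cd' db' sub' cpsi]]] := test_function_carried ab tpsi.
  pose c2 := Num.min c c'; pose d2 := Num.max d d'.
  have sub2 : `[c2, d2] `<=` `]a, b[.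
    move=> x /=; rewrite !in_itv/= => /andP[h1 h2].
    by rewrite (lt_le_trans _ h1) ?lt_min ?ac//= (le_lt_trans h2)// gt_max db.
  have cphi2 : carried c2 d2 (Cderive phi).
    by apply: carriedW cphi; rewrite ?ge_min ?le_max lexx.
  have cpsi2 : carried c2 d2 (Cderive psi).
    by apply: carriedW cpsi; rewrite ?ge_min ?le_max lexx ?orbT.
  have [sphi _ _] := tphi; have [spsi _ _] := tpsi.
  have dE : Cderive (fun x => z * phi x + psi x) =
      fun x => z * Cderive phi x + Cderive psi x.
    apply/funext => x; apply: Cis_derive_val.
    apply: Cis_deriveD; last exact: smooth_is_derive.
    rewrite -[X in Cis_derive _ _ X]add0r -[X in X + _](mul0r (phi x)).
    by apply: (Cis_deriveM (Cis_derive_cst _ _)); exact: smooth_is_derive.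
  rewrite /derivative_functional dE.
  rewrite (_ : (fun x => _) =
    (fun x => z * (g x * Cderive phi x) + g x * Cderive psi x)); last first.
    by apply/funext => x; ring.
  have gphi := carriedM cg cphi2; have gpsi := carriedM cg cpsi2.
  rewrite (CintegralD mab sub2 (carriedZ z gphi) gpsi) (CintegralZ _ mab sub2 gphi).
  by rewrite opprD mulrN.
move=> K _ _; pose Bg := modc (g a) + 2 * (L * (b - a)).
exists 1%N, (2 * (Bg * (b - a))) => phi tphi _ B HB; rewrite le_normC modcN.
have [c [d [ac cd db sub cphi]]] := test_function_carried ab tphi.
have Bg0 : 0 <= Bg by rewrite addr_ge0 ?modc_ge0// !mulr_ge0//; lra.
have gB x : c <= x <= d -> modc (g x) <= Bg.
  move=> xcd; have -> : g x = g a + (g x - g a) by ring.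
  apply: (le_trans (modcD _ _)); rewrite lerD2l.
  apply: (le_trans (Clipschitz_modc _ _ gL)).
  by rewrite ler_wpM2l// ler_wpM2l ?(ltW L0)// ger0_norm; lra.
have HB1 x : modc (Cderive phi x) <= B by rewrite -le_normC; exact: (HB 1%N x).
have B0 : 0 <= B by apply: le_trans (HB1 a); exact: modc_ge0.
apply: (le_trans (Cintegral_le cd sub (carriedM cg cphi) (M := Bg * B) _)).
  by move=> x xcd; rewrite modcM ler_pM ?modc_ge0//; exact: gB.
rewrite -!mulrA ler_wpM2l// ler_wpM2l// [leRHS]mulrC ler_wpM2l//; lra.
Qed.

(** Boundary values exist because the integral of [F] against a test function
    is, up to sign, that of the primitive against the derivative of the test
    function, and the primitive is continuous up to the boundary. *)
Lemma boundary_value_primitive (F : R[i] -> R[i]) (G : R -> R -> R[i])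
    (a b r L : R) : 0 < L -> a < b -> 0 < r ->
  (forall x y x' y',
     `|complex.Re (G x y) - complex.Re (G x' y')| <= L * (`|x - x'| + `|y - y'|)) ->
  (forall x y x' y',
     `|complex.Im (G x y) - complex.Im (G x' y')| <= L * (`|x - x'| + `|y - y'|)) ->
  (forall x y, a < x < b -> 0 < y < r -> Ccontinuous_at (fun s => F (s +i* y)) x) ->
  (forall x y, a < x < b -> 0 < y < r -> Cis_derive (fun s => G s y) x (F (x +i* y))) ->
  boundary_value a b F (derivative_functional a b (fun x => G x 0)).
Proof.
move=> L0 ab r0 G1 G2 cF dG phi tphi.
have [c [d [ac cd db sub cphi]]] := test_function_carried ab tphi.
have mab : measurable (`]a, b[ : set R) by exact: measurable_itv.
have GL y : Clipschitz L (fun x => G x y).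
  split=> x x'; first by have := G1 x y x' y; rewrite subrr normr0 addr0.
  by have := G2 x y x' y; rewrite subrr normr0 addr0.
have GC y := Clipschitz_continuous (GL y).
have mphi x : 0 <= modc (Cderive phi x) by exact: modc_ge0.
have [B B0 HB] : exists2 B : R, 0 < B & forall x, modc (Cderive phi x) <= B.
  exact: carried_modc_bounded cphi.
apply/CcvgP => e e0.
pose Q := 4 * L * B * (b - a).
have Q0 : 0 < Q by rewrite !mulr_gt0// subr_gt0.
have : \forall y \near 0^'+, 0 < y /\ y < Num.min r (e / Q).
  near=> y; split => //; near: y; apply: nbhs_right_lt.
  by rewrite lt_min r0 divr_gt0.
apply: filterS => y [y0]; rewrite lt_min ltr_pdivlMr// => /andP[yr ye].
have y0r : 0 < y < r by rewrite y0.
have -> : Cintegral `]a, b[ (fun x => F (x +i* y) * phi x) =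
    derivative_functional a b (fun x => G x y) phi.
  apply: (Cby_parts L0 ab (GL y)) => //.
  - by apply: continuous_oo_measurable => x xab; have [] := cF x y xab y0r.
  - by apply: continuous_oo_measurable => x xab; have [] := cF x y xab y0r.
  - by apply: nearW => x xab; exact: dG.
have g1 := carriedM (GC y) cphi; have g2 := carriedM (GC 0) cphi.
have -> : derivative_functional a b (fun x => G x y) phi -
    derivative_functional a b (fun x => G x 0) phi =
  - Cintegral `]a, b[ (fun x => G x y * Cderive phi x +
      (- 1) * (G x 0 * Cderive phi x)).
  rewrite (CintegralD mab sub g1 (carriedZ _ g2)) (CintegralZ _ mab sub g2).
  by rewrite mulN1r opprD.
rewrite modcN.
apply: (le_trans (Cintegral_le cd sub (carriedD g1 (carriedZ _ g2)) (M := 2 * (L * y) * B) _)).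
  move=> x _; rewrite mulN1r -mulrBl modcM; apply: ler_pM; rewrite ?modc_ge0//.
  apply: modc_le2; rewrite !ReImE.
    by have := G1 x y x 0; rewrite subrr normr0 add0r subr0 (gtr0_norm y0).
  by have := G2 x y x 0; rewrite subrr normr0 add0r subr0 (gtr0_norm y0).
apply: le_trans (ltW ye); rewrite /Q.
rewrite (_ : y * _ = 2 * (2 * (L * y) * B * (b - a))); last by ring.
by rewrite ler_wpM2l// ler_wpM2l ?mulr_ge0 ?ltW//; lra.
Unshelve. all: by end_near. Qed.

Lemma boundary_value_unique (a b : R) (F : R[i] -> R[i]) (f1 f2 : (R -> R[i]) -> R[i]) :
  boundary_value a b F f1 -> boundary_value a b F f2 ->
  eq_distribution `]a, b[ f1 f2.
Proof.
move=> h1 h2 phi tphi; apply/eqP; rewrite -subr_eq0; apply/eqP; apply: modc_eq0.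
apply/eqP; rewrite eq_le modc_ge0 andbT; apply/ler_addgt0Pr => e e0; rewrite add0r.
have e20 : 0 < e / 2 by rewrite divr_gt0.
have /CcvgP/(_ _ e20) H1 := h1 phi tphi.
have /CcvgP/(_ _ e20) H2 := h2 phi tphi.
near (0:R)^'+ => y.
have p1 : modc (Cintegral `]a, b[ (fun x => F (x +i* y) * phi x) - f1 phi) <= e / 2.
  by near: y.
have p2 : modc (Cintegral `]a, b[ (fun x => F (x +i* y) * phi x) - f2 phi) <= e / 2.
  by near: y.
apply: le_trans (modc_trans (Cintegral `]a, b[ (fun x => F (x +i* y) * phi x)) _ _) _.
by rewrite modc_distC; lra.
Unshelve. all: by end_near. Qed.

End DerivativeFunctional.

(** * Point values of the derivative of a Lipschitz function *)

Section PointValues.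
Context {R : realType}.
Implicit Types (g phi : R -> R[i]) (f : (R -> R[i]) -> R[i]).

(** The lateral limit is tested on a smooth approximation of the
    characteristic function of [eta, 1]; up to an error proportional to [eta],
    uniformly in the dilation, the pairing is the difference quotient of [g]. *)
Lemma right_lateral_derivative f g (a b L x0 : R) (gamma : R[i]) :
  0 < L -> a < x0 -> x0 < b -> Clipschitz L g ->
  eq_distribution `]a, b[ f (derivative_functional a b g) ->
  right_lateral_limit f x0 gamma ->
  forall e, 0 < e -> exists2 d : R, 0 < d & forall h, 0 < h -> h <= d ->
    modc (g (x0 + h) - g x0 - gamma * h%:C) <= e * h.
Proof.
move=> L0 ax0 x0b gL fE lat e e0.
have [psi [C [C0 HC]]] := @exists_bumps R.
have mg := modc_ge0 gamma.
(* Divided by [h], the error is at most the [e / 2] of the lateral limit plus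
   [N eta], whose three terms come from replacing the test function by the
   characteristic function, from the gap between [x0] and [x0 + h eta], and from
   the integral of the test function not being 1. *)
pose N := 2 * (C * L) + 2 * L + modc gamma * (C + 1).
have CL0 : 0 < C * L by rewrite mulr_gt0.
have gC0 : 0 <= modc gamma * (C + 1) by rewrite mulr_ge0//; lra.
have N0 : 0 < N by rewrite /N; lra.
pose eta := Num.min (1 / 2) (e / (2 * N)).
have eta0 : 0 < eta by rewrite lt_min !divr_gt0// mulr_gt0.
have eta2 : eta <= 1 / 2 by rewrite ge_min lexx.
have etaN : N * eta <= e / 2.
  rewrite (_ : e / 2 = N * (e / (2 * N))); last by field; rewrite gt_eqF.
  by rewrite ler_wpM2l ?(ltW N0)// ge_min lexx orbT.
move: (eta) eta0 eta2 etaN => {}eta eta0 eta2 etaN.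
have eta1 : eta <= 1 by lra.
have [npsi psi0 psiD psiw] := HC eta eta 1 eta0 eta1.
pose phi t : R[i] := (psi eta eta 1 t)%:C.
have sphi : smooth phi by exact: smooth_real.
have phi0 t : ~~ (eta <= t <= 1 + eta) -> phi t = 0.
  by move=> /psi0 h; rewrite /phi h.
have tphi : test_function `]0, +oo[ phi.
  apply: (carried_test_function sphi phi0) => t /=.
  by rewrite !in_itv/= andbT => /andP[h _]; lra.
have cpsi : continuous (psi eta eta 1).
  by move=> x; have [/(_ x)/derivable1_diffP/differentiable_continuous] := npsi 1%N.
have cpsi' : continuous (derive1 (psi eta eta 1)).
  by move=> x; have [_ [/(_ x)/derivable1_diffP/differentiable_continuous]] := npsi 2%N.
pose I := \int[mu]_(t in setT) psi eta eta 1 t.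
have phiI : Cintegral setT phi = I%:C.
  apply: complex_ext => //=; rewrite /Rintegral integral0_eq//.
have I1 : `|I - (1 - eta)| <= C * eta.
  have sub : `[eta, 1 + eta] `<=` `](-1), 3[.
    by apply: segment_sub_oo; lra.
  have IE : I = \int[mu]_(t in `](-1), 3[) (1 * psi eta eta 1 t).
    rewrite /I (carried_Rintegral (@subsetT _ `[eta, 1 + eta]) psi0).
    rewrite -(carried_Rintegral sub psi0).
    by congr Rintegral; apply/funext => t; rewrite mul1r.
  have psi'0 t : ~~ (eta <= t <= 1 + eta) -> derive1 (psi eta eta 1) t = 0.
    move=> /(derive_carried sphi phi0).2 h.
    by have := congr1 (@complex.Re R) h.
  have idL (x y : R) : `|id x - id y| <= 1 * `|x - y| by rewrite mul1r.
  have did : {ae mu, forall x : R, -1 < x < 3 -> is_derive x 1 id ((fun=> 1) x)}.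
    by apply: nearW => x _; exact: is_derive_id.
  have m1 : measurable_fun `](-1 : R), (3 : R)[ (fun _ : R => 1 : R) by exact: measurable_cst.
  have h1 : -1 < eta by lra.
  have h2 : eta <= 1 + eta by lra.
  have h3 : 1 + eta < 3 by lra.
  have [_ E] := lipschitz_by_parts ltr01 h1 h2 h3 idL m1 did
    (nderivable_is_derive (npsi 1%N)) cpsi' psi0 psi'0.
  rewrite IE E; have := psiw id 1 (-1) 3 ler01.
  rewrite mul1r; apply; [by move=> x y; rewrite mul1r|lra|lra].
have gI : modc (gamma * I%:C - gamma) <= modc gamma * (C + 1) * eta.
  rewrite (_ : _ - gamma = gamma * (I - 1)%:C); last by rewrite rmorphB /=; ring.
  rewrite modcM modc_real -mulrA ler_wpM2l//.
  by move: I1; rewrite !ler_norml; lra.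
have e20 : 0 < e / 2 by rewrite divr_gt0.
have /CcvgP/(_ _ e20) := lat phi tphi.
rewrite near_withinE => /nbhs_normP[d /= d0 Hd].
exists (Num.min (d / 2) ((b - x0) / 2)); first by rewrite lt_min !divr_gt0// subr_gt0.
move=> h h0; rewrite le_min => /andP[hd hb].
have hdist : `|0 - h| < d by rewrite sub0r normrN gtr0_norm//; lra.
have := Hd h hdist h0; rewrite phiI -/(dilate x0 h phi) => HDP.
have sdil : smooth (dilate x0 h phi) by exact: smooth_dilate.
have he : h * eta <= h / 2 by have := ler_wpM2l (ltW h0) eta2; lra.
have heta : 0 < h * eta by rewrite mulr_gt0.
have pb : x0 + h * 1 + h * eta < b by clear -hb he x0b h0; lra.
have pa : a < x0 + h * eta by clear -ax0 heta; lra.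
have tdil : test_function `]a, b[ (dilate x0 h phi).
  have dil0 := dilate_out (x0 := x0) h0 phi0.
  by apply: (carried_test_function sdil dil0); apply: segment_sub_oo;
    rewrite // mulrDr addrA.
pose p := psi (h * eta) (x0 + h * eta) (x0 + h * 1).
have dilE : dilate x0 h phi = fun t => (h^-1 * p t)%:C.
  by apply/funext => t; rewrite /dilate /phi psiD// rmorphM.
have he1 : x0 + h * eta <= x0 + h * 1 by clear -he h0; lra.
have [np _ _ pw] := HC (h * eta) _ _ heta he1.
have CdilE t : Cderive (dilate x0 h phi) t = (h^-1)%:C * (derive1 p t)%:C.
  rewrite dilE -rmorphM; apply: Cis_derive_val; split; last exact: is_derive_cst.
  have dp : is_derive t 1 p (derive1 p t) := nderivable_is_derive (np 1%N) t.
  rewrite /= (_ : (fun t => _) = (cst h^-1 : R -> R) * p)//.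
  by apply: is_derive_eq; rewrite /GRing.scale/= mulr0 addr0.
have fdil : f (dilate x0 h phi) = (h^-1)%:C *
    ((- \int[mu]_(t in `]a, b[) (complex.Re (g t) * derive1 p t)) +i*
     (- \int[mu]_(t in `]a, b[) (complex.Im (g t) * derive1 p t))).
  rewrite (fE _ tdil) /derivative_functional.
  have [c [d' [_ _ _ sub cdil]]] := test_function_carried (lt_trans ax0 x0b) tdil.
  have mab : measurable (`]a, b[ : set R) by exact: measurable_itv.
  have cp : carried c d' (fun t => (derive1 p t)%:C : R[i]).
    rewrite (_ : (fun t => _) = fun t => h%:C * Cderive (dilate x0 h phi) t).
      exact: carriedZ.
    by apply/funext => t; rewrite CdilE mulrA -rmorphM mulfV ?gt_eqF// mul1r.
  rewrite (_ : (fun t => _) = (fun t => (h^-1)%:C * (g t * (derive1 p t)%:C))); last first.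
    by apply/funext => t; rewrite CdilE; ring.
  rewrite (CintegralZ _ mab sub (carriedM (Clipschitz_continuous gL) cp)) -mulrN.
  congr (_ * _); apply: complex_ext; rewrite ?ReN ?ImN /=; congr (- _); congr Rintegral.
    by apply/funext => t; rewrite !ReImE /= mulr0 subr0.
  by apply/funext => t; rewrite !ReImE /= mulr0 add0r.
have [g1L g2L] := gL.
have w1 := pw _ _ _ _ (ltW L0) g1L pa pb.
have w2 := pw _ _ _ _ (ltW L0) g2L pa pb.
have w12 : modc (h%:C * f (dilate x0 h phi) - (g (x0 + h * 1) - g (x0 + h * eta))) <=
    2 * (C * (L * (h * eta))).
  rewrite fdil mulrA -rmorphM mulfV ?gt_eqF// mul1r.
  by apply: modc_le2; rewrite !ReImE.
have w3 : modc (g (x0 + h * eta) - g x0) <= 2 * (L * (h * eta)).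
  by have := Clipschitz_modc (x0 + h * eta) x0 gL; rewrite addrAC subrr add0r gtr0_norm.
have w4 : modc (h%:C * (f (dilate x0 h phi) - gamma * I%:C)) <= h * (e / 2).
  by rewrite modcM modc_real gtr0_norm// ler_wpM2l// ltW.
have w5 : modc (h%:C * (gamma * I%:C - gamma)) <= h * (modc gamma * (C + 1) * eta).
  by rewrite modcM modc_real gtr0_norm// ler_wpM2l// ltW.
have -> : g (x0 + h) - g x0 - gamma * h%:C =
  - (h%:C * f (dilate x0 h phi) - (g (x0 + h * 1) - g (x0 + h * eta))) +
  (g (x0 + h * eta) - g x0) + h%:C * (f (dilate x0 h phi) - gamma * I%:C) +
  h%:C * (gamma * I%:C - gamma) by rewrite mulr1; ring.
apply: (le_trans (modcD _ _)).
set X1 := (X in modc (X + _ + _)); set X2 := (X in modc (_ + X + _)).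
set X3 := (X in modc (_ + X)).
have := modcD (X1 + X2) X3; have := modcD X1 X2; rewrite {1}/X1 modcN.
have := ler_wpM2l (ltW h0) etaN; rewrite /N; move: w12 w3 w4 w5.
rewrite -/X2 -/X3; clear; lra.
Qed.

Definition has_derivative g (x0 : R) (gamma : R[i]) := forall e, 0 < e ->
  exists2 d : R, 0 < d & forall h, `|h| <= d ->
    modc (g (x0 + h) - g x0 - gamma * h%:C) <= e * `|h|.

(** The change of variables is carried out on an antiderivative. *)
Lemma Cintegral_dilate phi (B x0 e : R) (U : set R) : 0 < B -> 0 < e ->
  carried (- B) B phi -> carried (x0 + e * - B) (x0 + e * B) (dilate x0 e phi) ->
  `[x0 + e * - B, x0 + e * B] `<=` U ->
  Cintegral U (dilate x0 e phi) = Cintegral setT phi.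
Proof.
move=> B0 e0 cphi cdil sub.
rewrite (Cintegral_carried sub cdil) (Cintegral_carried (@subsetT _ _) cphi).
have [K K0 HK] := carried_modc_bounded cphi.
have [P dP] : exists P : R -> R[i], forall x, - B - 1 < x < B + 1 -> Cis_derive P x (phi x).
  by apply: (@Cantiderivative R phi _ _ K) => x _; [exact: cphi.1|exact: HK].
have BB : - B <= B by lra.
have eBB : x0 + e * - B <= x0 + e * B by rewrite lerD2l ler_wpM2l// ltW.
rewrite (Cintegral_derive BB cphi.1 (W := P)); last by move=> x xB; apply: dP; lra.
rewrite (Cintegral_derive eBB cdil.1 (W := fun t => P ((t - x0) / e))).
  by congr (P _ - P _); field; rewrite gt_eqF.
move=> x /andP[h1 h2]; apply: Cis_derive_affine; apply: dP.
rewrite ltr_pdivlMr// ltr_pdivrMr//; have := mulr_gt0 e0 B0; lra.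
Qed.

(** The affine part of [g] contributes exactly [gamma] times the integral of
    the test function; the remainder is small compared with the dilation
    parameter, which makes up for the two powers lost in the derivative of the
    dilated test function. *)
Lemma derivative_point_value f g (a b L x0 : R) (gamma : R[i]) :
  0 < L -> a < x0 -> x0 < b -> Clipschitz L g ->
  eq_distribution `]a, b[ f (derivative_functional a b g) ->
  has_derivative g x0 gamma -> point_value f x0 gamma.
Proof.
move=> L0 ax0 x0b gL fE dg phi tphi.
have ab : a < b by exact: lt_trans x0b.
have [B B0 phi0] := test_function_T tphi; have [sphi _ _] := tphi.
have cphi' := derive_carried sphi phi0.
have [B' B'0 HB'] := carried_modc_bounded cphi'.
have mab : measurable (`]a, b[ : set R) by exact: measurable_itv.
have mg := modc_ge0 gamma.
pose L' := modc gamma + 1; have L'0 : 0 < L' by rewrite /L'; lra.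
pose w (t : R) : R[i] := (g x0 - gamma * x0%:C) + t%:C * gamma.
have wL : Clipschitz L' w.
  have wE x y : w x - w y = (x - y)%:C * gamma by rewrite /w rmorphB /=; ring.
  have main x y : modc (w x - w y) <= L' * `|x - y|.
    by rewrite wE modcM modc_real mulrC ler_wpM2r// /L'; lra.
  split=> x y; rewrite -?ReN -?ReD -?ImN -?ImD; apply: le_trans (main x y);
    [exact: modc_Re|exact: modc_Im].
have cw := Clipschitz_continuous wL; have cg := Clipschitz_continuous gL.
apply/CcvgP => e e0.
pose Q := 4 * B ^+ 2 * B'; have Q0 : 0 < Q by rewrite !mulr_gt0// exprn_gt0.
have eQ : 0 < e / Q by rewrite divr_gt0.
have [d d0 Hd] := dg _ eQ.
pose m := Num.min d (Num.min (x0 - a) (b - x0)).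
have m0 : 0 < m by rewrite !lt_min d0 !subr_gt0 ax0.
have [md ma mb] : [/\ m <= d, m <= x0 - a & m <= b - x0].
  by rewrite !ge_min !lexx !orbT.
move: (m) m0 md ma mb => {}m m0 md ma mb.
have : \forall h \near 0^'+, 0 < h /\ h < m / B.
  near=> h; split => //; near: h; apply: nbhs_right_lt; exact: divr_gt0.
apply: filterS => h [h0]; rewrite ltr_pdivlMr// => hm.
have dil0 := dilate_out (x0 := x0) h0 phi0.
have sdil : smooth (dilate x0 h phi) by exact: smooth_dilate.
have sub : `[x0 + h * - B, x0 + h * B] `<=` `]a, b[.
  by apply: segment_sub_oo; lra.
have tdil : test_function `]a, b[ (dilate x0 h phi).
  exact: (carried_test_function sdil dil0 sub).
have cdil := smooth_carried sdil dil0; have cdil' := derive_carried sdil dil0.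
have hB : x0 + h * - B <= x0 + h * B by have := mulr_gt0 h0 B0; lra.
rewrite -/(dilate x0 h phi) /dilated_pairing -/(dilate x0 h phi) (fE _ tdil).
have affine : gamma * Cintegral setT phi =
    - Cintegral `]a, b[ (fun t => w t * Cderive (dilate x0 h phi) t).
  rewrite -(Cintegral_dilate B0 h0 (smooth_carried sphi phi0) cdil sub).
  rewrite -(CintegralZ gamma mab sub cdil).
  apply: (Cby_parts L'0 ab wL) => //; try exact: measurable_cst.
  by apply: nearW => x _; exact: Cis_derive_line.
have g1 := carriedM cg cdil'; have g2 := carriedM cw cdil'.
rewrite affine /derivative_functional opprK addrC -modcN opprD opprK.
rewrite addrC -mulN1r -(CintegralZ (-1) mab sub g2).
rewrite -(CintegralD mab sub g1 (carriedZ _ g2)).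
apply: (le_trans (Cintegral_le hB sub (carriedD g1 (carriedZ _ g2))
  (M := e / Q * (h * B) * (h^-1 * (h^-1 * B'))) _)).
  move=> t ht; rewrite mulN1r -mulrBl modcM Cderive_dilate// !modcM modc_real.
  rewrite (gtr0_norm (_ : 0 < h^-1)) ?invr_gt0//.
  have tx : `|t - x0| <= h * B by rewrite ler_norml; lra.
  apply: ler_pM; rewrite ?modc_ge0 ?mulr_ge0 ?modc_ge0 ?invr_ge0 ?(ltW h0)//.
    have -> : g t - w t = g (x0 + (t - x0)) - g x0 - gamma * (t - x0)%:C.
      rewrite (_ : x0 + (t - x0) = t); last by ring.
      by rewrite /w rmorphB /=; ring.
    apply: (le_trans (Hd _ _)); first by lra.
    by rewrite ler_wpM2l// ltW.
  by rewrite !ler_wpM2l ?invr_ge0 ?(ltW h0)//; exact: HB'.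
rewrite le_eqVlt; apply/orP; left; apply/eqP; rewrite /Q.
by field; rewrite !gt_eqF.
Unshelve. all: by end_near. Qed.

(** With [f_1] the difference quotient of [g] at [x0], the product
    [(x - x0) f_1] is [g - g x0], which has the same derivative as [g]. *)
Lemma derivative_order_one f g (a b L x0 : R) (gamma : R[i]) :
  0 < L -> a < x0 -> x0 < b -> Clipschitz L g ->
  eq_distribution `]a, b[ f (derivative_functional a b g) ->
  has_derivative g x0 gamma -> point_value_of_order 1 `]a, b[ f x0 gamma.
Proof.
move=> L0 ax0 x0b gL fE dg.
have ab : a < b by exact: lt_trans x0b.
have mab : measurable (`]a, b[ : set R) by exact: measurable_itv.
pose d := Num.min (x0 - a) (b - x0).
have d0 : 0 < d by rewrite lt_min !subr_gt0 ax0.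
have [da db] : d <= x0 - a /\ d <= b - x0 by rewrite !ge_min !lexx orbT.
pose fn x := if x == x0 then gamma else ((x - x0)^-1)%:C * (g x - g x0).
have fnE x : fn x * (x - x0)%:C = g x - g x0.
  rewrite /fn; case: eqVneq => [->|xx0]; first by rewrite !subrr mulr0.
  by rewrite mulrAC -rmorphM mulVf ?subr_eq0// mul1r.
have cg := Clipschitz_continuous gL.
have subV : `]x0 - d, x0 + d[ `<=` `]a, b[.
  by move=> x /=; rewrite !in_itv/= => /andP[? ?]; lra.
exists d, fn; split => //.
- move=> x _; apply/CcvgP => e e0.
  have [->|xx0] := eqVneq x x0.
    have [r r0 Hr] := dg _ e0; apply/nbhs_normP; exists r => // t /= xt.
    have -> : fn x0 = gamma by rewrite /fn eqxx.
    rewrite /fn; case: eqVneq => [_|tx0]; first by rewrite subrr modc0 ltW.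
    have t0 : 0 < `|t - x0| by rewrite normr_gt0 subr_eq0.
    have -> : ((t - x0)^-1)%:C * (g t - g x0) - gamma = ((t - x0)^-1)%:C *
        (g (x0 + (t - x0)) - g x0 - gamma * (t - x0)%:C).
      rewrite (_ : x0 + (t - x0) = t); last by ring.
      rewrite [RHS]mulrBr; congr (_ - _); rewrite mulrCA -rmorphM mulVf ?mulr1//.
      by rewrite subr_eq0.
    rewrite modcM modc_real normfV ler_pdivrMl// [leRHS]mulrC.
    by apply: Hr; rewrite distrC ltW.
  have dx0 : 0 < `|x - x0| by rewrite normr_gt0 subr_eq0.
  pose h t : R[i] := ((t - x0)^-1)%:C * (g t - g x0).
  have [h1 h2] : Ccontinuous_at h x.
    apply: Ccontinuous_atM.
      split; last exact: cvg_cst.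
      apply: cvgV; first by rewrite subr_eq0.
      by apply: cvgB; [exact: cvg_id|exact: cvg_cst].
    by apply: Ccontinuous_atD; [exact: cg|exact: Ccontinuous_cst].
  have e20 : 0 < e / 2 by rewrite divr_gt0.
  have n1 : \forall t \near x, `|x - t| < `|x - x0|.
    by apply/nbhs_normP; exists `|x - x0|.
  move/(@cvgrPdist_le _ R^o) : h1 => /(_ _ e20) h1.
  move/(@cvgrPdist_le _ R^o) : h2 => /(_ _ e20) h2.
  apply: filterS3 n1 h1 h2 => t tx h1 h2.
  have tx0 : t != x0 by apply/eqP => tE; move: tx; rewrite tE ltxx.
  rewrite /fn (negbTE tx0) (negbTE xx0) -/(h t) -/(h x) modc_distC.
  have -> : e = 2 * (e / 2) by field.
  move: (h x) (h t) h1 h2 => u v h1 h2.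
  by apply: modc_le2; rewrite !ReImE.
- by rewrite /fn eqxx.
move=> phi tphi; have tab := test_function_sub subV tphi.
have dd : x0 - d < x0 + d by lra.
have [c [c' [h1 h2 h3 sub cphi']]] := test_function_carried dd tphi.
have [sphi _ _] := tphi.
have sub' : `[c, c'] `<=` `]a, b[ by exact: subset_trans sub subV.
have zero : Cintegral `]a, b[ (Cderive phi) = 0.
  have [c1 [c2 [k1 k2 k3 phi0]]] := test_function_oo dd tphi.
  have s12 : `[c1 - d / 2, c2 + d / 2] `<=` setT by exact: subsetT.
  have cc : c1 - 1 <= c2 + 1 by lra.
  have cphi := derive_carried sphi phi0.
  have sub12 : `[c1, c2] `<=` `]a, b[.
    by apply: segment_sub_oo; lra.
  rewrite (Cintegral_carried sub12 cphi).
  rewrite -(Cintegral_carried (c := c1) (d := c2) (A := `[c1 - 1, c2 + 1]%classic) _ cphi).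
    rewrite (Cintegral_derive cc cphi.1 (W := phi)).
      rewrite !phi0 ?subrr//; apply/negP; lra.
    by move=> x _; exact: smooth_is_derive.
  by move=> x /=; rewrite !in_itv/= => /andP[? ?]; lra.
rewrite (fE _ tab) /= /partial_at /distr_derive /distr_mul /regular_distribution.
rewrite /derivative_functional; congr (- _).
rewrite (_ : (fun x => fn x * _) = (fun x => g x * Cderive phi x +
    (- g x0) * Cderive phi x)); last first.
  by apply/funext => x; rewrite mulrA fnE mulrBl mulNr.
have mV : measurable (`]x0 - d, x0 + d[ : set R) by exact: measurable_itv.
have gphi := carriedM cg cphi'.
rewrite (CintegralD mV sub gphi (carriedZ _ cphi')) (CintegralZ _ mV sub cphi').
rewrite (Cintegral_carried sub cphi') -(Cintegral_carried sub' cphi') zero mulr0 addr0.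
by rewrite (Cintegral_carried sub gphi) -(Cintegral_carried sub' gphi).
Qed.

End PointValues.

(** * Uniqueness of the density *)

Section DensityIncrement.
Context {R : realType}.

(** [k] is almost everywhere equal to a bounded function [t], with a Lipschitz
    primitive [W]. Both [u] and [W] have the same integrals against derivatives
    of test functions, hence, by [exists_bumps], the same increments. *)
Lemma density_increment (k u : R -> R) (M L a b : R) : 0 < M -> 0 < L -> a < b ->
  measurable_fun `]a, b[ k ->
  {ae mu, forall x : R, a < x < b -> `|k x| <= M} ->
  (forall x y, `|u x - u y| <= L * `|x - y|) ->
  (forall (psi : R -> R) c d, (forall n, nderivable n psi) -> a < c -> d < b ->
    (forall x, ~~ (c <= x <= d) -> psi x = 0) ->
    \int[mu]_(x in `]a, b[) (k x * psi x) =
    - \int[mu]_(x in `]a, b[) (u x * derive1 psi x)) ->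
  forall c d, a < c -> c <= d -> d < b -> \int[mu]_(x in `[c, d]) k x = u d - u c.
Proof.
move=> M0 L0 ab mk kM uL H c d ac cd db.
pose t := (fun x => Num.max (- M) (Num.min M (k x))) \_ `]a, b[.
have mab : measurable (`]a, b[ : set R) by exact: measurable_itv.
have mt : measurable_fun setT t.
  apply/(measurable_restrictT _ mab).
  apply: measurable_maxr; first exact: measurable_cst.
  by apply: measurable_minr => //; exact: measurable_cst.
have tM x : `|t x| <= M.
  rewrite /t patchE; case: ifP => _; last by rewrite normr0 ltW.
  by rewrite ler_norml le_max lexx /= ge_max ge_min lexx /= andbT; lra.
have t0 x : ~~ (a < x < b) -> t x = 0.
  by move=> /negP xab; rewrite /t patchE memNset//= in_itv.
have tk : {ae mu, forall x : R, a < x < b -> t x = k x}.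
  apply: filterS kM; first exact: (ae_filter_ringOfSetsType mu).
  move=> x /= h xab; rewrite /t patchE mem_set/= ?in_itv//.
  have := h xab; rewrite ler_norml => /andP[h1 h2].
  by rewrite (min_idPr h2) (max_idPr h1).
have [W [WL WE dW]] := bounded_primitive mt tM t0.
have [psi [C [C0 HC]]] := @exists_bumps R.
have tint : \int[mu]_(x in `[c, d]) k x = \int[mu]_(x in `[c, d]) t x.
  have sub : `[c, d] `<=` `]a, b[.
    exact: segment_sub_oo.
  rewrite /Rintegral; congr fine; apply: ae_eq_integral => //.
  - by apply/measurable_EFinP; exact: measurable_funS mk.
  - by apply/measurable_EFinP; exact: measurable_funTS.
  - apply: filterS tk; first exact: (ae_filter_ringOfSetsType mu).
    by move=> x /= h xcd; rewrite h//; have := sub x xcd; rewrite /= in_itv.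
rewrite tint -WE//; apply/eqP; rewrite -subr_eq0 -normr_eq0.
rewrite eq_le normr_ge0 andbT; apply/ler_addgt0Pr => e e0; rewrite add0r.
pose N := C * M + C * L; have N0 : 0 < N by rewrite addr_gt0// mulr_gt0.
pose s := Num.min ((b - d) / 2) (e / N).
have s0 : 0 < s by rewrite lt_min !divr_gt0// subr_gt0.
have [sb sN] : s <= (b - d) / 2 /\ N * s <= e.
  split; first by rewrite ge_min lexx.
  have -> : e = N * (e / N) by field; rewrite gt_eqF.
  by rewrite ler_wpM2l ?(ltW N0)// ge_min lexx orbT.
move: (s) s0 sb sN => {}s s0 sb sN.
have [npsi psi0 _ psiw] := HC s c d s0 cd.
have ds : d + s < b by lra.
have HW : \int[mu]_(x in `]a, b[) (t x * psi s c d x) =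
    - \int[mu]_(x in `]a, b[) (W x * derive1 (psi s c d) x).
  have psi'0 x : ~~ (c <= x <= d + s) -> derive1 (psi s c d) x = 0.
    have sphi : smooth (fun x => (psi s c d x)%:C) by exact: smooth_real.
    have phi0 x' : ~~ (c <= x' <= d + s) -> (psi s c d x')%:C = 0 :> R[i].
      by move=> /psi0 ->.
    by move=> /(derive_carried sphi phi0).2 h; have := congr1 (@complex.Re R) h.
  have cpsi' : continuous (derive1 (psi s c d)).
    by move=> x; have [_ [/(_ x)/derivable1_diffP/differentiable_continuous]] := npsi 2%N.
  have cds : c <= d + s by lra.
  have mt' : measurable_fun `]a, b[ t by exact: measurable_funTS.
  have dW' : {ae mu, forall x : R, a < x < b -> is_derive x 1 W (t x)}.
    apply: filterS dW; first exact: (ae_filter_ringOfSetsType mu).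
    by move=> x /= h _.
  by have [_ ->] := lipschitz_by_parts M0 ac cds ds WL mt' dW'
    (nderivable_is_derive (npsi 1%N)) cpsi' psi0 psi'0.
have kt : \int[mu]_(x in `]a, b[) (k x * psi s c d x) =
    \int[mu]_(x in `]a, b[) (t x * psi s c d x).
  have mpsi : measurable_fun `]a, b[ (psi s c d).
    apply: continuous_oo_measurable => x _.
    by have [/(_ x)/derivable1_diffP/differentiable_continuous] := npsi 1%N.
  rewrite /Rintegral; congr fine; apply: ae_eq_integral => //.
  - by apply/measurable_EFinP; exact: measurable_funM.
  - by apply/measurable_EFinP; apply: measurable_funM => //; exact: measurable_funTS.
  - apply: filterS tk; first exact: (ae_filter_ringOfSetsType mu).
    by move=> x /= h; rewrite in_itv/= => /h ->.
have E : (- \int[mu]_(x in `]a, b[) (u x * derive1 (psi s c d) x)) =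
    (- \int[mu]_(x in `]a, b[) (W x * derive1 (psi s c d) x)).
  by rewrite -HW -kt (H (psi s c d) c (d + s)).
have := psiw u L a b (ltW L0) uL ac ds; rewrite E => h1.
have := psiw W M a b (ltW M0) WL ac ds => h2.
have := ler_distD (- \int[mu]_(x in `]a, b[) (W x * derive1 (psi s c d) x))
  (W d - W c) (u d - u c).
rewrite distrC in h2; move=> h3; apply: (le_trans h3).
apply: le_trans sN; apply: le_trans (lerD h2 h1) _; rewrite /N; clear; lra.
Qed.

(** Testing against real test functions separates the components. *)
Lemma Cdensity_increment (k g : R -> R[i]) (L a b : R) : 0 < L -> a < b ->
  Clipschitz L g -> Linfty `]a, b[ k ->
  eq_distribution `]a, b[ (regular_distribution `]a, b[ k) (derivative_functional a b g) ->
  forall c d, a < c -> c <= d -> d < b -> Cintegral `[c, d] k = g d - g c.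
Proof.
move=> L0 ab [g1 g2] [mk1 mk2 [M kM]] E.
have M0 : 0 < `|M| + 1 by rewrite ltr_wpDl.
have bound (h : R[i] -> R) : (forall z, `|h z| <= modc z) ->
    {ae mu, forall x : R, a < x < b -> `|h (k x)| <= `|M| + 1}.
  move=> hz; apply: filterS kM; first exact: (ae_filter_ringOfSetsType mu).
  move=> x /= H xab; have := H; rewrite in_itv/= xab => /(_ isT).
  by rewrite le_normC => kx; apply: (le_trans (hz _)); have := ler_norm M; lra.
have key (psi : R -> R) c d : (forall n, nderivable n psi) -> a < c -> d < b ->
    (forall x, ~~ (c <= x <= d) -> psi x = 0) ->
    \int[mu]_(x in `]a, b[) (complex.Re (k x) * psi x) =
      (- \int[mu]_(x in `]a, b[) (complex.Re (g x) * derive1 psi x)) /\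
    \int[mu]_(x in `]a, b[) (complex.Im (k x) * psi x) =
      (- \int[mu]_(x in `]a, b[) (complex.Im (g x) * derive1 psi x)).
  move=> npsi ac db psi0.
  pose phi x : R[i] := (psi x)%:C.
  have sphi : smooth phi by exact: smooth_real.
  have phi0 x : ~~ (c <= x <= d) -> phi x = 0 by move=> /psi0 h; rewrite /phi h.
  have tphi : test_function `]a, b[ phi.
    by apply: (carried_test_function sphi phi0); exact: segment_sub_oo.
  have dphi x : Cderive phi x = (derive1 psi x)%:C.
    apply: Cis_derive_val; split; last exact: is_derive_cst.
    exact: nderivable_is_derive (npsi 1%N) x.
  have := E phi tphi; rewrite /regular_distribution /derivative_functional => e.
  have := congr1 (@complex.Re R) e; have := congr1 (@complex.Im R) e.
  rewrite ReN ImN /= => e2 e1; split.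
  - transitivity (\int[mu]_(x in `]a, b[) complex.Re (k x * phi x)).
      by congr Rintegral; apply/funext => x; rewrite CReM /= mulr0 subr0.
    rewrite e1; congr (- _); congr Rintegral; apply/funext => x.
    by rewrite dphi CReM /= mulr0 subr0.
  - transitivity (\int[mu]_(x in `]a, b[) complex.Im (k x * phi x)).
      by congr Rintegral; apply/funext => x; rewrite CImM /= mulr0 add0r.
    rewrite e2; congr (- _); congr Rintegral; apply/funext => x.
    by rewrite dphi CImM /= mulr0 add0r.
move=> c d ac cd db; apply: complex_ext; rewrite ?ReD ?ImD ?ReN ?ImN /=.
- apply: (density_increment M0 L0 ab mk1 (bound _ (@modc_Re R)) g1) => //.
  by move=> psi c' d' h1 h2 h3 h4; have [] := key psi c' d' h1 h2 h3 h4.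
- apply: (density_increment M0 L0 ab mk2 (bound _ (@modc_Im R)) g2) => //.
  by move=> psi c' d' h1 h2 h3 h4; have [] := key psi c' d' h1 h2 h3 h4.
Qed.

Lemma has_derivative_average (k g : R -> R[i]) (L a b x0 : R) (gamma : R[i]) :
  0 < L -> a < x0 -> x0 < b -> Clipschitz L g -> Linfty `]a, b[ k ->
  eq_distribution `]a, b[ (regular_distribution `]a, b[ k) (derivative_functional a b g) ->
  has_derivative g x0 gamma ->
  ((x - x0)^-1)%:C * oriented_integral x0 x k @[x --> x0^'] --> (gamma : R[i]^o).
Proof.
move=> L0 ax0 x0b gL kL E dg.
have ab : a < b by exact: lt_trans x0b.
have inc := Cdensity_increment L0 ab gL kL E.
apply/CcvgP => e e0; have [d d0 Hd] := dg e e0.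
rewrite near_withinE; apply/nbhs_normP.
exists (Num.min d (Num.min (x0 - a) (b - x0))); first by rewrite /= !lt_min d0 !subr_gt0 ax0.
move=> x /=; rewrite !lt_min => /and3P[xd xa xb] xx0.
have {}xa : a < x by have := ler_norm (x0 - x); lra.
have {}xb : x < b by have := ler_norm (x - x0); rewrite distrC; lra.
have -> : oriented_integral x0 x k = g x - g x0.
  rewrite /oriented_integral; have [x0x|/ltW xx0'] := leP x0 x; first exact: inc.
  by rewrite inc// opprB.
have t0 : 0 < `|x - x0| by rewrite normr_gt0 subr_eq0.
have -> : ((x - x0)^-1)%:C * (g x - g x0) - gamma = ((x - x0)^-1)%:C *
    (g (x0 + (x - x0)) - g x0 - gamma * (x - x0)%:C).
  rewrite (_ : x0 + (x - x0) = x); last by ring.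
  rewrite [RHS]mulrBr; congr (_ - _); rewrite mulrCA -rmorphM mulVf ?mulr1//.
  by rewrite subr_eq0.
rewrite modcM modc_real normfV ler_pdivrMl// [leRHS]mulrC.
by apply: Hd; rewrite distrC ltW.
Qed.

End DensityIncrement.

Theorem theorem1 (R : realType) (a b r : R) (F : R[i] -> R[i])
    (hab : a < b) (hr : 0 < r)
    (hF : analytic_on (rectangle a b r) F)
    (hFb : bounded_on (rectangle a b r) F) :
  (exists f : (R -> R[i]) -> R[i],
     is_distribution `]a, b[ f /\ boundary_value a b F f) /\
  (forall f : (R -> R[i]) -> R[i],
     is_distribution `]a, b[ f -> boundary_value a b F f ->
     (exists g : R -> R[i], Linfty `]a, b[ g /\
        eq_distribution `]a, b[ f (regular_distribution `]a, b[ g)) /\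
     (forall (x0 : R) (gamma : R[i]), a < x0 -> x0 < b ->
        right_lateral_limit f x0 gamma ->
        [/\ point_value f x0 gamma,
            point_value_of_order 1 `]a, b[ f x0 gamma &
            forall g : R -> R[i], Linfty `]a, b[ g ->
              eq_distribution `]a, b[ f (regular_distribution `]a, b[ g) ->
              ((x - x0)^-1)%:C * oriented_integral x0 x g @[x --> x0^']
                --> (gamma : R[i]^o)])).
Proof.
have [M M0 FM] : exists2 M : R, 0 < M &
    forall x y, a < x < b -> 0 < y < r -> modc (F (x +i* y)) <= M.
  have [M HM] := hFb; exists (`|M| + 1); first by rewrite ltr_wpDl.
  move=> x y /andP[ax xb] /andP[y0 yr].
  have /HM : rectangle a b r (x +i* y) by split.
  by rewrite le_normC; have := ler_norm M; lra.
have dF x y : a < x < b -> 0 < y < r -> exists D, Cdiff F (x +i* y) D.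
  move=> /andP[ax xb] /andP[y0 yr]; apply: derivable_Cdiff; apply: hF.
  by split.
have [G [G1 G2 dG eG]] := lipschitz_primitive hab hr M0 dF FM.
pose g x := G x 0.
have gL : Clipschitz M g.
  split=> x x'; first by have := G1 x 0 x' 0; rewrite subrr normr0 addr0.
  by have := G2 x 0 x' 0; rewrite subrr normr0 addr0.
have bv : boundary_value a b F (derivative_functional a b g).
  apply: (boundary_value_primitive M0 hab hr G1 G2 _ dG) => x y xab y0r.
  by have [D FD] := dF x y xab y0r; exact: Cdiff_horizontal FD.
split.
  exists (derivative_functional a b g); split=> //.
  exact: derivative_functional_distribution gL.
move=> f _ bf; have fE := boundary_value_unique bf bv; split.
  have [k [kL dk]] := Clipschitz_density M0 hab gL; exists k; split=> //.
  have [mk1 mk2 _] := kL => phi tphi; rewrite (fE _ tphi) /regular_distribution.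
  by rewrite (Cby_parts M0 hab gL mk1 mk2 dk tphi).
move=> x0 gamma ax0 x0b lat.
have right := right_lateral_derivative M0 ax0 x0b gL fE lat.
have x0ab : a < x0 < b by rewrite ax0.
have M20 : 0 < 2 * M by rewrite mulr_gt0.
have GL x y x' y' : modc (G x y - G x' y') <= 2 * M * (`|x - x'| + `|y - y'|).
  by rewrite -mulrA; apply: modc_le2; rewrite !ReImE.
have left := left_derivative M20 x0ab hr GL eG right.
have dg : has_derivative g x0 gamma.
  move=> e e0; have [d d0 Hd] := right e e0; have [d' d'0 Hd'] := left e e0.
  exists (Num.min d d'); first by rewrite lt_min d0.
  move=> h; rewrite le_min => /andP[hd hd'].
  have [h0|h0|->] := ltgtP h 0; last first.
  - by rewrite addr0 subrr mulr0 subr0 modc0 normr0 mulr0.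
  - by rewrite gtr0_norm// in hd *; exact: Hd.
  rewrite ltr0_norm// in hd' *.
  have := Hd' (- h); rewrite oppr_gt0 opprK => /(_ h0 hd').
  by rewrite rmorphN mulrN.
split.
- exact: derivative_point_value M0 ax0 x0b gL fE dg.
- exact: derivative_order_one M0 ax0 x0b gL fE dg.
move=> k kL fk.
apply: (has_derivative_average M0 ax0 x0b gL kL _ dg) => phi tphi.
by rewrite -fk// fE.
Qed.
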